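(* Let $\alpha>0$, $n\in\mathbb N$ and $k\in\{1,\ldots,n\}$ with $\alpha n>1$. Then $$ \tilde{\mathbf J}_{n,k}\Big(\frac{\alpha+n-1}{2}\Big)=\binom nk\int_{-\pi/2}^{\pi/2}\tilde c_{\frac{\alpha n}{2}}(\cos x)^{\alpha n-2}\Big(\frac12+i\int_0^x\tilde c_{\frac{\alpha+1}{2}}(\cos y)^{-\alpha}dy\Big)^{n-k}dx. $$
   Context: For $d\in\mathbb N$ and $\beta>d/2$ the $d$-dimensional beta' distribution has density $\tilde f_{d,\beta}(x)=\tilde c_{d,\beta}(1+\|x\|^2)^{-\beta}$, $x\in\mathbb R^d$, with $\tilde c_{d,\beta}=\Gamma(\beta)/(\pi^{d/2}\Gamma(\beta-\frac d2))$. Write $\tilde c_\beta:=\tilde c_{1,\beta}=\Gamma(\beta)/(\sqrt\pi\,\Gamma(\beta-\frac12))$. The internal angle $\beta(F,T)$ of a simplex $T\subset\mathbb R^d$ at a face $F$ is $\lim_{r\downarrow0}\mathrm{Vol}_d(B_r(z)\cap T)/\mathrm{Vol}_d(B_r(z))$, $z$ in the relative interior of $F$. For $n\ge2$, $\beta>\frac{n-1}{2}$ and $\tilde X_1,\ldots,\tilde X_n$ i.i.d. in $\mathbb R^{n-1}$ with density $\tilde f_{n-1,\beta}$, $\tilde{\mathbf J}_{n,k}(\beta)=\binom nk\,\mathbb E\,\beta([\tilde X_1,\ldots,\tilde X_k],[\tilde X_1,\ldots,\tilde X_n])$, $k\in\{1,\ldots,n\}$; by convention $\tilde{\mathbf J}_{n,n}(\beta)=1$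 for all $n\in\mathbb N$. Here $i=\sqrt{-1}$. *)

(* Defs.v *)
From HB Require Import structures.
From mathcomp Require Import all_boot all_order all_algebra.
From mathcomp Require Import all_classical all_reals all_analysis.
From mathcomp.real_closed Require Import complex.

Set Implicit Arguments.
Unset Strict Implicit.
Unset Printing Implicit Defensive.

Import Order.TTheory GRing.Theory Num.Theory.
Import numFieldNormedType.Exports.

Local Open Scope classical_set_scope.
Local Open Scope ring_scope.

Section Defs.
Variable R : realType.

Definition Gamma (s : R) : R :=
  Rintegral lebesgue_measure `]0, +oo[%classic (fun t => t `^ (s - 1) * expR (- t)).

(* Euclidean norm on R^d = 'rV[R]_d (the library norm on matrices is the sup norm). *)
Definition enorm (d : nat) (x : 'rV[R]_d) : R :=
  Num.sqrt (\sum_(i < d) x ord0 i ^+ 2).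

Definition eball (d : nat) (z : 'rV[R]_d) (r : R) : set 'rV[R]_d :=
  [set x | enorm (x - z) < r].

(* Lebesgue integral over R^d of a non-negative extended-real function,
   computed as the iterated one-dimensional Lebesgue integral (Tonelli). *)
Fixpoint intRd (d : nat) : ('rV[R]_d -> \bar R) -> \bar R :=
  match d return ('rV[R]_d -> \bar R) -> \bar R with
  | 0 => fun f => f 0
  | d'.+1 => fun f =>
      (\int[lebesgue_measure]_(t in [set: R])
         intRd (fun y : 'rV[R]_d' => f (row_mx (t%:M : 'M[R]_1) y)))%E
  end.

Definition vol (d : nat) (A : set 'rV[R]_d) : \bar R :=
  intRd (fun x => (\1_A x)%:E).

Definition ctd (d : nat) (b : R) : R :=
  Gamma b / (pi `^ (d%:R / 2) * Gamma (b - d%:R / 2)).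

Definition ct (b : R) : R := ctd 1 b.

Definition betap_density (d : nat) (b : R) (x : 'rV[R]_d) : R :=
  ctd d b * (1 + enorm x ^+ 2) `^ (- b).

Definition conv_rows (n d : nat) (X : 'M[R]_(n, d)) (P : pred 'I_n) : set 'rV[R]_d :=
  [set x | exists l : 'I_n -> R,
     [/\ forall i, 0 <= l i, forall i, ~~ P i -> l i = 0,
         \sum_(i < n) l i = 1 & x = \sum_(i < n) l i *: row i X]].

(* Internal angle of the simplex T at a face F, evaluated at a point z of the
   relative interior of F:  lim_{r -> 0+} Vol(B_r(z) /\ T) / Vol(B_r(z)). *)
Definition internal_angle_at (d : nat) (T : set 'rV[R]_d) (z : 'rV[R]_d) : R :=
  lim ((fun r : R => fine (vol (eball z r `&` T)) / fine (vol (eball z r)))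
         @ 0^'+).

(* beta([X_1..X_k], [X_1..X_n]) : z is the barycentre of X_1..X_k, which lies
   in the relative interior of the face [X_1,...,X_k]. *)
Definition face_angle (n d : nat) (X : 'M[R]_(n, d)) (k : nat) : R :=
  internal_angle_at (conv_rows X predT)
    ((k%:R)^-1 *: \sum_(i < n | (i < k)%N) row i X).

(* E beta([X_1..X_k],[X_1..X_n]) for X_1..X_n iid with density tilde f_{n-1,b}
   in R^(n-1): integral over (R^(n-1))^n of the angle times the product density. *)
Definition expected_angle (n k : nat) (b : R) : \bar R :=
  intRd (fun v : 'rV[R]_(n * n.-1) =>
    let X : 'M[R]_(n, n.-1) := vec_mx v in
    (face_angle X k * \prod_(i < n) betap_density b (row i X))%:E).

(* tilde J_{n,k}(beta), with the convention tilde J_{n,n} = 1. *)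
Definition Jt (n k : nat) (b : R) : R :=
  if k == n then 1 else 'C(n, k)%:R * fine (expected_angle n k b).

Definition oint (a b : R) (f : R -> R) : R :=
  if a <= b then Rintegral lebesgue_measure `[a, b] f
  else - Rintegral lebesgue_measure `[b, a] f.

Local Open Scope complex_scope.

Definition cintegral (a b : R) (g : R -> R[i]) : R[i] :=
  (Rintegral lebesgue_measure `[a, b] (fun x => complex.Re (g x)))%:C
  + (@Complex R 0 1) * (Rintegral lebesgue_measure `[a, b] (fun x => complex.Im (g x)))%:C.

End Defs.

(* Main.v *)
Require Import Defs.
From HB Require Import structures.
From mathcomp Require Import all_boot all_order all_algebra.
From mathcomp Require Import all_classical all_reals all_analysis.
From mathcomp Require Import measurable_realfun.
From mathcomp.real_closed Require Import complex polyrcf.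
From mathcomp Require Import ring lra.

Set Implicit Arguments.
Unset Strict Implicit.
Unset Printing Implicit Defensive.

Import Order.TTheory GRing.Theory Num.Theory.
Import numFieldNormedType.Exports.

Local Open Scope classical_set_scope.
Local Open Scope ring_scope.

(* Write [n = d + 1].  The angle of the simplex with vertices [X_0, ..., X_d] at its
   first [k] vertices is a Gaussian integral of [exp (- |sum_i h_i X_i|^2)] over a cone [K] of
   vectors [h] with [sum_i h_i = 0], times the Jacobian [|det (X_i - X_0)|].  Each
   density [(1 + |x|^2)^(-b)] is a Gamma mixture of Gaussians [exp (- t |x|^2)], so the [X_i] can be
   integrated out exactly; by homogeneity what remains is, up to a factor that does not depend on
   [K], the integral over [K] of [prod_i q (h_i)], where
   [q x = int t^((alpha - 3) / 2) exp (- t - x^2 / t) dt].  The factor is eliminated by comparison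
   with the case [k = n], where [K] is everything and the angle is 1.

   The constraint [sum_i h_i = 0] makes this a convolution at the origin, hence by Fourier inversion
   an integral of [A^k B^(n-k)], [A] and [B] being the Fourier transforms of [q] on the line and on
   the half-line.  Under [v = 2 tan x],
   [B v = sqrt pi * Gamma (alpha / 2) * cos^alpha x * (1/2 + i c int_0^x cos^(-alpha))]
   and [A = 2 Re B]; the imaginary part is a superposition of Dawson integrals. *)

(** After the [X_i] are gone, the weight still contains [sqrt (sum_i t_i)] and
    [(1 + sum_i h_i^2 / t_i)^(-n/2)], neither of which splits over the indices. Both disappear
    because the cone is invariant under dilations: a further Gamma mixture turns the power into a
    Gaussian, the root is absorbed by rescaling [t], and each operation costs a factor that does not
    see the cone. These factors are never evaluated and could a priori be infinite, so the
    comparison with [k = n] is an identity between products of extended reals; finiteness comes from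
    the final Fourier integral.

    Fourier inversion is applied to a Gaussian only. Vertex 0 lies in the face, so
    [h_0 = - sum_(i > 0) h_i] carries no sign condition, and for a fixed mixing variable its factor
    is a Gaussian, the explicit transform of another Gaussian. Inversion then reduces to Fubini, one
    coordinate at a time. The analytic difficulty is absolute convergence: [A] decays like
    [|v|^(-alpha)], but [B] never faster than [1 / |v|], and the two rates must be combined to reach
    the threshold [alpha n > 1]. *)

Definition matrix_display : measure_display.
Proof. exact: default_measure_display. Qed.

(** * The coordinate sigma-algebra on matrices *)

Section measurable_matrix.
Variables (T : realType) (m n : nat).

Let coords : 'I_(m * n) -> 'M[T]_(m, n) -> T := fun i A => mxvec A ord0 i.

Let matrix_set0 : g_sigma_preimage coords set0.
Proof. exact: sigma_algebra0. Qed.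

Let matrix_setC A : g_sigma_preimage coords A -> g_sigma_preimage coords (~` A).
Proof. exact: sigma_algebraC. Qed.

Let matrix_bigcup (F : _^nat) : (forall i, g_sigma_preimage coords (F i)) ->
  g_sigma_preimage coords (\bigcup_i (F i)).
Proof. exact: sigma_algebra_bigcup. Qed.

HB.instance Definition _ := @isMeasurable.Build matrix_display
  'M[T]_(m, n) (g_sigma_preimage coords) matrix_set0 matrix_setC matrix_bigcup.

End measurable_matrix.

Section measurable_fun_matrix.
Context (d1 : measure_display) (T1 : measurableType d1) (T2 : realType).

Lemma measurable_entry m n (i : 'I_m) (j : 'I_n) :
  measurable_fun [set: 'M[T2]_(m, n)] (fun A : 'M[T2]_(m, n) => A i j).
Proof.
move=> _ Y mY; rewrite setTI; apply: sub_sigma_algebra => /=.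
rewrite -bigcup_seq/=; exists (mxvec_index i j) => /=.
  by rewrite mem_index_enum.
exists Y => //; rewrite setTI; apply/seteqP.
by split=> A /=; rewrite mxvecE.
Qed.

Lemma measurable_fun_mxP m n (f : T1 -> 'M[T2]_(m, n)) :
  (forall i j, measurable_fun [set: T1] (fun x => f x i j)) ->
  measurable_fun [set: T1] f.
Proof.
move=> mf.
have mf' (k : 'I_(m * n)) : measurable_fun setT (fun x => mxvec (f x) ord0 k).
  case/mxvec_indexP: k => i j.
  by rewrite (_ : (fun x => _) = (fun x => f x i j)) //; apply/funext => x; rewrite mxvecE.
suff h : g_sigma_preimage
    (fun i => (fun A : 'M[T2]_(m, n) => mxvec A ord0 i) \o f) `<=` measurable.
  move: h; rewrite g_sigma_preimage_comp => h.
  by move=> _ A mA; apply: h; exists A.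
apply: smallest_sub; first exact: sigma_algebra_measurable.
move=> A; rewrite -bigcup_seq /= => -[k _ [B mB <-]].
exact: mf'.
Qed.

End measurable_fun_matrix.

(** * Tonelli theorems for the iterated integral [intRd] *)

Section iterated_integral.
Variable R : realType.
Local Notation mu := (@lebesgue_measure R).
Local Open Scope ereal_scope.

Lemma measurable_fun_comp2 (d0 d1 d2 d3 : measure_display) (T : measurableType d0)
    (T1 : measurableType d1) (T2 : measurableType d2) (T3 : measurableType d3)
    (f : T1 -> T2 -> T3) (a : T -> T1) (b : T -> T2) :
  measurable_fun setT (fun p : T1 * T2 => f p.1 p.2) ->
  measurable_fun setT a -> measurable_fun setT b ->
  measurable_fun setT (fun x => f (a x) (b x)).
Proof.
move=> mf ma mb; apply: (measurableT_comp mf (g := fun x => (a x, b x))).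
exact: measurable_fun_pair.
Qed.

Lemma measurable_slice1 (d1 d2 d3 : measure_display) (T1 : measurableType d1)
    (T2 : measurableType d2) (T3 : measurableType d3) (f : T1 -> T2 -> T3) x :
  measurable_fun setT (fun p : T1 * T2 => f p.1 p.2) -> measurable_fun setT (f x).
Proof.
move=> mf; apply: (measurableT_comp mf (g := fun y => (x, y))).
exact: measurable_fun_pair.
Qed.

Lemma measurable_slice2 (d1 d2 d3 : measure_display) (T1 : measurableType d1)
    (T2 : measurableType d2) (T3 : measurableType d3) (f : T1 -> T2 -> T3) y :
  measurable_fun setT (fun p : T1 * T2 => f p.1 p.2) -> measurable_fun setT (f^~ y).
Proof.
move=> mf; apply: (measurableT_comp mf (g := fun x => (x, y))).
exact: measurable_fun_pair.
Qed.

Lemma measurable_row_mx (d0 : measure_display) (T : measurableType d0) d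
    (t : T -> R) (y : T -> 'rV[R]_d) :
  measurable_fun setT t -> measurable_fun setT y ->
  measurable_fun setT (fun x => row_mx ((t x)%:M : 'M[R]_1) (y x)).
Proof.
move=> mt my; apply: measurable_fun_mxP => i j; rewrite ord1.
case: (split_ordP j) => k ->.
  rewrite (_ : (fun _ => _) = t) //; apply/funext => x.
  by rewrite row_mxEl mxE !ord1 eqxx mulr1n.
rewrite (_ : (fun _ => _) = (fun x => y x ord0 k)).
  exact: (measurableT_comp (measurable_entry ord0 k) my).
by apply/funext => x; rewrite row_mxEr.
Qed.

Lemma intRd_ge0 d (f : 'rV[R]_d -> \bar R) : (forall x, 0 <= f x) -> 0 <= intRd f.
Proof.
elim: d f => [|d IH] f f0 //=; apply: integral_ge0 => t _.
by apply: IH.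
Qed.

Lemma eq_intRd d (f g : 'rV[R]_d -> \bar R) : f =1 g -> intRd f = intRd g.
Proof. by move=> /funext ->. Qed.

(** The parameter space is arbitrary because the induction on [d] enlarges it: peeling off one
    coordinate replaces [T] by [T * R]. *)
Lemma measurable_intRd d (d0 : measure_display) (T : measurableType d0)
    (f : T -> 'rV[R]_d -> \bar R) :
  measurable_fun setT (fun p : T * 'rV[R]_d => f p.1 p.2) -> (forall x y, 0 <= f x y) ->
  measurable_fun setT (fun x => intRd (f x)).
Proof.
elim: d d0 T f => [|d IH] d0 T f mf f0 /=.
  exact: measurable_slice2 mf.
apply: (measurable_fun_fubini_tonelli_F (m2 := mu)
  (fun p : T * R => intRd (fun y => f p.1 (row_mx (p.2%:M : 'M[R]_1) y)))).
  apply: (IH _ _ (fun (p : T * R) y => f p.1 (row_mx (p.2%:M : 'M[R]_1) y))) => //.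
  apply: (measurable_fun_comp2 mf).
    by apply: (measurableT_comp (f := fst)).
  apply: (@measurable_row_mx _ _ d (fun z => z.1.2) snd) => //.
  by apply: (measurableT_comp (f := snd)).
by move=> p; exact: intRd_ge0.
Qed.

Lemma measurable_cons_slice d (f : 'rV[R]_d.+1 -> \bar R) : measurable_fun setT f ->
  measurable_fun setT (fun p : R * 'rV[R]_d => f (row_mx (p.1%:M : 'M[R]_1) p.2)).
Proof.
move=> mf; apply: (measurableT_comp mf).
by apply: (@measurable_row_mx _ _ d fst snd).
Qed.

Lemma integral_intRd d (d0 : measure_display) (T : measurableType d0)
    (nu : {sigma_finite_measure set T -> \bar R}) (f : T -> 'rV[R]_d -> \bar R) :
  measurable_fun setT (fun p : T * 'rV[R]_d => f p.1 p.2) -> (forall x y, 0 <= f x y) ->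
  intRd (fun y => \int[nu]_x f x y) = \int[nu]_x intRd (f x).
Proof.
elim: d f => [|d IH] f mf f0 //=.
have mg : measurable_fun setT
    (fun p : (T * R) * 'rV[R]_d => f p.1.1 (row_mx (p.1.2%:M : 'M[R]_1) p.2)).
  apply: (measurable_fun_comp2 mf).
    by apply: (measurableT_comp (f := fst)).
  apply: (@measurable_row_mx _ _ d (fun z => z.1.2) snd) => //.
  by apply: (measurableT_comp (f := snd)).
transitivity (\int[mu]_t \int[nu]_x intRd (fun y => f x (row_mx (t%:M : 'M[R]_1) y))).
  apply: eq_integral => t _; apply: IH => //.
  apply: (measurableT_comp mg (g := fun p => ((p.1, t), p.2))).
  apply: measurable_fun_pair => //; exact: measurable_fun_pair.
rewrite [LHS](fubini_tonelli (m1 := mu) (m2 := nu)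
  (fun p : R * T => intRd (fun y => f p.2 (row_mx (p.1%:M : 'M[R]_1) y)))) //.
- apply: (@measurable_intRd d _ (R * T)%type
    (fun p y => f p.2 (row_mx (p.1%:M : 'M[R]_1) y))) => //.
  apply: (measurableT_comp mg (g := fun p : (R * T) * 'rV[R]_d => ((p.1.2, p.1.1), p.2))).
  apply: measurable_fun_pair => //; apply: measurable_fun_pair.
    by apply: (measurableT_comp (f := snd)) => //.
  by apply: (measurableT_comp (f := fst)) => //.
- by move=> p; exact: intRd_ge0.
Qed.

(** Induction on [d]: the line integral of the first coordinate is moved across the other [intRd] by
    [integral_intRd]. *)
Lemma intRd_swap d e (f : 'rV[R]_d -> 'rV[R]_e -> \bar R) :
  measurable_fun setT (fun p : 'rV[R]_d * 'rV[R]_e => f p.1 p.2) ->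
  (forall x y, 0 <= f x y) ->
  intRd (fun x => intRd (f x)) = intRd (fun y => intRd (f^~ y)).
Proof.
elim: d f => [|d IH] f mf f0 //=.
have mg : measurable_fun setT (fun p : (R * 'rV[R]_e) * 'rV[R]_d =>
    f (row_mx (p.1.1%:M : 'M[R]_1) p.2) p.1.2).
  apply: (measurable_fun_comp2 mf).
    apply: (@measurable_row_mx _ _ d (fun z => z.1.1) snd) => //.
    by apply: (measurableT_comp (f := fst)).
  by apply: (measurableT_comp (f := snd)).
transitivity (\int[mu]_t intRd (fun y => intRd (fun x => f (row_mx (t%:M : 'M[R]_1) x) y))).
  apply: eq_integral => t _; apply: (IH (fun x y => f (row_mx (t%:M : 'M[R]_1) x) y)) => //.
  apply: (measurableT_comp mg (g := fun p => ((t, p.2), p.1))).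
  by apply: measurable_fun_pair => //; exact: measurable_fun_pair.
rewrite -(@integral_intRd e _ _ mu (fun t y => intRd (fun x => f (row_mx (t%:M : 'M[R]_1) x) y))) //.
- exact: (@measurable_intRd d _ (R * 'rV[R]_e)%type
    (fun p x => f (row_mx (p.1%:M : 'M[R]_1) x) p.2)).
- by move=> *; exact: intRd_ge0.
Qed.

Lemma measurable_intRd_slice d (f : 'rV[R]_d.+1 -> \bar R) : measurable_fun setT f ->
  (forall x, 0 <= f x) ->
  measurable_fun setT (fun t : R => intRd (fun y => f (row_mx (t%:M : 'M[R]_1) y))).
Proof.
move=> mf f0.
apply: (@measurable_intRd d _ R (fun t y => f (row_mx (t%:M : 'M[R]_1) y))) => //.
exact: measurable_cons_slice.
Qed.

Lemma measurable_cons_slice1 d (f : 'rV[R]_d.+1 -> \bar R) t : measurable_fun setT f ->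
  measurable_fun setT (fun y => f (row_mx (t%:M : 'M[R]_1) y)).
Proof.
move=> mf; apply: (measurableT_comp mf).
by apply: (@measurable_row_mx _ _ d (fun=> t) id).
Qed.

Lemma intRdZl d (k : \bar R) (f : 'rV[R]_d -> \bar R) : measurable_fun setT f ->
  (forall x, 0 <= f x) -> 0 <= k -> intRd (fun x => k * f x) = k * intRd f.
Proof.
move=> + + k0; elim: d f => [|d IH] f mf f0 //=.
rewrite -ge0_integralZl //.
- by apply: eq_integral => t _; rewrite IH //; exact: measurable_cons_slice1.
- exact: measurable_intRd_slice.
- by move=> t _; exact: intRd_ge0.
Qed.

Lemma le_intRd d (f g : 'rV[R]_d -> \bar R) :
  measurable_fun setT f -> measurable_fun setT g ->
  (forall x, 0 <= f x) -> (forall x, f x <= g x) -> intRd f <= intRd g.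
Proof.
elim: d f g => [|d IH] f g mf mg f0 fg //=.
have g0 x : 0 <= g x by exact: le_trans (fg x).
apply: ge0_le_integral => //.
- by move=> t _; exact: intRd_ge0.
- exact: measurable_intRd_slice.
- exact: measurable_intRd_slice.
- by move=> t _; apply: IH => //; exact: measurable_cons_slice1.
Qed.

End iterated_integral.

(** * Row-major flattening of matrices *)

Section matrix_index.

Lemma index_allpairs (S T : eqType) (s : seq S) (t : seq T) x y :
  x \in s -> y \in t ->
  index (x, y) [seq (a, b) | a <- s, b <- t] = (index x s * size t + index y t)%N.
Proof.
move=> + yt; elim: s => //= a s IH; rewrite inE index_cat.
have [->|xa] /= := eqVneq x a.
  move=> _; rewrite mem_map; last by move=> ? ? [].
  rewrite yt index_map; last by move=> ? ? [].
  by rewrite mul0n.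
move=> xs; rewrite (negbTE (_ : _ \notin _)); last first.
  by apply/mapP => -[b _ [xa' _]]; rewrite xa' eqxx in xa.
by rewrite size_map IH // mulSn addnA.
Qed.

(** [mxvec_index] is a rank in the enumeration of pairs; its numerical value is what allows the
    first row to be split off a flattened matrix. *)
Lemma mxvec_indexE m n (i : 'I_m) (j : 'I_n) :
  mxvec_index i j = (i * n + j)%N :> nat.
Proof.
rewrite /mxvec_index /=.
have -> : enum_rank (i, j) = index (i, j) (enum {: 'I_m * 'I_n}) :> nat.
  rewrite -[X in index X _](nth_enum_rank (i, j)) index_uniq ?enum_uniq //.
  by rewrite -cardE.
rewrite enumT unlock /= /prod_enum index_allpairs ?mem_enum //.
by rewrite !index_enum_ord size_enum_ord.
Qed.

(** Makes integration over matrices recursive in the rows, see [intMS]. *)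
Lemma vec_mx_row (R : nzRingType) m n (r : 'rV[R]_n) (w : 'rV[R]_(m * n)) :
  vec_mx (row_mx r w : 'rV[R]_(m.+1 * n)) = col_mx r (vec_mx w) :> 'M[R]_(1 + m, n).
Proof.
apply/matrixP => i j; rewrite [LHS]mxE.
case: (split_ordP i) => k ->.
  rewrite ord1 col_mxEu.
  have -> : @mxvec_index m.+1 n (@lshift 1 m ord0) j = lshift (m * n) j.
    by apply/val_inj; rewrite [LHS]mxvec_indexE mul0n.
  by rewrite row_mxEl.
rewrite col_mxEd [RHS]mxE.
have -> : @mxvec_index m.+1 n (@rshift 1 m k) j = rshift n (mxvec_index k j).
  apply/val_inj; rewrite [LHS]mxvec_indexE.
  transitivity (n + mxvec_index k j)%N => //.
  by rewrite mxvec_indexE addnA -mulSn.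
by rewrite row_mxEr.
Qed.

End matrix_index.

(** * Affine substitution on the line *)

Section one_dim.
Variable R : realType.
Local Notation mu := (@lebesgue_measure R).
Local Open Scope ereal_scope.

(** The push-forward of Lebesgue measure under the affine map, multiplied by [a], agrees with
    Lebesgue measure on half-open intervals, hence everywhere by uniqueness. *)
Lemma ge0_integral_affine_pos (a c : R) (f : R -> \bar R) : (0 < a)%R ->
  measurable_fun setT f -> (forall x, 0 <= f x) ->
  a%:E * \int[mu]_x f (a * x + c)%R = \int[mu]_x f x.
Proof.
move=> a0 mf f0.
pose phi (x : R) : measurableTypeR R := (a * x + c)%R.
have mphi : measurable_fun [set: measurableTypeR R] phi.
  by apply: measurable_funD => //; exact: measurable_funM.
pose a' : {nonneg R} := NngNum (ltW a0).
pose nu := mscale a' (pushforward mu phi).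
transitivity (\int[nu mphi]_x f x).
  rewrite ge0_integral_mscale //.
  by rewrite ge0_integral_pushforward // preimage_setT.
apply: eq_measure_integral => A mA _; apply/esym.
apply: lebesgue_measure_unique => // _ [[s t]] _ <-.
rewrite /= /mscale /= /pushforward.
have -> : phi @^-1` `]s, t] = `](s - c) / a, (t - c) / a]%classic%R.
  apply/seteqP; split => x /=; rewrite !in_itv /= /phi ltr_pdivrMr // ler_pdivlMr // ltrBlDr lerBrDr;
  by rewrite (mulrC a).
rewrite !lebesgue_measure_itv /= !lte_fin ltr_pM2r ?invr_gt0 // ltrD2r.
case: ifP => // _; last by rewrite mule0.
by rewrite -!EFinB -EFinM; congr EFin; field; rewrite gt_eqF.
Qed.

Lemma ge0_integral_opp (f : R -> \bar R) :
  measurable_fun setT f -> (forall x, 0 <= f x) ->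
  \int[mu]_x f (- x)%R = \int[mu]_x f x.
Proof.
move=> mf f0.
transitivity (\int[pushforward mu (-%R : R -> measurableTypeR R)]_x f x).
  by rewrite ge0_integral_pushforward // preimage_setT.
by apply: eq_measure_integral => A mA _; exact: lebesgue_measureN.
Qed.

Lemma ge0_integral_affine (a c : R) (f : R -> \bar R) : (a != 0)%R ->
  measurable_fun setT f -> (forall x, 0 <= f x) ->
  `|a|%:E * \int[mu]_x f (a * x + c)%R = \int[mu]_x f x.
Proof.
move=> a0 mf f0; case: (ltP 0%R a) => [ap|aN].
  by rewrite gtr0_norm // ge0_integral_affine_pos.
have ap : (0 < - a)%R by rewrite oppr_gt0 lt_neqAle a0.
rewrite ltr0_norm -?oppr_gt0 // -ge0_integral_opp; last 2 first.
- apply: (measurableT_comp mf); apply: measurable_funD => //; exact: measurable_funM.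
- by [].
rewrite -(ge0_integral_affine_pos c ap mf f0); congr (_ * _).
by apply: eq_integral => x _; rewrite mulrN mulNr.
Qed.

End one_dim.

(** * Closure rules for real and matrix valued measurable functions *)

Section measurability_rules.
Context (d : measure_display) (T : measurableType d) (R : realType).
Implicit Types (f g : T -> R) (b c : T -> bool).

Lemma mfun_add f g : measurable_fun setT f -> measurable_fun setT g ->
  measurable_fun setT (fun x => f x + g x).
Proof. exact: measurable_funD. Qed.

Lemma mfun_mul f g : measurable_fun setT f -> measurable_fun setT g ->
  measurable_fun setT (fun x => f x * g x).
Proof. exact: measurable_funM. Qed.

Lemma mfun_opp f : measurable_fun setT f -> measurable_fun setT (fun x => - f x).
Proof. exact: measurable_funN. Qed.

Lemma mfun_exp f n : measurable_fun setT f -> measurable_fun setT (fun x => f x ^+ n).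
Proof. exact: measurable_funX. Qed.

Lemma mfun_inv f : measurable_fun setT f -> measurable_fun setT (fun x => (f x)^-1).
Proof.
move=> mf.
(* The inverse is discontinuous at 0, so it is expressed through the measurable power [-1], which
   agrees with it only for nonnegative arguments; negative ones are reflected. *)
rewrite (_ : (fun x => (f x)^-1) =
  (fun x => if f x < 0 then - (- f x) `^ (-1) else if f x == 0 then 0 else f x `^ (-1))).
  apply: measurable_fun_ifT; first exact: measurable_fun_ltr.
    apply: measurable_funN; apply: (measurableT_comp (measurable_powR (R := R) (-1))).
    exact: measurable_funN.
  apply: measurable_fun_ifT => //; first exact: measurable_fun_eqr.
  exact: (measurableT_comp (measurable_powR (R := R) (-1))).
apply/funext => x; case: ltP => h.
  by rewrite powR_inv1 ?oppr_ge0 ?ltW // invrN opprK.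
case: eqP => [->|_]; first by rewrite invr0.
by rewrite powR_inv1.
Qed.

Lemma mfun_norm f : measurable_fun setT f -> measurable_fun setT (fun x => `|f x|).
Proof. by move=> mf; exact: (measurableT_comp (@normr_measurable R setT)). Qed.

Lemma mfun_expR f : measurable_fun setT f -> measurable_fun setT (fun x => expR (f x)).
Proof. by move=> mf; exact: (measurableT_comp (@measurable_expR R)). Qed.

Lemma mfun_powR f p : measurable_fun setT f -> measurable_fun setT (fun x => f x `^ p).
Proof. by move=> mf; exact: (measurableT_comp (measurable_powR (R := R) p)). Qed.

Lemma mfun_sqrt f : measurable_fun setT f -> measurable_fun setT (fun x => Num.sqrt (f x)).
Proof.
move=> mf; have m := continuous_measurable_fun (@sqrt_continuous R).
exact: (measurableT_comp m mf).
Qed.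

Lemma mfun_cos f : measurable_fun setT f -> measurable_fun setT (fun x => cos (f x)).
Proof.
move=> mf; have m := continuous_measurable_fun (@continuous_cos R).
exact: (measurableT_comp m mf).
Qed.

Lemma mfun_sin f : measurable_fun setT f -> measurable_fun setT (fun x => sin (f x)).
Proof.
move=> mf; have m := continuous_measurable_fun (@continuous_sin R).
exact: (measurableT_comp m mf).
Qed.

Lemma mfun_bigsum (I : Type) (s : seq I) (P : pred I) (h : I -> T -> R) :
  (forall i, measurable_fun setT (h i)) ->
  measurable_fun setT (fun x => \sum_(i <- s | P i) h i x).
Proof.
move=> mh; elim: s => [|i s IH]; first (under eq_fun do rewrite big_nil; exact: measurable_cst).
under eq_fun do rewrite big_cons; case: (P i) => //; exact: mfun_add.
Qed.

Lemma mfun_bigprod (I : Type) (s : seq I) (P : pred I) (h : I -> T -> R) :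
  (forall i, measurable_fun setT (h i)) ->
  measurable_fun setT (fun x => \prod_(i <- s | P i) h i x).
Proof.
move=> mh; elim: s => [|i s IH]; first (under eq_fun do rewrite big_nil; exact: measurable_cst).
under eq_fun do rewrite big_cons; case: (P i) => //; exact: mfun_mul.
Qed.

Lemma mfun_natbool b : measurable_fun setT b -> measurable_fun setT (fun x => (b x)%:R : R).
Proof.
move=> mb; rewrite (_ : (fun x => _) = (fun x => if b x then 1 else 0 : R)).
  exact: measurable_fun_ifT.
by apply/funext => x; case: (b x).
Qed.

Lemma mfun_forall (I : finType) (h : I -> T -> bool) :
  (forall i, measurable_fun setT (h i)) -> measurable_fun setT (fun x => [forall i, h i x]).
Proof.
move=> mh; rewrite (_ : (fun x => _) = (fun x => \big[andb/true]_i h i x)); last first.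
  by apply/funext => x; rewrite big_andE.
elim: (index_enum I) => [|i s IH]; first (under eq_fun do rewrite big_nil; exact: measurable_cst).
by under eq_fun do rewrite big_cons; exact: measurable_and.
Qed.

Lemma mfun_EFin f : measurable_fun setT f -> measurable_fun setT (fun x => (f x)%:E).
Proof. by move=> mf; exact/measurable_EFinP. Qed.

Lemma mfun_mule (f g : T -> \bar R) : measurable_fun setT f -> measurable_fun setT g ->
  measurable_fun setT (fun x => f x * g x)%E.
Proof. exact: emeasurable_funM. Qed.

Lemma mfun_adde (f g : T -> \bar R) : measurable_fun setT f -> measurable_fun setT g ->
  measurable_fun setT (fun x => f x + g x)%E.
Proof. exact: emeasurable_funD. Qed.

Lemma mfun_bigprode (I : Type) (s : seq I) (P : pred I) (h : I -> T -> \bar R) :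
  (forall i, measurable_fun setT (h i)) ->
  measurable_fun setT (fun x => \prod_(i <- s | P i) h i x)%E.
Proof.
move=> mh; elim: s => [|i s IH]; first (under eq_fun do rewrite big_nil; exact: measurable_cst).
under eq_fun do rewrite big_cons; case: (P i) => //; exact: mfun_mule.
Qed.

Lemma mfun_entry m n (X : T -> 'M[R]_(m, n)) i j :
  measurable_fun setT X -> measurable_fun setT (fun x => X x i j).
Proof. by move=> mX; exact: (measurableT_comp (measurable_entry i j) mX). Qed.

Lemma mfun_mx m n (E : T -> 'I_m -> 'I_n -> R) :
  (forall i j, measurable_fun setT (fun x => E x i j)) ->
  measurable_fun setT (fun x => \matrix_(i, j) E x i j).
Proof. by move=> mE; apply: measurable_fun_mxP => i j; under eq_fun do rewrite mxE; exact: mE. Qed.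

Lemma mfun_addmx m n (X Y : T -> 'M[R]_(m, n)) :
  measurable_fun setT X -> measurable_fun setT Y -> measurable_fun setT (fun x => X x + Y x).
Proof.
move=> mX mY; apply: measurable_fun_mxP => i j; under eq_fun do rewrite mxE.
by apply: mfun_add; exact: mfun_entry.
Qed.

Lemma mfun_oppmx m n (X : T -> 'M[R]_(m, n)) :
  measurable_fun setT X -> measurable_fun setT (fun x => - X x).
Proof.
move=> mX; apply: measurable_fun_mxP => i j; under eq_fun do rewrite mxE.
by apply: mfun_opp; exact: mfun_entry.
Qed.

Lemma mfun_scalemx m n f (X : T -> 'M[R]_(m, n)) :
  measurable_fun setT f -> measurable_fun setT X -> measurable_fun setT (fun x => f x *: X x).
Proof.
move=> mf mX; apply: measurable_fun_mxP => i j; under eq_fun do rewrite mxE.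
by apply: mfun_mul => //; exact: mfun_entry.
Qed.

Lemma mfun_mulmx m n p (X : T -> 'M[R]_(m, n)) (Y : T -> 'M[R]_(n, p)) :
  measurable_fun setT X -> measurable_fun setT Y -> measurable_fun setT (fun x => X x *m Y x).
Proof.
move=> mX mY; apply: measurable_fun_mxP => i j; under eq_fun do rewrite mxE.
by apply: mfun_bigsum => k; apply: mfun_mul; exact: mfun_entry.
Qed.

Lemma mfun_trmx m n (X : T -> 'M[R]_(m, n)) :
  measurable_fun setT X -> measurable_fun setT (fun x => (X x)^T).
Proof.
move=> mX; apply: measurable_fun_mxP => i j; under eq_fun do rewrite mxE.
exact: mfun_entry.
Qed.

Lemma mfun_row m n (X : T -> 'M[R]_(m, n)) i :
  measurable_fun setT X -> measurable_fun setT (fun x => row i (X x)).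
Proof.
move=> mX; apply: measurable_fun_mxP => i' j; under eq_fun do rewrite mxE.
exact: mfun_entry.
Qed.

Lemma mfun_scalar n f : measurable_fun setT f -> measurable_fun setT (fun x => (f x)%:M : 'M[R]_n).
Proof.
move=> mf; apply: measurable_fun_mxP => i j; under eq_fun do rewrite mxE.
by case: (i == j) => //; (under eq_fun do rewrite mulr0n; exact: measurable_cst).
Qed.

Lemma mfun_row_mx m n p (X : T -> 'M[R]_(m, n)) (Y : T -> 'M[R]_(m, p)) :
  measurable_fun setT X -> measurable_fun setT Y ->
  measurable_fun setT (fun x => row_mx (X x) (Y x)).
Proof.
move=> mX mY; apply: measurable_fun_mxP => i j.
case: (split_ordP j) => k ->.
  by under eq_fun do rewrite row_mxEl; exact: mfun_entry.
by under eq_fun do rewrite row_mxEr; exact: mfun_entry.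
Qed.

Lemma mfun_col_mx m n p (X : T -> 'M[R]_(m, p)) (Y : T -> 'M[R]_(n, p)) :
  measurable_fun setT X -> measurable_fun setT Y ->
  measurable_fun setT (fun x => col_mx (X x) (Y x)).
Proof.
move=> mX mY; apply: measurable_fun_mxP => i j.
case: (split_ordP i) => k ->.
  by under eq_fun do rewrite col_mxEu; exact: mfun_entry.
by under eq_fun do rewrite col_mxEd; exact: mfun_entry.
Qed.

Lemma mfun_usubmx m n p (X : T -> 'M[R]_(m + n, p)) :
  measurable_fun setT X -> measurable_fun setT (fun x => usubmx (X x)).
Proof.
move=> mX; apply: measurable_fun_mxP => i j; under eq_fun do rewrite mxE.
exact: mfun_entry.
Qed.

Lemma mfun_dsubmx m n p (X : T -> 'M[R]_(m + n, p)) :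
  measurable_fun setT X -> measurable_fun setT (fun x => dsubmx (X x)).
Proof.
move=> mX; apply: measurable_fun_mxP => i j; under eq_fun do rewrite mxE.
exact: mfun_entry.
Qed.

Lemma mfun_vec_mx m n (X : T -> 'rV[R]_(m * n)) :
  measurable_fun setT X -> measurable_fun setT (fun x => vec_mx (X x)).
Proof.
move=> mX; apply: measurable_fun_mxP => i j; under eq_fun do rewrite mxE.
exact: mfun_entry.
Qed.

Lemma mfun_det n (X : T -> 'M[R]_n) :
  measurable_fun setT X -> measurable_fun setT (fun x => \det (X x)).
Proof.
move=> mX; rewrite /determinant; apply: mfun_bigsum => s; apply: mfun_mul => //.
by apply: mfun_bigprod => i; exact: mfun_entry.
Qed.

Lemma mfun_enorm n (X : T -> 'rV[R]_n) :
  measurable_fun setT X -> measurable_fun setT (fun x => enorm (X x)).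
Proof.
move=> mX; apply: mfun_sqrt; apply: mfun_bigsum => i.
by apply: mfun_exp; exact: mfun_entry.
Qed.

End measurability_rules.

(** The head symbol of the body selects the closure rule; a function that is not an abstraction is
    eta-expanded so that a rule can match. *)
Ltac mfun_step :=
  lazymatch goal with
  | |- measurable_fun _ ?F =>
    first [ assumption | exact: measurable_cst | exact: measurable_id
          | exact: measurable_fst | exact: measurable_snd |
    lazymatch F with
    | fst => exact: measurable_fst
    | snd => exact: measurable_snd
    | fun x => fst x => exact: measurable_fst
    | fun x => snd x => exact: measurable_snd
    | fun x => fst (@?g x) => apply: (measurableT_comp measurable_fst (g := g))
    | fun x => snd (@?g x) => apply: (measurableT_comp measurable_snd (g := g))
    | fun x => GRing.add _ _ => first [apply: mfun_add | apply: mfun_addmx]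
    | fun x => GRing.opp _ => first [apply: mfun_opp | apply: mfun_oppmx]
    | fun x => GRing.mul _ _ => apply: mfun_mul
    | fun x => GRing.exp _ _ => apply: mfun_exp
    | fun x => GRing.inv _ => apply: mfun_inv
    | fun x => GRing.scale _ _ => apply: mfun_scalemx
    | fun x => GRing.natmul _ (nat_of_bool _) => apply: mfun_natbool
    | fun x => Num.norm _ => apply: mfun_norm
    | fun x => expR _ => apply: mfun_expR
    | fun x => powR _ _ => apply: mfun_powR
    | fun x => Num.sqrt _ => apply: mfun_sqrt
    | fun x => cos _ => apply: mfun_cos
    | fun x => sin _ => apply: mfun_sin
    | fun x => andb _ _ => apply: measurable_and
    | fun x => negb _ => apply: measurable_neg
    | fun x => Order.lt _ _ => apply: measurable_fun_ltr
    | fun x => Order.le _ _ => apply: measurable_fun_ler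
    | fun x => eq_op _ _ => apply: measurable_fun_eqr
    | fun x => if _ then _ else _ => apply: measurable_fun_ifT
    | fun x => EFin _ => apply: mfun_EFin
    | fun x => mule _ _ => apply: mfun_mule
    | fun x => adde _ _ => apply: mfun_adde
    | fun x => determinant _ => apply: mfun_det
    | fun x => enorm _ => apply: mfun_enorm
    | fun x => mulmx _ _ => apply: mfun_mulmx
    | fun x => trmx _ => apply: mfun_trmx
    | fun x => row _ _ => apply: mfun_row
    | fun x => scalar_mx _ => apply: mfun_scalar
    | fun x => @row_mx _ ?m ?n ?p _ _ => apply: (@mfun_row_mx _ _ _ m n p)
    | fun x => @col_mx _ ?m ?n ?p _ _ => apply: (@mfun_col_mx _ _ _ m n p)
    | fun x => @usubmx _ ?m ?n ?p _ => apply: (@mfun_usubmx _ _ _ m n p)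
    | fun x => @dsubmx _ ?m ?n ?p _ => apply: (@mfun_dsubmx _ _ _ m n p)
    | @vec_mx _ ?m ?n => apply: (@mfun_vec_mx _ _ _ m n id)
    | fun x => @vec_mx _ ?m ?n _ => apply: (@mfun_vec_mx _ _ _ m n)
    | fun x => fun_of_matrix _ _ _ => apply: mfun_entry
    | fun x => matrix_of_fun _ _ => apply: mfun_mx
    | fun x => FiniteQuant.quant0b _ => apply: mfun_forall
    | fun x => bigop _ _ _ => first [apply: mfun_bigsum | apply: mfun_bigprod | apply: mfun_bigprode]
    | fun x => _ => fail
    | _ => lazymatch goal with
           | |- @measurable_fun ?d1 ?d2 ?T ?U ?D ?F =>
             change (@measurable_fun d1 d2 T U D (fun x => F x))
           end
    end ]
  | |- forall _, _ => intro
  end.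
Ltac mfun := repeat mfun_step.

(** * Affine invariance in [R^d] and integration over matrices *)

Section affine_invariance.
Variable R : realType.
Local Notation mu := (@lebesgue_measure R).
Local Open Scope ereal_scope.

Lemma intRd_affine d (a : R) (c : 'rV[R]_d) (f : 'rV[R]_d -> \bar R) : (a != 0)%R ->
  measurable_fun setT f -> (forall x, 0 <= f x) ->
  (`|a| ^+ d)%:E * intRd (fun x => f (a *: x + c)%R) = intRd f.
Proof.
move=> a0; elim: d c f => [|d IH] c f mf f0.
  by rewrite expr0 mul1e /=; congr f; rewrite [LHS]thinmx0.
pose c0 := lsubmx (c : 'rV[R]_(1 + d)) ord0 ord0.
pose c' := rsubmx (c : 'rV[R]_(1 + d)).
have E t y : (a *: row_mx (t%:M : 'M[R]_1) y + c =
    row_mx ((a * t + c0)%:M : 'M[R]_1) (a *: y + c'))%R.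
  rewrite -[c in LHS](hsubmxK (c : 'rV[R]_(1 + d))) scale_row_mx add_row_mx.
  by congr row_mx; apply/matrixP => i j; rewrite !ord1 !mxE //= !mulr1n /c0 mxE.
rewrite [X in _ * X](_ : _ =
    \int[mu]_t intRd (fun y => f (row_mx ((a * t + c0)%:M : 'M[R]_1) (a *: y + c')%R))); last first.
  by apply: eq_integral => t _; apply: eq_intRd => y; rewrite E.
pose g s := intRd (fun y => f (row_mx (s%:M : 'M[R]_1) y)).
have mg : measurable_fun setT g by exact: measurable_intRd_slice.
have g0 s : 0 <= g s by exact: intRd_ge0.
rewrite -[RHS](ge0_integral_affine c0 a0 mg g0) exprS EFinM -muleA; congr (_ * _).
rewrite -ge0_integralZl //.
- apply: eq_integral => t _.
  rewrite -[RHS](IH c' (fun y => f (row_mx ((a * t + c0)%:M : 'M[R]_1) y))) //.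
  exact: measurable_cons_slice1.
- apply: (@measurable_intRd _ d _ R
    (fun t y => f (row_mx ((a * t + c0)%:M : 'M[R]_1) (a *: y + c')%R))) => //.
  by apply: (measurableT_comp mf); mfun.
- by move=> t _; exact: intRd_ge0.
Qed.

Lemma intRd_shift d (c : 'rV[R]_d) (f : 'rV[R]_d -> \bar R) :
  measurable_fun setT f -> (forall x, 0 <= f x) ->
  intRd (fun x => f (x + c)%R) = intRd f.
Proof.
move=> mf f0; rewrite -[RHS](intRd_affine c (oner_neq0 _) mf f0) normr1 expr1n mul1e.
by apply: eq_intRd => x; rewrite scale1r.
Qed.

Lemma intRd_scale d (a : R) (f : 'rV[R]_d -> \bar R) : (a != 0)%R ->
  measurable_fun setT f -> (forall x, 0 <= f x) ->
  (`|a| ^+ d)%:E * intRd (fun x => f (a *: x)%R) = intRd f.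
Proof.
move=> a0 mf f0; rewrite -[RHS](intRd_affine 0 a0 mf f0); congr (_ * _).
by apply: eq_intRd => x; rewrite addr0.
Qed.

Lemma intRd_cat d e (f : 'rV[R]_(d + e) -> \bar R) :
  intRd f = intRd (fun x : 'rV[R]_d => intRd (fun y : 'rV[R]_e => f (row_mx x y))).
Proof.
elim: d f => [|d IH] f /=.
  apply: eq_intRd => y; congr f; apply/rowP => i; rewrite mxE.
  by case: splitP => [[]//|k ik]; congr (y _ _); exact/val_inj.
apply: eq_integral => t _; rewrite IH.
apply: eq_intRd => x; apply: eq_intRd => y; congr f.
by rewrite row_mxA; exact: castmx_id.
Qed.


(** The same flattening by [vec_mx] as in [expected_angle], so that facts about [intM] apply to it
    by conversion. *)
Definition intM m n (f : 'M[R]_(m, n) -> \bar R) : \bar R :=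
  intRd (fun v : 'rV[R]_(m * n) => f (vec_mx v)).

Lemma eq_intM m n (f g : 'M[R]_(m, n) -> \bar R) : f =1 g -> intM f = intM g.
Proof. by move=> /funext ->. Qed.

Lemma intM0 n (f : 'M[R]_(0, n) -> \bar R) : intM f = f 0%R.
Proof. by rewrite /intM /=; congr f; rewrite [LHS]flatmx0. Qed.

Lemma intMS m n (f : 'M[R]_(m.+1, n) -> \bar R) :
  intM f = intRd (fun r => intM (fun Y : 'M[R]_(m, n) => f (col_mx r Y : 'M[R]_(1 + m, n)))).
Proof.
rewrite /intM (intRd_cat (d := n) (e := m * n)).
by apply: eq_intRd => r; apply: eq_intRd => w; rewrite vec_mx_row.
Qed.

Lemma measurable_vec_mx m n (f : 'M[R]_(m, n) -> \bar R) : measurable_fun setT f ->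
  measurable_fun setT (fun v : 'rV[R]_(m * n) => f (vec_mx v)).
Proof. by move=> mf; apply: (measurableT_comp mf); mfun. Qed.

Lemma intM_ge0 m n (f : 'M[R]_(m, n) -> \bar R) : (forall x, 0 <= f x) -> 0 <= intM f.
Proof. by move=> f0; apply: intRd_ge0. Qed.

Lemma measurable_intM m n (d0 : measure_display) (T : measurableType d0)
    (f : T -> 'M[R]_(m, n) -> \bar R) :
  measurable_fun setT (fun p : T * 'M[R]_(m, n) => f p.1 p.2) -> (forall x y, 0 <= f x y) ->
  measurable_fun setT (fun x => intM (f x)).
Proof.
move=> mf f0; apply: (@measurable_intRd _ _ _ T (fun x v => f x (vec_mx v))) => //.
by apply: (measurable_fun_comp2 mf); mfun.
Qed.

Lemma intM_swap m n e (f : 'M[R]_(m, n) -> 'rV[R]_e -> \bar R) :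
  measurable_fun setT (fun p : 'M[R]_(m, n) * 'rV[R]_e => f p.1 p.2) ->
  (forall x y, 0 <= f x y) ->
  intM (fun x => intRd (f x)) = intRd (fun y => intM (f^~ y)).
Proof.
move=> mf f0; apply: (intRd_swap (f := fun v y => f (vec_mx v) y)) => //.
by apply: (measurable_fun_comp2 mf); mfun.
Qed.

Lemma integral_intM m n (d0 : measure_display) (T : measurableType d0)
    (nu : {sigma_finite_measure set T -> \bar R}) (f : T -> 'M[R]_(m, n) -> \bar R) :
  measurable_fun setT (fun p : T * 'M[R]_(m, n) => f p.1 p.2) -> (forall x y, 0 <= f x y) ->
  intM (fun y => \int[nu]_x f x y) = \int[nu]_x intM (f x).
Proof.
move=> mf f0; apply: (integral_intRd nu (f := fun x v => f x (vec_mx v))) => //.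
by apply: (measurable_fun_comp2 mf); mfun.
Qed.

Lemma intMZl m n (k : \bar R) (f : 'M[R]_(m, n) -> \bar R) : measurable_fun setT f ->
  (forall x, 0 <= f x) -> 0 <= k -> intM (fun x => k * f x) = k * intM f.
Proof. by move=> mf f0 k0; apply: intRdZl => //; exact: measurable_vec_mx. Qed.

Lemma le_intM m n (f g : 'M[R]_(m, n) -> \bar R) :
  measurable_fun setT f -> measurable_fun setT g ->
  (forall x, 0 <= f x) -> (forall x, f x <= g x) -> intM f <= intM g.
Proof. by move=> mf mg f0 fg; apply: le_intRd => //; exact: measurable_vec_mx. Qed.

Lemma intM_shift m n (C : 'M[R]_(m, n)) (f : 'M[R]_(m, n) -> \bar R) :
  measurable_fun setT f -> (forall x, 0 <= f x) ->
  intM (fun x => f (x + C)%R) = intM f.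
Proof.
move=> mf f0; rewrite /intM -[RHS](intRd_shift (mxvec C)) //; last exact: measurable_vec_mx.
by apply: eq_intRd => v; rewrite linearD /= mxvecK.
Qed.

End affine_invariance.

(** * The Jacobian of left multiplication by a matrix *)

Section linear_change_of_variables.
Variable R : realType.
Local Open Scope ereal_scope.

(** [A] acts on each of the [n] columns separately, hence the Jacobian [|det A|^n]. As a property of
    [A] it is closed under products, which is what elimination needs. *)
Definition left_mul_scales m (A : 'M[R]_m) := forall n (f : 'M[R]_(m, n) -> \bar R),
  measurable_fun setT f -> (forall x, 0 <= f x) ->
  (`|\det A| ^+ n)%:E * intM (fun X => f (A *m X)%R) = intM f.

Lemma left_mul_scales_mul m (A B : 'M[R]_m) :
  left_mul_scales A -> left_mul_scales B -> left_mul_scales (A *m B).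
Proof.
move=> hA hB n f mf f0.
rewrite det_mulmx normrM exprMn EFinM -muleA -[RHS](hA n f mf f0); congr (_ * _).
rewrite -(hB n (fun X => f (A *m X)%R)) //; last by apply: (measurableT_comp mf); mfun.
by congr (_ * _); apply: eq_intM => X; rewrite mulmxA.
Qed.

Lemma left_mul_scales1 m : left_mul_scales (1%:M : 'M[R]_m).
Proof.
move=> n f mf f0; rewrite det1 normr1 expr1n mul1e.
by apply: eq_intM => X; rewrite mul1mx.
Qed.

(** For a fixed first row [r] the term [c *m r] is a translation of the remaining rows, so they are
    integrated innermost. *)
Lemma left_mul_scales_lower m (a : R) (c : 'cV[R]_m) (D : 'M[R]_m) : (a != 0)%R ->
  left_mul_scales D ->
  left_mul_scales (block_mx (a%:M : 'M[R]_1) (0%R : 'rV[R]_m) c D : 'M[R]_(1 + m)).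
Proof.
move=> a0 hD n f mf f0.
rewrite det_lblock det_scalar1 normrM exprMn.
have E (r : 'rV[R]_n) (Y : 'M[R]_(m, n)) :
    (block_mx (a%:M : 'M[R]_1) (0%R : 'rV[R]_m) c D *m col_mx r Y =
     col_mx (a *: r) (c *m r + D *m Y))%R.
  by rewrite mul_block_col mul0mx addr0 mul_scalar_mx.
rewrite !(@intMS R m n).
under eq_intRd => r do under eq_intM => Y do rewrite E.
rewrite EFinM -muleA -intRdZl; last 3 first.
- apply: (@measurable_intM R m n _ 'rV[R]_n (fun r Y => f (col_mx (a *: r) (c *m r + D *m Y)%R))) => //.
  by apply: (measurableT_comp mf); mfun.
- by move=> r; exact: intM_ge0.
- by rewrite lee_fin exprn_ge0.
have mc (r : 'rV[R]_n) : measurable_fun setT (fun Z : 'M[R]_(m, n) => f (col_mx r Z)).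
  by apply: (measurableT_comp mf); mfun.
transitivity ((`|a| ^+ n)%:E * intRd (fun r : 'rV[R]_n =>
   intM (fun Z : 'M[R]_(m, n) => f (col_mx (a *: r) Z)))).
  congr (_ * _); apply: eq_intRd => r.
  rewrite (hD n (fun Z => f (col_mx (a *: r) (c *m r + Z)%R))) //; last first.
    by apply: (measurableT_comp mf); mfun.
  rewrite -[RHS](intM_shift (c *m r)) //.
  by apply: eq_intM => Z; rewrite addrC.
apply: (intRd_scale (f := fun r => intM (fun Z : 'M[R]_(m, n) => f (col_mx r Z)))) => //.
  apply: (@measurable_intM R m n _ 'rV[R]_n (fun r Y => f (col_mx r Y))) => //.
  by apply: (measurableT_comp mf); mfun.
by move=> r; exact: intM_ge0.
Qed.

(** Now the first row is translated by [b *m Y], so it has to be integrated innermost; this is the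
    reason for the exchange by [intM_swap]. *)
Lemma left_mul_scales_upper m (a : R) (b : 'rV[R]_m) (D : 'M[R]_m) : (a != 0)%R ->
  left_mul_scales D ->
  left_mul_scales (block_mx (a%:M : 'M[R]_1) b (0%R : 'cV[R]_m) D : 'M[R]_(1 + m)).
Proof.
move=> a0 hD n f mf f0.
rewrite det_ublock det_scalar1 normrM exprMn.
have E (r : 'rV[R]_n) (Y : 'M[R]_(m, n)) :
    (block_mx (a%:M : 'M[R]_1) b (0%R : 'cV[R]_m) D *m col_mx r Y =
     col_mx (a *: r + b *m Y) (D *m Y))%R.
  by rewrite mul_block_col mul0mx add0r mul_scalar_mx.
rewrite !(@intMS R m n).
under eq_intRd => r do under eq_intM => Y do rewrite E.
have mF : measurable_fun setT (fun p : 'M[R]_(m, n) * 'rV[R]_n => f (col_mx p.2 p.1)).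
  by apply: (measurableT_comp mf); mfun.
rewrite -(intM_swap (f := fun Y r => f (col_mx (a *: r + b *m Y)%R (D *m Y)%R))) //; last first.
  by apply: (measurableT_comp mf); mfun.
rewrite -[RHS](intM_swap (f := fun Y r => f (col_mx r Y))) //.
have mG : measurable_fun setT (fun Y : 'M[R]_(m, n) => intRd (fun r => f (col_mx r Y))).
  by apply: (@measurable_intRd R n _ 'M[R]_(m, n) (fun Y r => f (col_mx r Y))).
rewrite -[RHS](hD n) //; last by move=> Y; exact: intRd_ge0.
rewrite mulrC EFinM -muleA; congr (_ * _).
rewrite -intMZl; last 3 first.
- apply: (@measurable_intRd R n _ 'M[R]_(m, n)
    (fun Y r => f (col_mx (a *: r + b *m Y)%R (D *m Y)%R))) => //.
  by apply: (measurableT_comp mf); mfun.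
- by move=> Y; exact: intRd_ge0.
- by rewrite lee_fin exprn_ge0.
apply: eq_intM => Y.
apply: (intRd_affine (b *m Y)%R a0 (f := fun r => f (col_mx r (D *m Y)%R))) => //.
by apply: (measurableT_comp mf); mfun.
Qed.

(** Gaussian elimination by induction on the size: a nonzero pivot factors the matrix into a lower
    and an upper block matrix, the latter containing the Schur complement of the pivot. *)
Lemma left_mul_scales_unit m (A : 'M[R]_m) : A \in unitmx -> left_mul_scales A.
Proof.
elim: m A => [|m IH] A uA.
  have -> : A = 1%:M by rewrite [LHS]flatmx0 [RHS]flatmx0.
  exact: left_mul_scales1.
have pivot (B : 'M[R]_(1 + m)) : B \in unitmx -> B ord0 ord0 != 0%R -> left_mul_scales B.
  move=> uB; set a := B ord0 ord0 => a0.
  pose b := ursubmx B; pose c := dlsubmx B; pose D := (drsubmx B - a^-1 *: (c *m b))%R.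
  have BE : (B = block_mx (1%:M : 'M[R]_1) (0 : 'rV[R]_m) (a^-1 *: c) 1%:M *m
                block_mx (a%:M : 'M[R]_1) b (0 : 'cV[R]_m) D)%R.
    rewrite mulmx_block !mul1mx !mul0mx !addr0 -{1}[B]submxK.
    congr block_mx => //.
    - by apply/matrixP => i j; rewrite !ord1 !mxE //= mulr1n /a; congr (B _ _); exact/val_inj.
    - by rewrite mul_mx_scalar scalerA divff // scale1r.
    - by rewrite -scalemxAl /D addrC subrK.
  have uD : D \in unitmx.
    move: uB; rewrite !unitmxE BE det_mulmx det_lblock det_ublock !det1 !mul1r det_scalar1.
    by rewrite unitrM => /andP[].
  rewrite BE; apply: left_mul_scales_mul.
    by apply: left_mul_scales_lower; [exact: oner_neq0|exact: left_mul_scales1].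
  by apply: left_mul_scales_upper => //; exact: IH.
have [A00|A00] := eqVneq (A ord0 ord0) 0%R; last exact: pivot.
have [i Ai] : exists i : 'I_m, A (lift ord0 i) ord0 != 0%R.
  apply/existsP; apply: contraLR uA; rewrite negb_exists => /forallP h.
  rewrite unitmxE (expand_det_col _ ord0) big1 ?unitr0 // => j _.
  have [->|[k ->]] : j = ord0 \/ exists k, j = lift ord0 k.
  - by case: (unliftP ord0 j) => [k ->|->]; [right; exists k|left].
  - by rewrite A00 mul0r.
  - by move: (h k); rewrite negbK => /eqP ->; rewrite mul0r.
(* When the pivot vanishes, adding to the first row another row whose leading entry is nonzero
   creates one; [U (-1)] undoes the addition. *)
pose U (s : R) := block_mx (1%:M : 'M[R]_1) (s *: delta_mx ord0 i : 'rV[R]_m)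
  (0%R : 'cV[R]_m) 1%:M : 'M[R]_(1 + m).
have hU s : left_mul_scales (U s).
  by apply: left_mul_scales_upper; [exact: oner_neq0|exact: left_mul_scales1].
have -> : A = U (-1)%R *m (U 1%R *m A).
  rewrite mulmxA /U mulmx_block !mul1mx !mulmx1 !mulmx0 !mul0mx !addr0 !add0r.
  by rewrite scale1r scaleN1r addrN -scalar_mx_block mul1mx.
apply: left_mul_scales_mul => //; apply: pivot.
  by rewrite unitmx_mul uA andbT unitmxE /U det_ublock !det1 mulr1 unitr1.
have UE j : U 1%R ord0 (lift ord0 j) = ((j == i)%:R)%R.
  transitivity (U 1%R (lshift m ord0) (rshift 1 j)).
    by congr (U _ _ _); exact/val_inj.
  by rewrite block_mxEur !mxE eqxx mul1r.
rewrite mxE big_ord_recl A00 mulr0 add0r (bigD1 i) //= UE eqxx mul1r big1 ?addr0 //.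
by move=> j /negbTE ji; rewrite UE ji mul0r.
Qed.

End linear_change_of_variables.

(** * Linear maps, hyperplanes and product functions in [R^d] *)

Section vector_integrals.
Variable R : realType.
Local Notation mu := (@lebesgue_measure R).
Local Open Scope ereal_scope.

Lemma intM_col d (f : 'cV[R]_d -> \bar R) : intM f = intRd (fun x : 'rV[R]_d => f x^T).
Proof.
elim: d f => [|d IH] f; first by rewrite intM0 /=; congr f; rewrite [RHS]flatmx0.
rewrite intMS /=; apply: eq_integral => t _; rewrite IH; apply: eq_intRd => y; congr f.
transitivity (col_mx (t%:M : 'M[R]_1)^T y^T); last first.
  by rewrite -(@tr_row_mx _ 1 1 d).
suff -> : row_mx (t%:M : 'M[R]_1) (0%R : 'rV[R]_0) = (t%:M : 'M[R]_1)^T :> 'rV[R]_1 by [].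
apply/matrixP => i j; rewrite !ord1 mxE.
case: splitP => k; last by case: k.
by rewrite !mxE ord1.
Qed.

Lemma intRd_mulmx d (A : 'M[R]_d) (f : 'rV[R]_d -> \bar R) : A \in unitmx ->
  measurable_fun setT f -> (forall x, 0 <= f x) ->
  `|\det A|%:E * intRd (fun x => f (x *m A)%R) = intRd f.
Proof.
move=> uA mf f0.
have E (g : 'rV[R]_d -> \bar R) : intRd g = intM (fun X : 'cV[R]_d => g X^T).
  by rewrite intM_col; apply: eq_intRd => x; rewrite trmxK.
rewrite !E -[RHS](left_mul_scales_unit (A := A^T) _ (n := 1%N)) ?unitmx_tr //; last first.
  by apply: (measurableT_comp mf); mfun.
rewrite det_tr expr1; congr (_ * _).
by apply: eq_intM => X; rewrite trmx_mul trmxK.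
Qed.

Lemma intRd0 d : intRd (fun _ : 'rV[R]_d => 0) = 0.
Proof. by elim: d => //= d IH; rewrite integral0_eq. Qed.

(** If the normal [c] has a component beyond the first coordinate, every slice lives on a hyperplane
    of dimension one less. Otherwise a single value of the first coordinate contributes. *)
Lemma intRd_hyperplane d (c : 'cV[R]_d) (b : R) (f : 'rV[R]_d -> \bar R) : c != 0%R ->
  (forall x, ((x *m c) ord0 ord0 != b)%R -> f x = 0) -> intRd f = 0.
Proof.
elim: d c b f => [|d IH] c b f; first by rewrite [c]flatmx0 eqxx.
move=> c0 fH /=.
pose c1 := usubmx (c : 'cV[R]_(1 + d)) ord0 ord0.
pose c' := dsubmx (c : 'cV[R]_(1 + d)).
have E (t : R) (y : 'rV[R]_d) : ((row_mx (t%:M : 'M[R]_1) y *m c) ord0 ord0 ==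
    b)%R = ((y *m c') ord0 ord0 == b - t * c1)%R.
  rewrite -[c](vsubmxK (c : 'cV[R]_(1 + d))) mul_row_col mxE mul_scalar_mx mxE.
  by rewrite -/c1 -/c' addrC (can2_eq (addrK _) (subrK _)).
have [c'0|c'0] := eqVneq c' 0%R; last first.
  rewrite integral0_eq // => t _; apply: (IH c' (b - t * c1)%R) => // y.
  by rewrite -E => /fH.
have c10 : c1 != 0%R.
  apply: contra_neq c0 => c10; rewrite -[c](vsubmxK (c : 'cV[R]_(1 + d))) -/c' c'0.
  rewrite (_ : usubmx _ = 0%R) ?col_mx0 //.
  by apply/matrixP => i j; rewrite !ord1 -/c1 c10 mxE.
have h0 (t : R) : (setT `\ (b / c1)%R) t ->
    intRd (fun y => f (row_mx (t%:M : 'M[R]_1) y)) = 0.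
  move=> [_ /= tb]; rewrite -[RHS](@intRd0 d); apply: eq_intRd => y; apply: fH.
  rewrite E c'0 mulmx0 mxE eq_sym subr_eq0; apply/eqP => bt.
  by case: tb; rewrite bt mulfK.
rewrite -(@integral_setD1 _ _ (b / c1)%R); last 2 first.
- exact: measurableD.
- apply: (eq_measurable_fun (cst 0)); last exact: measurable_cst.
  by move=> t; rewrite inE => /h0 ->.
by rewrite integral0_eq.
Qed.

Lemma intRd_prod d (g : 'I_d -> R -> \bar R) : (forall i, measurable_fun setT (g i)) ->
  (forall i x, 0 <= g i x) ->
  intRd (fun x : 'rV[R]_d => \prod_(i < d) g i (x ord0 i)) = \prod_(i < d) \int[mu]_x g i x.
Proof.
elim: d g => [|d IH] g mg g0; first by rewrite /= !big_ord0.
rewrite /= big_ord_recl.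
have P0 (x : 'rV[R]_d) : 0 <= \prod_(i < d) g (lift ord0 i) (x ord0 i).
  by apply: prode_ge0 => i _; exact: g0.
transitivity (\int[mu]_t (g ord0 t * \prod_(i < d) \int[mu]_x g (lift ord0 i) x)).
  apply: eq_integral => t _.
  rewrite -(IH (fun i => g (lift ord0 i))) //.
  rewrite -intRdZl //; last first.
    apply: mfun_bigprode => i; apply: (measurableT_comp (mg (lift ord0 i))); mfun.
  apply: eq_intRd => y; rewrite big_ord_recl; congr (_ * _).
    congr g; rewrite mxE; case: splitP => // j; by rewrite !mxE !ord1 mulr1n.
  apply: eq_bigr => i _; congr g.
  transitivity (row_mx (t%:M : 'M[R]_1) y ord0 (rshift 1 i)); last by rewrite row_mxEr.
  by congr (row_mx _ _ _ _); exact/val_inj.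
rewrite ge0_integralZr //; last by apply: prode_ge0 => i _; apply: integral_ge0 => x _; exact: g0.
all: by [exact: mg|move=> x _; exact: g0].
Qed.

End vector_integrals.

(** * The Gamma kernel and its integrability *)

Section gaussian_gamma.
Variable R : realType.
Local Notation mu := (@lebesgue_measure R).
Local Open Scope ereal_scope.

Lemma integral_itv_natbool (i : interval R) (f : R -> R) :
  \int[mu]_(x in [set` i]) (f x)%:E = \int[mu]_x ((x \in i)%:R * f x)%R%:E.
Proof.
rewrite integral_mkcond; apply: eq_integral => x _.
rewrite patchE; case: ifPn; first by rewrite inE /= => ->; rewrite mul1r.
by rewrite notin_setE /= => /negP/negbTE ->; rewrite mul0r.
Qed.

Lemma integral_is_derive (f F : R -> R) (a b : R) : (a <= b)%R ->
  (forall x, (a <= x <= b)%R -> is_derive x 1%R F (f x)) ->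
  (forall x, (a <= x <= b)%R -> {for x, continuous f}) ->
  \int[mu]_(x in `[a, b]) (f x)%:E = (F b - F a)%R%:E.
Proof.
rewrite le_eqVlt => /predU1P[->|ab] dF cf.
  by rewrite set_itv1 integral_set1 subrr.
have cF x : (a <= x <= b)%R -> {for x, continuous F}.
  by move=> /dF h; apply/differentiable_continuous/derivable1_diffP; exact: ex_derive.
have aab : (a <= a <= b)%R by rewrite lexx ltW.
have bab : (a <= b <= b)%R by rewrite lexx ltW.
rewrite EFinB; apply: (continuous_FTC2 ab).
- apply: continuous_in_subspaceT => x; rewrite inE /= in_itv /=; exact: cf.
- split.
  + move=> x; rewrite in_itv /= => /andP[ax xb].
    by have := dF x; rewrite !ltW // => /(_ isT) ?; exact: ex_derive.
  + by apply: cvg_at_right_filter; exact: cF.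
  + by apply: cvg_at_left_filter; exact: cF.
- move=> x; rewrite in_itv /= => /andP[ax xb]; rewrite derive1E.
  by have := dF x; rewrite !ltW // => /(_ isT) ?; rewrite derive_val.
Qed.

Lemma continuous_powR_pos (p x : R) : (0 < x)%R -> {for x, continuous (fun y : R => (y `^ p)%R)}.
Proof.
move=> x0; have := is_derive1_powR p x0 => ?.
by apply/differentiable_continuous/derivable1_diffP; exact: ex_derive.
Qed.

(** The integrand may blow up at 0, so []0, 1]] is exhausted by [[1 / (n + 1), 1]], where the
    primitive [x^s / s] applies. The bound serves the Gamma kernel here and the decay of [dawson]
    later. *)
Lemma integral_powR01 (s : R) : (0 < s)%R ->
  \int[mu]_(x in `]0%R, 1%R]) (x `^ (s - 1))%:E <= (s^-1)%:E.
Proof.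
move=> s0.
pose F (n : nat) : set R := `[n.+1%:R^-1, 1]%classic%R.
have FU : `]0%R, 1%R]%classic = \bigcup_i F i :> set R.
  apply/seteqP; split => x /=.
    rewrite in_itv /= => /andP[x0 x1]; exists (Num.trunc (x^-1)) => //.
    rewrite /F /= in_itv /= x1 andbT invf_ple ?posrE //.
    by apply/ltW; rewrite truncnS_gt.
  move=> [n _]; rewrite /F /= !in_itv /= => /andP[nx ->]; rewrite andbT.
  by apply: lt_le_trans nx; rewrite invr_gt0.
have mf D : measurable_fun D (fun x : R => (x `^ (s - 1))%:E).
  by apply: measurable_funTS; mfun.
have := @ge0_nondecreasing_set_cvg_integral _ (measurableTypeR R) R F (fun x => (x `^ (s - 1))%:E) mu.
rewrite -FU => h.
have {}h : \int[mu]_(x in F i) (x `^ (s - 1))%:E @[i --> \oo] -->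
    \int[mu]_(x in `]0%R, 1%R]) (x `^ (s - 1))%:E.
  apply: h => //.
  - apply/nondecreasing_seqP => n; apply/subsetPset => x; rewrite /F /= !in_itv /= => /andP[h ->].
    by rewrite andbT (le_trans _ h) // lef_pV2 ?posrE // ler_nat.
  - by move=> n; exact: measurable_itv.
  - by move=> n; exact: mf.
  - by move=> n x _; rewrite lee_fin powR_ge0.
rewrite -(cvg_lim _ h) //; apply: lime_le; first by apply/cvg_ex; eexists; exact: h.
apply: nearW => n.
have n0 : (0 < n.+1%:R^-1 :> R)%R by rewrite invr_gt0.
have -> : \int[mu]_(x in F n) (x `^ (s - 1))%:E = (s^-1 * 1 `^ s - s^-1 * n.+1%:R^-1 `^ s)%R%:E.
  apply: (@integral_is_derive _ (fun x => s^-1 * x `^ s)%R).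
  - by rewrite invf_le1 // ler1n.
  - move=> x /andP[nx _]; have x0 : (0 < x)%R := lt_le_trans n0 nx.
    apply: (is_derive_eq (is_deriveZ s^-1%R (is_derive1_powR s x0))).
    by rewrite /GRing.scale /= mulrA mulVf ?mul1r // gt_eqF.
  - by move=> x /andP[nx _]; apply: continuous_powR_pos; exact: lt_le_trans nx.
by rewrite lee_fin powR1 mulr1 lerBlDr lerDl mulr_ge0 ?powR_ge0 // invr_ge0 ltW.
Qed.

(** Extended by zero to the whole line, so that Tonelli and scaling are always applied over
    [setT]. *)
Definition gamma_ker (s t : R) : R := ((0 < t)%R%:R * (t `^ (s - 1) * expR (- t)))%R.

Lemma gamma_ker_ge0 s t : (0 <= gamma_ker s t)%R.
Proof. by rewrite mulr_ge0 // mulr_ge0 ?powR_ge0 ?expR_ge0. Qed.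

Lemma measurable_gamma_ker s : measurable_fun setT (gamma_ker s).
Proof. rewrite /gamma_ker; mfun. Qed.

(** The inequality [x <= exp x] at [x = t / (2 p)], raised to the power [p]. *)
Lemma powR_le_expR (p t : R) : (0 < p)%R -> (0 < t)%R ->
  (t `^ p <= (2 * p) `^ p * expR (t / 2))%R.
Proof.
move=> p0 t0; have pp : (0 < 2 * p)%R by rewrite mulr_gt0.
have tp : (0 < t / (2 * p))%R by rewrite divr_gt0.
have -> : (t `^ p = (t / (2 * p)) `^ p * (2 * p) `^ p)%R.
  by rewrite -powRM ?divfK ?(lt0r_neq0 pp) //; exact: ltW.
rewrite [leRHS]mulrC ler_pM2r ?powR_gt0 //.
have -> : (expR (t / 2) = expR (t / (2 * p)) `^ p)%R.
  rewrite /powR gt_eqF ?expR_gt0 // expRK; congr expR; field; exact: lt0r_neq0.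
apply: ge0_ler_powR; rewrite ?nnegrE ?expR_ge0 //; [exact: ltW|exact: ltW|].
by apply: le_trans (expR_ge1Dx _) => //; rewrite lerDr.
Qed.

Lemma integral_gamma_ker_lty (s : R) : (0 < s)%R ->
  \int[mu]_t (gamma_ker s t)%:E < +oo.
Proof.
move=> s0.
(* This [p] is positive and at least [s - 1], so [powR_le_expR] bounds the kernel beyond 1 by a
   multiple of the exponential density of rate [1/2]. *)
pose p : R := (`|s - 1| + 1)%R.
have p0 : (0 < p)%R by rewrite ltr_wpDl.
pose C := ((2 * p) `^ p * 2)%R.
have C0 : (0 <= C)%R by rewrite mulr_ge0 ?powR_ge0.
pose g1 (t : R) := ((t \in `]0%R, 1%R])%:R * t `^ (s - 1))%R.
pose g2 (t : R) := (C * exponential_pdf 2^-1 t)%R.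
have mg1 : measurable_fun setT g1.
  rewrite /g1; apply: mfun_mul; last by mfun.
  apply: mfun_natbool.
  have -> : (fun t : R => t \in `]0%R, 1%R]) = (fun t => (0 < t)%R && (t <= 1)%R).
    by apply/funext => t; rewrite in_itv.
  by mfun.
have mg2 : measurable_fun setT g2.
  by apply: mfun_mul; [exact: measurable_cst|exact: measurable_exponential_pdf].
have le12 : \int[mu]_t (gamma_ker s t)%:E <= \int[mu]_t ((g1 t)%:E + (g2 t)%:E).
  apply: ge0_le_integral => //.
  - by move=> t _; rewrite lee_fin gamma_ker_ge0.
  - by apply: mfun_EFin; exact: measurable_gamma_ker.
  - by apply: mfun_adde; apply: mfun_EFin.
  - move=> t _; rewrite -EFinD lee_fin /gamma_ker.
    have g20 : (0 <= g2 t)%R by rewrite mulr_ge0 // exponential_pdf_ge0.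
    have g10 : (0 <= g1 t)%R by rewrite mulr_ge0 ?powR_ge0.
    case: ltP => t0; last by rewrite mul0r addr_ge0.
    rewrite mul1r; case: (leP t 1%R) => t1.
      rewrite -[leLHS]addr0 lerD // /g1 in_itv /= t0 t1 mul1r ler_piMr ?powR_ge0 //.
      by rewrite -expR0 ler_expR oppr_le0 ltW.
    rewrite -[leLHS]add0r lerD // /g2 exponential_pdfE ?(ltW t0) // /C.
    rewrite [leRHS](_ : _ = ((2 * p) `^ p * expR (- (2^-1) * t))%R); last by field.
    have -> : (- t = - (2^-1) * t - t / 2)%R by field.
    rewrite expRD mulrA mulrAC ler_pM2r ?expR_gt0 //.
    rewrite expRN ler_pdivrMr ?expR_gt0 //.
    apply: le_trans (powR_le_expR p0 t0).
    apply: ler_powR; first exact: ltW.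
    by rewrite (le_trans (ler_norm _)) // lerDl.
apply: (le_lt_trans le12); rewrite ge0_integralD //; last 4 first.
- by move=> t _; rewrite lee_fin mulr_ge0 ?powR_ge0.
- exact: mfun_EFin.
- by move=> t _; rewrite lee_fin mulr_ge0 // exponential_pdf_ge0.
- exact: mfun_EFin.
rewrite /g1 -integral_itv_natbool.
apply: lte_add_pinfty; first exact: le_lt_trans (integral_powR01 s0) (ltry _).
rewrite /g2; under eq_integral do rewrite EFinM.
rewrite ge0_integralZl //.
- by rewrite integral_exponential_pdf ?invr_gt0 // mule1 ltry.
- by apply: mfun_EFin; exact: measurable_exponential_pdf.
- by move=> t _; rewrite lee_fin exponential_pdf_ge0.
Qed.

End gaussian_gamma.

(** * Gaussian integrals and the mass of the beta' kernel *)

Section gamma_gauss.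
Variable R : realType.
Local Notation mu := (@lebesgue_measure R).
Local Open Scope ereal_scope.

Lemma integral_gamma_ker (s : R) : (0 < s)%R ->
  \int[mu]_t (gamma_ker s t)%:E = (Gamma s)%:E.
Proof.
move=> s0; rewrite /Gamma /Rintegral integral_itv_natbool.
rewrite [X in fine X](_ : _ = \int[mu]_t (gamma_ker s t)%:E); last first.
  by apply: eq_integral => t _; rewrite in_itv /= andbT.
rewrite fineK // ge0_fin_numE; first exact: integral_gamma_ker_lty.
by apply: integral_ge0 => t _; rewrite lee_fin gamma_ker_ge0.
Qed.

(** On [[1, 2]] the kernel is at least [2^(- |s - 1|) * exp (-2)], whatever the sign of [s - 1]. *)
Lemma Gamma_gt0 (s : R) : (0 < s)%R -> (0 < Gamma s)%R.
Proof.
move=> s0; rewrite -lte_fin -integral_gamma_ker //.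
pose c : R := ((2 `^ `|s - 1|)^-1 * expR (-2))%R.
have c0 : (0 < c)%R by rewrite mulr_gt0 ?invr_gt0 ?powR_gt0 ?expR_gt0.
apply: (@lt_le_trans _ _ (\int[mu]_(t in `[1%R, 2%R]) c%:E)).
  rewrite integral_cst //= lebesgue_measure_itv /= lte_fin ltr1n -EFinB -EFinM lte_fin.
  by rewrite mulr_gt0 // subr_gt0 ltr1n.
rewrite integral_itv_natbool; apply: ge0_le_integral => //.
- by move=> t _; rewrite lee_fin mulr_ge0 // ltW.
- apply: mfun_EFin; apply: mfun_mul; last by mfun.
  apply: mfun_natbool.
  have -> : (fun t : R => t \in `[1%R, 2%R]) = (fun t => (1 <= t)%R && (t <= 2)%R).
    by apply/funext => t; rewrite in_itv.
  by mfun.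
- by apply: mfun_EFin; exact: measurable_gamma_ker.
- move=> t _; rewrite lee_fin in_itv /=.
  case: andP => [[t1 t2]|_]; last by rewrite mul0r gamma_ker_ge0.
  have t0 : (0 < t)%R by exact: lt_le_trans t1.
  rewrite mul1r /gamma_ker t0 mul1r; apply: ler_pM.
  - by rewrite invr_ge0 powR_ge0.
  - exact: expR_ge0.
  - apply: (@le_trans _ _ (t `^ (- `|s - 1|))%R).
      rewrite powRN lef_pV2 ?posrE ?powR_gt0 //.
      by apply: ge0_ler_powR => //; rewrite nnegrE ltW.
    by apply: ler_powR => //; rewrite lerNl -normrN ler_norm.
  - by rewrite ler_expR lerN2.
Qed.

Lemma integral_gamma_scale (a s : R) : (0 < a)%R -> (0 < s)%R ->
  \int[mu]_t ((0 < t)%R%:R * (t `^ (s - 1) * expR (- (a * t))))%R%:E = (Gamma s * a `^ (- s))%R%:E.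
Proof.
move=> a0 s0.
have h := @ge0_integral_affine R a 0 (fun t => (gamma_ker s t)%:E).
have {}h := h (lt0r_neq0 a0) (mfun_EFin (measurable_gamma_ker s)) (fun t => gamma_ker_ge0 s t).
rewrite integral_gamma_ker // gtr0_norm // in h.
have E t : (gamma_ker s (a * t + 0) =
   a `^ (s - 1) * ((0 < t)%R%:R * (t `^ (s - 1) * expR (- (a * t)))))%R.
  rewrite addr0 /gamma_ker pmulr_rgt0 //; case: ltP => t0; last by rewrite !mul0r mulr0.
  by rewrite !mul1r powRM 1?ltW // -mulrA; congr (_ * _)%R; rewrite ltW.
have mk : measurable_fun setT
    (fun t : R => ((0 < t)%R%:R * (t `^ (s - 1) * expR (- (a * t))))%R%:E) by mfun.
have {}h : a%:E * \int[mu]_t ((a `^ (s - 1))%:E *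
    ((0 < t)%R%:R * (t `^ (s - 1) * expR (- (a * t))))%R%:E) = (Gamma s)%:E.
  by rewrite -h; congr (_ * _); apply: eq_integral => t _; rewrite E EFinM.
rewrite ge0_integralZl // in h.
- rewrite muleA -EFinM mulr_powRB1 ?(ltW a0) // in h.
  have as0 : (0 < a `^ s)%R by rewrite powR_gt0.
  rewrite powRN mulrC EFinM -h muleA -EFinM mulVf ?mul1e //; exact: lt0r_neq0.
- by move=> t _; rewrite lee_fin mulr_ge0 // mulr_ge0 ?powR_ge0 ?expR_ge0.
- by rewrite lee_fin powR_ge0.
Qed.

Lemma prod_EFin (I : Type) (r : seq I) (P : pred I) (F : I -> R) :
  \prod_(i <- r | P i) (F i)%:E = (\prod_(i <- r | P i) F i)%R%:E.
Proof. by rewrite (big_morph EFin (@EFinM R) erefl). Qed.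

Lemma enorm_sqr d (x : 'rV[R]_d) : (enorm x ^+ 2 = \sum_(i < d) x ord0 i ^+ 2)%R.
Proof. by rewrite sqr_sqrtr // sumr_ge0 // => i _; exact: sqr_ge0. Qed.

Lemma integral_gauss_scale (t : R) : (0 < t)%R ->
  \int[mu]_x (expR (- (t * x ^+ 2)))%:E = ((pi / t) `^ 2^-1)%:E.
Proof.
move=> t0; pose a := Num.sqrt t.
have a0 : (0 < a)%R by rewrite sqrtr_gt0.
have h := @ge0_integral_affine R a 0 (fun t => (gauss_fun t)%:E).
have {}h := h (lt0r_neq0 a0) (mfun_EFin measurable_gauss_fun) (fun t => gauss_fun_ge0 t).
rewrite integralT_gauss gtr0_norm // in h.
have E x : gauss_fun (a * x + 0) = expR (- (t * x ^+ 2)).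
  by rewrite /gauss_fun addr0 exprMn sqr_sqrtr // ltW.
have {}h : a%:E * \int[mu]_x (expR (- (t * x ^+ 2)))%:E = (Num.sqrt pi)%:E.
  by rewrite -h; congr (_ * _); apply: eq_integral => x _; rewrite E.
have pt : (0 <= pi / t)%R by rewrite divr_ge0 ?pi_ge0 // ltW.
rewrite powR12_sqrt // sqrtrM ?pi_ge0 // sqrtrV ?(ltW t0) // -/a mulrC EFinM -h muleA -EFinM.
by rewrite mulVf ?mul1e // lt0r_neq0.
Qed.

Lemma intRd_gauss d (t : R) : (0 < t)%R ->
  intRd (fun x : 'rV[R]_d => (expR (- (t * enorm x ^+ 2)))%:E) = ((pi / t) `^ (d%:R / 2))%:E.
Proof.
move=> t0.
transitivity (intRd (fun x : 'rV[R]_d => \prod_(i < d) (expR (- (t * x ord0 i ^+ 2)))%:E)).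
  apply: eq_intRd => x; rewrite prod_EFin -expR_sum enorm_sqr mulr_sumr; congr (expR _)%:E.
  by rewrite -sumrN.
rewrite (intRd_prod (g := fun i x => (expR (- (t * x ^+ 2)))%:E)).
- under eq_bigr do rewrite integral_gauss_scale //.
  rewrite prod_EFin prodr_const card_ord -powR_mulrn ?powR_ge0 // -powRrM.
  by rewrite [(2^-1 * _)%R]mulrC.
- by move=> i; mfun.
- by move=> i x; rewrite lee_fin expR_ge0.
Qed.

Lemma powR_gamma_mix (b y : R) : (0 < b)%R -> (0 < y)%R ->
  (y `^ (- b))%:E = ((Gamma b)^-1)%:E *
    \int[mu]_t ((0 < t)%R%:R * (t `^ (b - 1) * expR (- (y * t))))%R%:E.
Proof.
move=> b0 y0; rewrite integral_gamma_scale // -EFinM mulrA mulVf ?mul1r //.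
by rewrite lt0r_neq0 // Gamma_gt0.
Qed.

(** The Gamma mixture replaces polar coordinates: each Gaussian contributes [(pi / t)^(d/2)], which
    lowers the shape of the kernel from [b] to [b - d/2]. *)
Lemma intRd_betap d (b : R) : (d%:R / 2 < b)%R ->
  intRd (fun x : 'rV[R]_d => ((1 + enorm x ^+ 2) `^ (- b))%:E) =
  (pi `^ (d%:R / 2) * Gamma (b - d%:R / 2) / Gamma b)%R%:E.
Proof.
move=> db.
have d0 : (0 <= d%:R / 2 :> R)%R by rewrite divr_ge0.
have b0 : (0 < b)%R by exact: le_lt_trans db.
have e0 (x : 'rV[R]_d) : (0 < 1 + enorm x ^+ 2)%R by rewrite ltr_pwDl // sqr_ge0.
under eq_intRd do rewrite powR_gamma_mix //.
have mk : measurable_fun setT (fun p : R * 'rV[R]_d =>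
    ((0 < p.1)%R%:R * (p.1 `^ (b - 1) * expR (- ((1 + enorm p.2 ^+ 2) * p.1))))%R%:E) by mfun.
have k0 (t : R) (x : 'rV[R]_d) :
    0 <= ((0 < t)%R%:R * (t `^ (b - 1) * expR (- ((1 + enorm x ^+ 2) * t))))%R%:E.
  by rewrite lee_fin mulr_ge0 // mulr_ge0 ?powR_ge0 ?expR_ge0.
rewrite intRdZl; last 3 first.
- apply: (measurable_fun_fubini_tonelli_G (m1 := mu) (fun p : R * 'rV[R]_d =>
    ((0 < p.1)%R%:R * (p.1 `^ (b - 1) * expR (- ((1 + enorm p.2 ^+ 2) * p.1))))%R%:E)) => //.
- by move=> x; apply: integral_ge0.
- by rewrite lee_fin invr_ge0 ltW // Gamma_gt0.
rewrite (integral_intRd mu (f := fun t x =>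
  ((0 < t)%R%:R * (t `^ (b - 1) * expR (- ((1 + enorm x ^+ 2) * t))))%R%:E)) //.
rewrite [X in _ * X](_ : _ = \int[mu]_t
  ((pi `^ (d%:R / 2))%:E * (gamma_ker (b - d%:R / 2) t)%:E)); last first.
  apply: eq_integral => t _; rewrite /gamma_ker; case: ltP => t0; last first.
    by rewrite mul0r mule0; under eq_intRd do rewrite mul0r; rewrite intRd0.
  transitivity (intRd (fun x : 'rV[R]_d =>
      (t `^ (b - 1) * expR (- t))%R%:E * (expR (- (t * enorm x ^+ 2)))%:E)).
    apply: eq_intRd => x; rewrite -EFinM -mulrA -expRD !mul1r; congr (_ * expR _)%R%:E.
    by ring.
  rewrite intRdZl; last 3 first.
  - by mfun.
  - by move=> x; rewrite lee_fin expR_ge0.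
  - by rewrite lee_fin mulr_ge0 ?powR_ge0 ?expR_ge0.
  rewrite intRd_gauss // -!EFinM mul1r powRM ?pi_ge0 ?invr_ge0 ?(ltW t0) //.
  rewrite -[(t^-1)%R](powR_inv1 (ltW t0)) -powRrM mulN1r.
  rewrite (_ : b - d%:R / 2 - 1 = b - 1 + - (d%:R / 2))%R; last by ring.
  rewrite [in RHS]powRD; last by rewrite (gt_eqF t0) implybT.
  by congr EFin; ring.
rewrite ge0_integralZl //; last 3 first.
- by apply: mfun_EFin; exact: measurable_gamma_ker.
- by move=> t _; rewrite lee_fin gamma_ker_ge0.
- by rewrite lee_fin powR_ge0.
rewrite integral_gamma_ker ?subr_gt0 // -!EFinM; congr EFin.
by rewrite mulrC.
Qed.

End gamma_gauss.

(** * Ball volume and Gaussian mass of a cone *)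

Section cone_volume.
Variable R : realType.
Local Notation mu := (@lebesgue_measure R).
Local Open Scope ereal_scope.

(** [Gamma 1] is kept symbolic; it cancels in [face_angleE], where two cones are compared. *)
Lemma integral_exp_tail (y : R) :
  \int[mu]_s ((y < s)%R%:R * expR (- s))%R%:E = (expR (- y) * Gamma 1)%R%:E.
Proof.
have m1 : measurable_fun setT (fun s : R => ((y < s)%R%:R * expR (- s))%R%:E) by mfun.
have p1 (s : R) : 0 <= ((y < s)%R%:R * expR (- s))%R%:E.
  by rewrite lee_fin mulr_ge0 ?expR_ge0.
rewrite -(@ge0_integral_affine _ 1%R y _ (oner_neq0 _) m1 p1) normr1 mul1e.
rewrite EFinM -integral_gamma_ker // -ge0_integralZl //.
- apply: eq_integral => s _; rewrite -EFinM mul1r /gamma_ker subrr powRr0 mul1r mulrCA.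
  by rewrite -ltrBlDr subrr opprD expRD [(expR (- s) * _)%R]mulrC.
- by apply: mfun_EFin; exact: measurable_gamma_ker.
- by move=> s _; rewrite lee_fin gamma_ker_ge0.
Qed.

Lemma enormZ d (a : R) (x : 'rV[R]_d) : enorm (a *: x) = (`|a| * enorm x)%R.
Proof.
rewrite /enorm -sqrtr_sqr -sqrtrM ?sqr_ge0 //; congr Num.sqrt.
by rewrite mulr_sumr; apply: eq_bigr => i _; rewrite mxE exprMn.
Qed.

Lemma enorm_ge0 d (x : 'rV[R]_d) : (0 <= enorm x)%R.
Proof. exact: sqrtr_ge0. Qed.

Variables (d : nat) (K : 'rV[R]_d -> bool).
Hypothesis mK : measurable_fun setT K.
Hypothesis KZ : forall (a : R) x, (0 < a)%R -> K (a *: x)%R = K x.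

Definition cone_ball (r : R) := intRd (fun x => ((K x)%:R * (enorm x < r)%R%:R : R)%R%:E).

Let m_ball r : measurable_fun setT (fun x => ((K x)%:R * (enorm x < r)%R%:R : R)%R%:E).
Proof. by mfun. Qed.

Let ball_ge0 r x : 0 <= ((K x)%:R * (enorm x < r)%R%:R : R)%R%:E.
Proof. by rewrite lee_fin mulr_ge0. Qed.

Lemma cone_ball_scale (r : R) : (0 < r)%R -> cone_ball r = (r ^+ d)%:E * cone_ball 1.
Proof.
move=> r0; have rn : (r != 0)%R by rewrite gt_eqF.
rewrite /cone_ball -(intRd_scale rn (m_ball r) (ball_ge0 r)) gtr0_norm //.
congr (_ * _); apply: eq_intRd => x.
by rewrite KZ // enormZ gtr0_norm // gtr_pMr.
Qed.

(** Layer-cake argument: [exp (- |x|^2)] is the integral of [exp (- s)] over [s > |x|^2], and for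
    fixed [s] the cone meets the ball of radius [sqrt s] in [s^(d/2)] times its unit volume. Ratios
    of ball volumes of cones are therefore ratios of Gaussian masses. *)
Lemma cone_gauss : (Gamma 1)%:E * intRd (fun x => ((K x)%:R * expR (- enorm x ^+ 2))%R%:E) =
  (Gamma (d%:R / 2 + 1))%:E * cone_ball 1.
Proof.
have Gd : (0 < d%:R / 2 + 1 :> R)%R by rewrite ltr_wpDl // divr_ge0.
pose f (s : R) x := ((K x)%:R * ((enorm x ^+ 2 < s)%R%:R * expR (- s)))%R%:E.
have mf : measurable_fun setT (fun p : R * 'rV[R]_d => f p.1 p.2).
  rewrite /f; apply: mfun_EFin; apply: mfun_mul; last by mfun.
  by apply: mfun_natbool; apply: (measurableT_comp mK); mfun.
have f0 s x : 0 <= f s x by rewrite lee_fin mulr_ge0 // mulr_ge0 ?expR_ge0.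
transitivity (intRd (fun x => \int[mu]_s f s x)).
  rewrite -intRdZl.
  - apply: eq_intRd => x; rewrite /f.
    under eq_integral do rewrite EFinM.
    rewrite ge0_integralZl //.
    + by rewrite integral_exp_tail -!EFinM; congr EFin; ring.
    + by mfun.
  - by mfun.
  - by move=> x; rewrite lee_fin mulr_ge0 ?expR_ge0.
  - by rewrite lee_fin ltW // Gamma_gt0.
rewrite integral_intRd // -integral_gamma_ker // -ge0_integralZr //; last 3 first.
- by apply: mfun_EFin; exact: measurable_gamma_ker.
- by move=> s _; rewrite lee_fin gamma_ker_ge0.
- exact: intRd_ge0.
apply: eq_integral => s _; rewrite /gamma_ker /f.
case: ltP => s0; last first.
  rewrite mul0r mul0e -[RHS](@intRd0 R d); apply: eq_intRd => x.
  case: ltP; last by rewrite mul0r mulr0.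
  by move=> xs; have := lt_le_trans xs s0; rewrite ltNge sqr_ge0.
have q0 : (0 < Num.sqrt s)%R by rewrite sqrtr_gt0.
transitivity ((expR (- s))%:E * cone_ball (Num.sqrt s)).
  rewrite /cone_ball -intRdZl; [|exact: m_ball|exact: ball_ge0|by rewrite lee_fin expR_ge0].
  apply: eq_intRd => x; rewrite -EFinM; congr EFin.
  rewrite -{1}[s](sqr_sqrtr (ltW s0)) ltr_pXn2r ?nnegrE ?enorm_ge0 ?ltW //.
  by ring.
rewrite cone_ball_scale // muleA -EFinM; congr (_%:E * _).
rewrite mul1r mulrC addrK; congr (_ * _)%R.
by rewrite -powR12_sqrt ?ltW // -powR_mulrn ?powR_ge0 // -powRrM mulrC.
Qed.

End cone_volume.

(** * The internal angle as a Gaussian integral over the tangent cone *)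

Section face_angle.
Variables (R : realType) (d : nat).
Implicit Types (X : 'M[R]_(d.+1, d)) (k : nat).

Definition edge_mx X : 'M[R]_d := \matrix_(i, j) (X (lift ord0 i) j - X ord0 j).

(** The tangent cone of the simplex along its face, in coordinates along the edges issued from
    vertex 0. Index [i] stands for vertex [i.+1], hence the shift; vertices of the face carry no
    sign condition. *)
Definition face_cone k (l : 'rV[R]_d) : bool :=
  [forall i : 'I_d, (k <= i.+1)%N ==> (0 <= l ord0 i)].

Lemma face_coneP k (l : 'rV[R]_d) :
  reflect (forall i : 'I_d, (k <= i.+1)%N -> 0 <= l ord0 i) (face_cone k l).
Proof. by apply: (iffP forallP) => h i; [move=> ki; have := h i; rewrite ki|apply/implyP; exact: h]. Qed.

Lemma measurable_face_cone k : measurable_fun setT (face_cone k).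
Proof.
apply: mfun_forall => i; case: (k <= i.+1)%N; last exact: measurable_cst.
rewrite (_ : (fun _ => _) = (fun l : 'rV[R]_d => 0 <= l ord0 i)) //; mfun.
Qed.

Lemma face_coneZ k (a : R) (l : 'rV[R]_d) : 0 < a -> face_cone k (a *: l) = face_cone k l.
Proof.
move=> a0; apply/face_coneP/face_coneP => h i /h; rewrite mxE.
  by rewrite pmulr_rge0.
by move=> li; rewrite pmulr_rge0.
Qed.

Lemma affine_comb_edge X (w : 'I_d.+1 -> R) : \sum_i w i = 1 ->
  \sum_i w i *: row i X = row ord0 X + (\row_i w (lift ord0 i)) *m edge_mx X.
Proof.
rewrite !big_ord_recl => w1; rewrite mulmx_sum_row.
under [in RHS]eq_bigr => i _.
  rewrite mxE (_ : row i (edge_mx X) = row (lift ord0 i) X - row ord0 X); last first.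
    by apply/rowP => j; rewrite !mxE.
  rewrite scalerBr.
  over.
rewrite sumrB -scaler_suml (_ : w ord0 = 1 - \sum_(i < d) w (lift ord0 i)); last first.
  by rewrite -w1 addrK.
by rewrite scalerBl scale1r -addrA [- _ + _]addrC.
Qed.

Lemma conv_rows_edge X (x : 'rV[R]_d) : conv_rows X predT x <->
  exists l : 'rV[R]_d, [/\ forall i, 0 <= l ord0 i, \sum_i l ord0 i <= 1 &
    x = row ord0 X + l *m edge_mx X].
Proof.
split=> [[l [l0 _ l1 ->]]|[l [l0 l1 ->]]].
  exists (\row_i l (lift ord0 i)); split.
  - by move=> i; rewrite mxE.
  - rewrite -l1 big_ord_recl; under eq_bigr do rewrite mxE.
    by rewrite lerDr.
  - exact: affine_comb_edge.
pose w (i : 'I_d.+1) := if unlift ord0 i is Some j then l ord0 j else 1 - \sum_j l ord0 j.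
have wl (j : 'I_d) : w (lift ord0 j) = l ord0 j by rewrite /w liftK.
have w1 : \sum_i w i = 1.
  rewrite big_ord_recl /w unlift_none.
  by under [X in _ + X]eq_bigr do rewrite liftK; rewrite subrK.
exists w; split => //.
- move=> i; rewrite /w; case: unliftP => [j _|_]; first exact: l0.
  by rewrite subr_ge0.
- rewrite (affine_comb_edge X w1); congr (_ + _ *m _).
  by apply/rowP => j; rewrite mxE wl.
Qed.

(** Edge coordinates of the barycentre of the face: weight [1 / k] on each of the vertices
    [1, ..., k - 1], the last [1 / k] being left to vertex 0. *)
Definition face_coord k : 'rV[R]_d := \row_(i < d) ((i.+1 < k)%N%:R / k%:R).

Lemma sum_ltn_indic n k : (k <= n)%N -> \sum_(i < n) (i < k)%N%:R = k%:R :> R.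
Proof.
move=> kn; rewrite -natr_sum; congr (_%:R).
rewrite -(subnKC kn) big_split_ord /= [X in (_ + X)%N]big1 ?addn0; last first.
  by move=> i _; rewrite ltnNge leq_addr.
under eq_bigr => i _ do rewrite ltn_ord.
by rewrite sum1_card card_ord.
Qed.

Lemma face_barycentre X k : (0 < k <= d.+1)%N ->
  k%:R^-1 *: (\sum_(i < d.+1 | (i < k)%N) row i X) =
  row ord0 X + face_coord k *m edge_mx X.
Proof.
move=> /andP[k0 kd].
have kR : (k%:R != 0 :> R) by rewrite pnatr_eq0 -lt0n.
pose w (i : 'I_d.+1) : R := (i < k)%N%:R / k%:R.
have w1 : \sum_i w i = 1.
  by rewrite -mulr_suml sum_ltn_indic // divff.
rewrite -[face_coord k](_ : \row_i w (lift ord0 i) = _); last first.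
  by apply/rowP => i; rewrite !mxE /w.
rewrite -(affine_comb_edge X w1) scaler_sumr big_mkcond; apply: eq_bigr => i _.
by rewrite /w; case: ifP => _; rewrite ?mul1r // mul0r scale0r.
Qed.

Lemma entry_le_enorm (y : 'rV[R]_d) j : `|y ord0 j| <= enorm y.
Proof.
rewrite /enorm -sqrtr_sqr ler_sqrt; last by apply: sumr_ge0 => i _; exact: sqr_ge0.
by rewrite (bigD1 j) //= lerDl sumr_ge0 // => i _; exact: sqr_ge0.
Qed.

Lemma sum_mulmx_le (N : 'M[R]_d) (y : 'rV[R]_d) :
  \sum_i `|(y *m N) ord0 i| <= enorm y * (\sum_i \sum_j `|N j i|).
Proof.
rewrite mulr_sumr; apply: ler_sum => i _.
rewrite mxE mulr_sumr; apply: le_trans (ler_norm_sum _ _ _) _.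
apply: ler_sum => j _; rewrite normrM ler_wpM2r //; exact: entry_le_enorm.
Qed.

(** At the barycentre the weights of the face vertices, vertex 0 included, equal [1 / k]. A
    displacement whose edge coordinates have total size at most [1 / k] keeps them nonnegative, so
    only the constraints of the other vertices remain, and these define the cone. *)
Lemma conv_rows_near_face X k : (0 < k <= d)%N -> edge_mx X \in unitmx ->
  exists2 r0 : R, 0 < r0 & forall x,
    let z := row ord0 X + face_coord k *m edge_mx X in
    enorm (x - z) < r0 ->
    (conv_rows X predT x <-> face_cone k ((x - z) *m invmx (edge_mx X))).
Proof.
move=> /andP[k0 kd] uM; set M := edge_mx X; set N := invmx M.
(* [C] bounds the total size of the edge coordinates by the Euclidean norm ([sum_mulmx_le]); the
   summand 1 keeps it positive, so that [1 / (k C)] is an admissible radius. *)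
pose C : R := 1 + \sum_i \sum_j `|N j i|.
have C0 : 0 < C by rewrite ltr_pwDl // sumr_ge0 // => i _; exact: sumr_ge0.
have kR : 0 < k%:R :> R by rewrite ltr0n.
exists (k%:R * C)^-1; first by rewrite invr_gt0 mulr_gt0.
move=> x z xz; rewrite conv_rows_edge; split => [[l [l0 l1 xE]]|/face_coneP h].
  apply/face_coneP => i ki.
  rewrite xE /z opprD addrACA subrr add0r -mulmxBl mulmxK // !mxE.
  by rewrite ltnNge ki mul0r subr0.
set eta := (x - z) *m N in h.
have etaS : \sum_i `|eta ord0 i| <= k%:R^-1.
  apply: le_trans (sum_mulmx_le _ _) _.
  apply: (@le_trans _ _ ((k%:R * C)^-1 * C)); last by rewrite invfM divfK // gt_eqF.
  by apply: ler_pM; rewrite ?enorm_ge0 ?(ltW xz) ?lerDr // sumr_ge0 // => i _; exact: sumr_ge0.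
have etai i : `|eta ord0 i| <= k%:R^-1.
  by apply: le_trans etaS; rewrite (bigD1 i) //= lerDl sumr_ge0.
exists (face_coord k + eta); split.
- move=> i; rewrite mxE [face_coord _ _ _]mxE; case: (ltnP i.+1 k) => ik.
    rewrite mul1r -lerBlDl sub0r lerNl; apply: le_trans (etai i).
    by rewrite -normrN ler_norm.
  by rewrite mul0r add0r h.
- under eq_bigr do rewrite mxE.
  rewrite big_split /=.
  have -> : \sum_i face_coord k ord0 i = 1 - k%:R^-1.
    have := @sum_ltn_indic d.+1 k (leqW kd); rewrite big_ord_recl /= k0 => /eqP.
    rewrite addrC eq_sym -subr_eq => /eqP E.
    under eq_bigr do rewrite mxE.
    by rewrite -mulr_suml -E mulrBl divff ?gt_eqF // mul1r.
  rewrite -lerBrDl opprB addrC subrK; apply: le_trans etaS.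
  by apply: ler_sum => i _; exact: ler_norm.
- by rewrite mulmxDl addrA /eta -mulmxA mulVmx // mulmx1 addrC subrK.
Qed.

Local Open Scope ereal_scope.

Lemma vol_near_face X k : (0 < k <= d)%N -> edge_mx X \in unitmx ->
  let z := (k%:R^-1 *: (\sum_(i < d.+1 | (i < k)%N) row i X))%R in
  \forall r \near 0^'+, vol (eball z r `&` conv_rows X predT) =
    cone_ball (fun x => face_cone k (x *m invmx (edge_mx X))) r /\
    vol (eball z r) = cone_ball (fun _ : 'rV[R]_d => true) r.
Proof.
move=> kd uM z.
have zE : z = (row ord0 X + face_coord k *m edge_mx X)%R.
  by rewrite /z face_barycentre //; case/andP: kd => -> /leqW ->.
have [r0 r00 hr] := conv_rows_near_face kd uM.
near=> r.
have rr : (r <= r0)%R by near: r; exact: nbhs_right_le.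
split.
- rewrite /vol /cone_ball -[RHS](intRd_shift (- z)%R); last 2 first.
  + apply: mfun_EFin; apply: mfun_mul; last by mfun.
    apply: mfun_natbool; apply: (measurableT_comp (measurable_face_cone k)); mfun.
  + by move=> x; rewrite lee_fin mulr_ge0.
  apply: eq_intRd => x; rewrite indicE -natrM mulnb; congr (_%:R%:E)%R; congr nat_of_bool.
  apply/idP/andP; rewrite inE /eball /=.
    move=> [xz Tx]; split => //.
    by have := (hr x); rewrite -zE /= => /(_ (lt_le_trans xz rr)) <-.
  move=> [Kx xz]; split => //.
  by have := (hr x); rewrite -zE /= => /(_ (lt_le_trans xz rr)) ->.
- rewrite /vol /cone_ball -[RHS](intRd_shift (- z)%R); last 2 first.
  + by mfun.
  + by move=> x; rewrite lee_fin mulr_ge0.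
  apply: eq_intRd => x; rewrite indicE mul1r; congr (_%:R%:E)%R; congr nat_of_bool.
  by apply/idP/idP; rewrite inE /eball.
Unshelve. all: by end_near. Qed.

Lemma vol_conv_rows_degenerate X z r : edge_mx X \notin unitmx ->
  vol (eball z r `&` conv_rows X predT) = 0.
Proof.
move=> uM.
have [c c0 Mc] : exists2 c : 'cV[R]_d, c != 0%R & (edge_mx X *m c = 0)%R.
  have : \det (edge_mx X)^T == 0%R by rewrite det_tr; move: uM; rewrite unitmxE unitfE negbK.
  move=> /det0P[v v0 vM]; exists v^T.
    by apply: contra_neq v0 => v0; rewrite -[v]trmxK v0 trmx0.
  by apply: trmx_inj; rewrite trmx_mul trmxK vM trmx0.
apply: (intRd_hyperplane (b := (row ord0 X *m c) ord0 ord0) c0) => x xc.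
rewrite indicE memNset //= => -[_ /conv_rows_edge[l [_ _ xE]]].
by move/eqP: xc; apply; rewrite xE mulmxDl -mulmxA Mc mulmx0 addr0.
Qed.

(** For small [r] the quotient of volumes is constant, a ratio of Gaussian masses of cones; passing
    to edge coordinates produces the determinant. For a degenerate simplex both sides are 0, the
    simplex lying in a hyperplane. *)
Lemma face_angleE X k : (0 < k <= d)%N ->
  (face_angle X k)%:E = ((pi `^ (d%:R / 2))^-1 * `|\det (edge_mx X)|)%R%:E *
    intRd (fun l : 'rV[R]_d => ((face_cone k l)%:R * expR (- enorm (l *m edge_mx X) ^+ 2))%R%:E).
Proof.
move=> kd; rewrite /face_angle /internal_angle_at.
set z := (_ *: _)%R.
have [uM|uM] := boolP (edge_mx X \in unitmx); last first.
  have -> : (fun r : R => fine (vol (eball z r `&` conv_rows X predT)) / fine (vol (eball z r)))%R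
    = cst 0%R by apply/funext => r; rewrite vol_conv_rows_degenerate //= mul0r.
  rewrite lim_cst //; move: uM; rewrite unitmxE unitfE negbK => /eqP ->.
  by rewrite normr0 mulr0 mul0e.
set M := edge_mx X; set K := fun x : 'rV[R]_d => face_cone k (x *m invmx M).
have mK : measurable_fun setT K.
  by apply: (measurableT_comp (measurable_face_cone k)); mfun.
have KZ (a : R) x : (0 < a)%R -> K (a *: x)%R = K x.
  by move=> a0; rewrite /K -scalemxAl face_coneZ.
pose T1 := fun _ : 'rV[R]_d => true.
have mT : measurable_fun setT T1 by exact: measurable_cst.
have TZ (a : R) x : (0 < a)%R -> T1 (a *: x)%R = T1 x by [].
have G1 : (0 < Gamma 1 :> R)%R by exact: Gamma_gt0.
have Gd : (0 < Gamma (d%:R / 2 + 1) :> R)%R.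
  by apply: Gamma_gt0; rewrite ltr_wpDl // divr_ge0.
have pp : (0 < pi `^ (d%:R / 2) :> R)%R by rewrite powR_gt0 // pi_gt0.
have VE (V : 'rV[R]_d -> bool) : measurable_fun setT V ->
    (forall (a : R) x, (0 < a)%R -> V (a *: x)%R = V x) ->
    cone_ball V 1 = (Gamma 1 / Gamma (d%:R / 2 + 1))%R%:E *
      intRd (fun x => ((V x)%:R * expR (- enorm x ^+ 2))%R%:E).
  move=> mV VZ; rewrite mulrC EFinM -muleA (cone_gauss mV VZ) muleA -EFinM mulVf ?mul1e //.
  exact: lt0r_neq0.
have V1 : cone_ball T1 1 = (Gamma 1 / Gamma (d%:R / 2 + 1) * pi `^ (d%:R / 2))%R%:E.
  rewrite VE // [RHS]EFinM; congr (_ * _).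
  have := @intRd_gauss R d 1%R ltr01; rewrite divr1 => <-.
  by apply: eq_intRd => x; rewrite !mul1r.
set GK := intRd (fun x => ((K x)%:R * expR (- enorm x ^+ 2))%R%:E).
have GKE : GK = `|\det M|%:E * intRd (fun l : 'rV[R]_d =>
    ((face_cone k l)%:R * expR (- enorm (l *m M) ^+ 2))%R%:E).
  rewrite /GK -(intRd_mulmx uM).
  - by congr (_ * _); apply: eq_intRd => l; rewrite /K mulmxK.
  - by mfun.
  - by move=> x; rewrite lee_fin mulr_ge0 ?expR_ge0.
have GKfin : GK \is a fin_num.
  have GK0 : 0 <= GK by apply: intRd_ge0 => x; rewrite lee_fin mulr_ge0 ?expR_ge0.
  rewrite ge0_fin_numE //; apply: (@le_lt_trans _ _ (pi `^ (d%:R / 2))%R%:E); last exact: ltry.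
  have := @intRd_gauss R d 1%R ltr01; rewrite divr1 => <-.
  apply: le_intRd; [by mfun|by mfun| |].
  - by move=> x; rewrite lee_fin mulr_ge0 ?expR_ge0.
  - by move=> x; rewrite lee_fin mul1r ler_piMl ?expR_ge0 // lern1 leq_b1.
rewrite EFinM -muleA -GKE.
have {}GKfin := fineK GKfin.
rewrite -GKfin -EFinM; congr EFin.
apply: cvg_lim => //.
apply: (@cvg_trans _ ((fun=> (pi `^ (d%:R / 2))^-1 * fine GK)%R @ 0^'+)); last exact: cvg_cst.
apply: near_eq_cvg.
near=> r.
have [-> ->] : vol (eball z r `&` conv_rows X predT) = cone_ball K r /\
    vol (eball z r) = cone_ball T1 r.
  by near: r; exact: vol_near_face.
have r0 : (0 < r)%R by near: r; exact: nbhs_right_gt.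
rewrite (cone_ball_scale mK KZ r0) (cone_ball_scale mT TZ r0) V1 VE // -/GK -GKfin -!EFinM /=.
have rd : (0 < r ^+ d)%R by rewrite exprn_gt0.
by field; rewrite !gt_eqF.
Unshelve. all: by end_near. Qed.

End face_angle.

(** * Normal forms of a rank-one perturbation *)

Section quadratic_form.
Variable R : realType.

(** The bordered matrix [B] has two block triangular factorisations, one for each diagonal block
    used as pivot. *)
Lemma det_rank1 (n : nat) (u : 'cV[R]_n) (v : 'rV[R]_n) :
  \det (1%:M + u *m v) = 1 + (v *m u) ord0 ord0.
Proof.
pose B : 'M[R]_(1 + n) := block_mx (1%:M : 'M[R]_1) v (- u) 1%:M.
have : \det B = \det (1%:M + u *m v).
  have -> : B = block_mx (1%:M : 'M[R]_1) 0 (- u) 1%:M *m block_mx 1%:M v 0 (1%:M + u *m v).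
    rewrite mulmx_block !mul1mx !mulmx1 !mul0mx ?mulmx0 ?addr0 ?add0r; congr block_mx.
    by rewrite mulNmx addrC addrK.
  by rewrite det_mulmx det_lblock det_ublock !det1 !mul1r.
move=> <-.
have -> : B = block_mx (1%:M : 'M[R]_1) v 0 1%:M *m
    block_mx (1%:M + v *m u) 0 (- u) 1%:M.
  rewrite mulmx_block !mul1mx !mulmx1 !mul0mx ?mulmx0 ?addr0 ?add0r; congr block_mx.
  by rewrite mulmxN addrK.
by rewrite det_mulmx det_lblock det_ublock !det1 !mul1r mulr1 det_mx11 !mxE.
Qed.

Lemma dot_self (n : nat) (u : 'rV[R]_n) : (u *m u^T) ord0 ord0 = \sum_i u ord0 i ^+ 2.
Proof. by rewrite mxE; apply: eq_bigr => i _; rewrite mxE expr2. Qed.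

Lemma outer_sqr (n : nat) (u : 'rV[R]_n) :
  (u^T *m u) *m (u^T *m u) = (\sum_i u ord0 i ^+ 2) *: (u^T *m u).
Proof.
rewrite mulmxA -[_ *m u^T]mulmxA [u *m u^T]mx11_scalar dot_self mul_mx_scalar.
by rewrite -scalemxAl.
Qed.

(** The reflection along [w - |w| e_0] exchanges [w] and [|w| e_0]; if the two coincide, the
    identity serves. *)
Lemma householder (n : nat) (w : 'rV[R]_n.+1) : exists Q : 'M[R]_n.+1,
  Q^T *m Q = 1%:M /\ w *m Q = Num.sqrt (\sum_i w ord0 i ^+ 2) *: delta_mx ord0 ord0.
Proof.
set W := \sum_i _; set a := Num.sqrt W.
have W0 : 0 <= W by apply: sumr_ge0 => i _; exact: sqr_ge0.
have a2 : a ^+ 2 = W by rewrite sqr_sqrtr.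
pose v := w - a *: delta_mx ord0 ord0.
have ww : w *m w^T = W%:M by rewrite [LHS]mx11_scalar dot_self.
have we : w *m (delta_mx ord0 ord0 : 'rV[R]_n.+1)^T = (w ord0 ord0)%:M.
  by rewrite trmx_delta -colE [LHS]mx11_scalar mxE.
have ee : (delta_mx ord0 ord0 : 'rV[R]_n.+1) *m (delta_mx ord0 ord0 : 'rV[R]_n.+1)^T = 1%:M.
  by rewrite trmx_delta mul_delta_mx; apply/matrixP => i j; rewrite !mxE !ord1.
have vT : v^T = w^T - a *: (delta_mx ord0 ord0 : 'rV[R]_n.+1)^T.
  by apply/matrixP => i j; rewrite !mxE.
pose V := \sum_i v ord0 i ^+ 2.
have VE : V = 2 * (W - a * w ord0 ord0).
  rewrite /V -dot_self vT /v mulmxBl !mulmxBr ww -!scalemxAl -!scalemxAr we.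
  have -> : delta_mx ord0 ord0 *m w^T = (w ord0 ord0)%:M :> 'M[R]_1.
    by rewrite -[LHS]trmxK trmx_mul trmxK we tr_scalar_mx.
  by rewrite ee !mxE !mulr1n -a2; ring.
have wv : w *m v^T = (W - a * w ord0 ord0)%:M.
  rewrite vT mulmxBr ww -scalemxAr we.
  by rewrite scale_scalar_mx -raddfB.
have [V0|V0] := eqVneq V 0.
  have v0 : v = 0.
    apply/rowP => i; rewrite [RHS]mxE; apply/eqP; rewrite -sqrf_eq0.
    have := V0; rewrite /V => /eqP; rewrite psumr_eq0; last by move=> j _; exact: sqr_ge0.
    by move/allP => /(_ i); rewrite mem_index_enum => /(_ isT).
  exists 1%:M; rewrite trmx1 mulmx1; split => //; rewrite mulmx1.
  by apply/eqP; rewrite -subr_eq0 -/v v0.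
pose J := v^T *m v.
exists (1%:M - (2 / V) *: J); split.
  have JT : J^T = J by rewrite /J trmx_mul trmxK.
  have -> : (1%:M - (2 / V) *: J)^T = 1%:M - (2 / V) *: J.
    by rewrite [LHS]linearB /= trmx1 [X in _ - X]linearZ /= JT.
  rewrite mulmxBl !mulmxBr !mul1mx mulmx1.
  rewrite -!scalemxAl -!scalemxAr /J outer_sqr -/V -/J !scalerA.
  rewrite (_ : 2 / V * (2 / V) * V = 2 / V + 2 / V); last by field.
  by rewrite scalerDl opprB addrK subrK.
rewrite mulmxBr mulmx1 -scalemxAr /J mulmxA wv mul_scalar_mx scalerA.
rewrite (_ : 2 / V * _ = 1); last first.
  by rewrite mulrAC -VE divff.
by rewrite scale1r /v opprB addrCA subrr addr0.
Qed.


Lemma rank1_inverse_sqrt (n : nat) (u : 'rV[R]_n) : exists P : 'M[R]_n,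
  [/\ P^T *m (1%:M + u^T *m u) *m P = 1%:M,
      forall w : 'cV[R]_n, u *m w = 0 -> P *m w = w &
      \det P = (Num.sqrt (1 + \sum_i u ord0 i ^+ 2))^-1].
Proof.
set m := \sum_i _; pose s := Num.sqrt (1 + m).
have m0 : 0 <= m by apply: sumr_ge0 => i _; exact: sqr_ge0.
have s0 : 0 < s by rewrite sqrtr_gt0 ltr_pwDl.
have s2 : m = s ^+ 2 - 1 by rewrite sqr_sqrtr ?addr_ge0 // addrC addKr.
have s1 : 0 < 1 + s by rewrite ltr_wpDr // ltW.
(* On the line spanned by [u], [J] acts as [m = s^2 - 1], and [P] has to act as [1 / s]; solving
   [1 - c m = 1 / s] gives this [c], in a form that also covers [u = 0]. *)
pose c := (s * (1 + s))^-1.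
pose J := u^T *m u.
have JJ : J *m J = m *: J by exact: outer_sqr.
exists (1%:M - c *: J); split.
- have JT : J^T = J by rewrite /J trmx_mul trmxK.
  have -> : (1%:M - c *: J)^T = 1%:M - c *: J.
    by rewrite [LHS]linearB /= trmx1 [X in _ - X]linearZ /= JT.
  rewrite -/J; move: (J) JJ => {JT}J JJ.
  have -> : (1%:M - c *: J) *m (1%:M + J) = 1%:M + (1 - c - c * m) *: J.
    rewrite mulmxDr mulmx1 mulmxBl mul1mx -scalemxAl JJ scalerA.
    by rewrite !scalerBl scale1r -!addrA; congr (_ + _); rewrite addrCA addrA.
  rewrite mulmxBr mulmx1 mulmxDl mul1mx -scalemxAl -!scalemxAr JJ !scalerA.
  rewrite -scalerDl -addrA -scalerBl -[RHS]addr0; congr (_ + _).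
  rewrite -[RHS](scale0r J); congr (_ *: _).
  by rewrite s2 /c; field; rewrite !gt_eqF.
- by move=> w uw; rewrite mulmxBl mul1mx -scalemxAl /J -mulmxA uw mulmx0 scaler0 subr0.
- rewrite (_ : 1%:M - c *: J = 1%:M + u^T *m (- c *: u)); last first.
    by rewrite -scalemxAr scaleNr.
  rewrite det_rank1 -scalemxAl mxE dot_self -/m -/s s2 /c.
  by field; rewrite !gt_eqF.
Qed.

(** One basis normalises the quadratic form and at the same time sends a multiple of [e_0] to the
    all-ones vector. The two demands are compatible because [sum_i h_i = 0]: with [w_i = sqrt t_i]
    and [u_i = h_i / w_i] this says that [u] is orthogonal to [w], so the inverse square root [P] of
    [1 + u^T u] fixes [w]. *)
Lemma gram_basis (n : nat) (t h : 'rV[R]_n.+1) : (forall i, 0 < t ord0 i) ->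
  \sum_i h ord0 i = 0 -> exists A : 'M[R]_n.+1,
  [/\ A^T *m (diag_mx t + h^T *m h) *m A = 1%:M,
      A *m (Num.sqrt (\sum_i t ord0 i) *: delta_mx ord0 ord0) = const_mx 1 :> 'cV[R]_n.+1 &
      `|\det A| = (Num.sqrt ((\prod_i t ord0 i) * (1 + \sum_i h ord0 i ^+ 2 / t ord0 i)))^-1].
Proof.
move=> t0 h0.
pose w : 'rV[R]_n.+1 := \row_i Num.sqrt (t ord0 i).
have w0 i : 0 < w ord0 i by rewrite mxE sqrtr_gt0.
have w2 i : w ord0 i ^+ 2 = t ord0 i by rewrite mxE sqr_sqrtr // ltW.
pose v : 'rV[R]_n.+1 := \row_i (w ord0 i)^-1.
pose u : 'rV[R]_n.+1 := \row_i (h ord0 i / w ord0 i).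
have u2 : \sum_i u ord0 i ^+ 2 = \sum_i h ord0 i ^+ 2 / t ord0 i.
  by apply: eq_bigr => i _; rewrite mxE expr_div_n w2.
have [P [PP Pw detP]] := rank1_inverse_sqrt u.
have [Q [QQ wQ]] := householder w.
have vw : diag_mx v *m diag_mx w = 1%:M.
  rewrite mulmx_diag -diag_const_mx; congr diag_mx; apply/rowP => i.
  by rewrite !mxE mulVf // gt_eqF // sqrtr_gt0.
have SE : diag_mx t + h^T *m h = diag_mx w *m (1%:M + u^T *m u) *m diag_mx w.
  have hE : h = u *m diag_mx w.
    apply/rowP => i; rewrite mul_mx_diag !mxE divfK // gt_eqF // sqrtr_gt0 //.
  rewrite mulmxDr mulmx1 mulmxDl mulmx_diag {1 2}hE trmx_mul tr_diag_mx !mulmxA.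
  congr (diag_mx _ + _); apply/rowP => i; rewrite [RHS]mxE -expr2 w2 //.
have wv : diag_mx w *m diag_mx v = 1%:M by rewrite diag_mxC.
exists (diag_mx v *m P *m Q); split.
- rewrite SE !trmx_mul tr_diag_mx !mulmxA -[_ *m diag_mx v *m diag_mx w]mulmxA vw mulmx1.
  rewrite -[_ *m diag_mx w *m diag_mx v]mulmxA wv mulmx1.
  by rewrite -(mulmxA Q^T) -(mulmxA Q^T) PP mulmx1.
- have uw : u *m w^T = 0.
    apply/matrixP => i j; rewrite !ord1 !mxE -[RHS]h0; apply: eq_bigr => k _.
    by rewrite !mxE divfK // gt_eqF // sqrtr_gt0.
  have -> : Num.sqrt (\sum_i t ord0 i) *: delta_mx ord0 ord0 = (w *m Q)^T :> 'cV[R]_n.+1.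
    rewrite wQ linearZ /= trmx_delta; congr (Num.sqrt _ *: _).
    by apply: eq_bigr => i _; rewrite w2.
  have QQT : Q *m Q^T = 1%:M by apply: mulmx1C.
  rewrite trmx_mul -!mulmxA [Q *m _]mulmxA QQT mul1mx Pw //.
  by apply/colP => i; rewrite mul_diag_mx !mxE mulVf // gt_eqF // sqrtr_gt0.
- have detQ : `|\det Q| = 1.
    have : \det Q ^+ 2 = 1 by rewrite expr2 -{1}det_tr -det_mulmx QQ det1.
    by move/eqP; rewrite sqrf_eq1 => /orP[] /eqP ->; rewrite ?normrN normr1.
  rewrite !det_mulmx !normrM detQ mulr1 detP det_diag u2.
  have -> : \prod_i v ord0 i = (Num.sqrt (\prod_i t ord0 i))^-1.
    rewrite -sqrtrV; last by apply: prodr_ge0 => i _; exact: ltW.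
    have p0 : 0 <= \prod_i v ord0 i by apply: prodr_ge0 => i _; rewrite mxE invr_ge0 ltW.
    rewrite -[LHS]ger0_norm // -sqrtr_sqr -prodrXl -prodfV; congr Num.sqrt.
    by apply: eq_bigr => i _; rewrite mxE exprVn w2.
  rewrite sqrtrM; last by apply: prodr_ge0 => i _; exact: ltW.
  by rewrite invfM ger0_norm ?invr_ge0 ?sqrtr_ge0 // ger0_norm ?invr_ge0 ?sqrtr_ge0.
Qed.

End quadratic_form.

(** * Integrating the vertices out *)

Section gaussian_determinant.
Variables (R : realType) (d : nat).
Implicit Types (X : 'M[R]_(d.+1, d)) (l : 'rV[R]_d) (t : 'rV[R]_d.+1).

(** The zero-sum vector [h] of coefficients on all vertices, recovered from its edge coordinates. *)
Definition hat l : 'rV[R]_d.+1 := row_mx (- (\sum_i l ord0 i))%:M l : 'rV[R]_(1 + d).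

Lemma hat0 l : hat l ord0 ord0 = - \sum_i l ord0 i.
Proof.
transitivity ((hat l : 'rV[R]_(1 + d)) ord0 (lshift d ord0)).
  by congr (hat l _ _); exact/val_inj.
by rewrite row_mxEl mxE eqxx.
Qed.

Lemma hatS l i : hat l ord0 (lift ord0 i) = l ord0 i.
Proof.
transitivity ((hat l : 'rV[R]_(1 + d)) ord0 (rshift 1 i)).
  by congr (hat l _ _); exact/val_inj.
by rewrite row_mxEr.
Qed.

Lemma sum_hat l : \sum_i hat l ord0 i = 0.
Proof.
by rewrite big_ord_recl hat0 (eq_bigr _ (fun i _ => hatS l i)) addNr.
Qed.

Lemma hat_mul l X : hat l *m X = l *m edge_mx X.
Proof.
apply/rowP => j; rewrite !mxE big_ord_recl hat0.
under [X in _ + X]eq_bigr do rewrite hatS.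
under [in RHS]eq_bigr do rewrite mxE mulrBr.
by rewrite sumrB -mulr_suml mulNr addrC.
Qed.

(** Bordering by ones turns the edge determinant into one of size [d + 1], on which a left
    multiplication of [X] acts as soon as it controls the all-ones column; this is what the second
    clause of [gram_basis] provides. *)
Lemma det_edge X : \det (edge_mx X) =
  \det (row_mx (const_mx 1 : 'cV[R]_d.+1) X : 'M[R]_(1 + d)).
Proof.
pose L : 'M[R]_(1 + d) := block_mx (1%:M : 'M[R]_1) 0 (const_mx (-1)) 1%:M.
have detL : \det L = 1 by rewrite det_lblock !det1 mulr1.
have E : (row_mx (const_mx 1 : 'cV[R]_d.+1) X : 'M[R]_(1 + d)) =
    block_mx (1%:M : 'M[R]_1) (row ord0 X) (const_mx 1) (dsubmx (X : 'M[R]_(1 + d, d))).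
  rewrite -[LHS](@submxK _ 1 d 1 d); congr block_mx; apply/matrixP => i j.
  - by rewrite !mxE !ord1; case: splitP => // k _; rewrite mxE.
  - rewrite !mxE; case: splitP => k /= => [|/eqP]; first by case: k => -[].
    rewrite eqSS => /eqP/val_inj <-; by congr (X _ _); rewrite ord1; exact/val_inj.
  - by rewrite !mxE; case: splitP => k; rewrite ?mxE //= => /eqP; rewrite !ord1.
  - rewrite !mxE; case: splitP => k /= => [|/eqP]; first by case: k => -[].
    by rewrite eqSS => /eqP/val_inj <-.
have -> : \det (row_mx (const_mx 1 : 'cV[R]_d.+1) X : 'M[R]_(1 + d)) = \det (L *m
    block_mx (1%:M : 'M[R]_1) (row ord0 X) (const_mx 1) (dsubmx (X : 'M[R]_(1 + d, d)))).
  by rewrite det_mulmx detL mul1r -E.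
rewrite mulmx_block !mul1mx !mul0mx !addr0 mulmx1.
rewrite (_ : const_mx (-1) + const_mx 1 = 0); last first.
  by apply/matrixP => i j; rewrite !mxE addNr.
rewrite det_ublock det1 mul1r; congr determinant.
apply/matrixP => i j; rewrite !mxE big_ord1 !mxE mulN1r addrC; congr (X _ _ - _).
exact/val_inj.
Qed.

Local Open Scope ereal_scope.

(** A factor common to all cones, left unevaluated. *)
Definition gauss_det_const : \bar R := intM (fun Z : 'M[R]_(d.+1, d) =>
  (`|\det (dsubmx (Z : 'M[R]_(1 + d, d)))| * expR (- \sum_i \sum_j Z i j ^+ 2))%R%:E).

Definition qform t l : R := (\sum_i hat l ord0 i ^+ 2 / t ord0 i)%R.

Lemma trace_sqr (m n : nat) (Z : 'M[R]_(m, n)) :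
  (\tr (Z^T *m Z) = \sum_i \sum_j Z i j ^+ 2)%R.
Proof.
rewrite exchange_big /mxtrace; apply: eq_bigr => j _; rewrite mxE.
by apply: eq_bigr => i _; rewrite mxE expr2.
Qed.

(** The exponent is [tr (X^T (diag t + h^T h) X)]. Under [X = A Z] it becomes the squared norm of
    [Z], and the bordering column becomes a multiple of [e_0], so only the lower rows of [Z] stay in
    the determinant. Of the [d + 1] factors [|det A|], [d] come from the Jacobian and one from the
    bordered determinant. *)
Lemma gauss_det_integral t l : (forall i, 0 < t ord0 i)%R ->
  intM (fun X => (`|\det (edge_mx X)| *
    expR (- (\sum_i t ord0 i * enorm (row i X) ^+ 2 + enorm (l *m edge_mx X) ^+ 2)))%R%:E) =
  gauss_det_const * (Num.sqrt (\sum_i t ord0 i) *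
    (Num.sqrt ((\prod_i t ord0 i) * (1 + qform t l)))^-1 ^+ d.+1)%R%:E.
Proof.
move=> t0; have [A [AA Ae detA]] := gram_basis t0 (sum_hat l).
set D := (Num.sqrt (_ * _))^-1%R; rewrite -/(qform t l) -/D in detA.
have D0 : (0 < D)%R.
  rewrite invr_gt0 sqrtr_gt0 mulr_gt0 ?prodr_gt0 //.
  rewrite ltr_pwDl // sumr_ge0 // => i _; rewrite divr_ge0 ?sqr_ge0 // ltW //.
have uA : A \in unitmx by rewrite unitmxE unitfE -normr_gt0 detA.
set S := Num.sqrt (\sum_i t ord0 i).
set f := (X in intM X).
have f0 X : 0 <= f X by rewrite lee_fin mulr_ge0 ?expR_ge0.
have mf : measurable_fun setT f by rewrite /f /edge_mx; mfun.
have quadE (Y : 'M[R]_(d.+1, d)) :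
    (\sum_i t ord0 i * enorm (row i Y) ^+ 2 + enorm (l *m edge_mx Y) ^+ 2 =
     \tr (Y^T *m (diag_mx t + (hat l)^T *m hat l) *m Y))%R.
  rewrite mulmxDr mulmxDl linearD /=; congr (_ + _)%R.
    rewrite /mxtrace [RHS](eq_bigr (fun j => \sum_i t ord0 i * Y i j ^+ 2)%R); last first.
      move=> j _; rewrite mxE; apply: eq_bigr => i _; rewrite mul_mx_diag !mxE.
      by rewrite mulrAC -expr2 mulrC.
    rewrite exchange_big /=; apply: eq_bigr => i _; rewrite enorm_sqr mulr_sumr.
    by apply: eq_bigr => j _; rewrite mxE.
  rewrite -hat_mul enorm_sqr !mulmxA -trmx_mul -mulmxA trace_sqr big_ord1.
  by [].
have detE (Z : 'M[R]_(d.+1, d)) :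
    (`|\det (edge_mx (A *m Z))| = D * S * `|\det (dsubmx (Z : 'M[R]_(1 + d, d)))|)%R.
  rewrite det_edge.
  have -> : (row_mx (const_mx 1%R : 'cV[R]_d.+1) (A *m Z) : 'M[R]_(1 + d)) =
      (A : 'M[R]_(1 + d)) *m (row_mx ((S *: delta_mx ord0 ord0)%R : 'cV[R]_d.+1) Z : 'M[R]_(1 + d)).
    by rewrite -Ae -/S (mul_mx_row A).
  rewrite det_mulmx normrM detA -mulrA; congr (_ * _)%R.
  have -> : (row_mx ((S *: delta_mx ord0 ord0)%R : 'cV[R]_d.+1) Z : 'M[R]_(1 + d)) =
      block_mx (S%:M : 'M[R]_1) (usubmx (Z : 'M[R]_(1 + d, d))) 0%R (dsubmx (Z : 'M[R]_(1 + d, d))).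
    rewrite [RHS](@block_mxEh _ 1 d 1 d) -[Z in LHS](@vsubmxK _ 1 d d); congr row_mx.
    apply/colP => i; case: (@split_ordP 1 d i) => k ->.
      by rewrite !ord1 (@col_mxEu _ 1 d 1) !mxE eqxx mulr1 mulr1n.
    by rewrite (@col_mxEd _ 1 d 1) !mxE mulr0.
  by rewrite (@det_ublock _ 1 d) det_scalar1 normrM ger0_norm ?sqrtr_ge0.
rewrite -(left_mul_scales_unit uA mf f0) detA.
rewrite [X in _ * X](_ : _ = (D * S)%R%:E * gauss_det_const); last first.
  rewrite /gauss_det_const -intMZl; last 3 first.
  - by mfun.
  - by move=> Z; rewrite lee_fin mulr_ge0 ?expR_ge0.
  - by rewrite lee_fin mulr_ge0 ?sqrtr_ge0 // ltW.
  apply: eq_intM => Z; rewrite /f -EFinM detE quadE -!mulrA; congr EFin; do 3!congr (_ * _)%R; congr (expR (- _))%R.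
  rewrite trmx_mul !mulmxA -(mulmxA Z^T) -(mulmxA Z^T) AA mulmx1.
  exact: trace_sqr.
by rewrite muleA -EFinM muleC; congr (_ * _%:E); rewrite exprS; ring.
Qed.

End gaussian_determinant.

(** * Gamma mixture of the densities *)

Section mixture.
Variables (R : realType) (d : nat) (alpha : R).
Hypothesis alpha0 : 0 < alpha.
Local Notation mu := (@lebesgue_measure R).
Local Open Scope ereal_scope.

Let b : R := ((alpha + d%:R) / 2)%R.
(** This is [b - (d + 1) / 2]: the factor [(prod_i t_i)^(- (d + 1) / 2)] produced by the determinant
    lowers the Gamma shape. It is nonpositive for [alpha <= 1], and then [gamma_ker s0] is not
    integrable at 0. *)
Let s0 : R := ((alpha - 1) / 2)%R.

Let b0 : (0 < b)%R. Proof. by rewrite divr_gt0 // ltr_pwDl. Qed.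
Let db : (d%:R / 2 < b)%R. Proof. by rewrite ltr_pM2r // ltrDr. Qed.

Definition mixE (X : 'M[R]_(d.+1, d)) (t : 'rV[R]_d.+1) : R :=
  (\prod_i ((0 < t ord0 i)%R%:R * (t ord0 i `^ (b - 1) *
    expR (- ((1 + enorm (row i X) ^+ 2) * t ord0 i)))))%R.

Let Cb : R := ((ctd d b / Gamma b) ^+ d.+1)%R.

Lemma ctd_gt0 (m : nat) (c : R) : (m%:R / 2 < c)%R -> (0 < ctd m c)%R.
Proof.
move=> mc; have c0 : (0 < c)%R by apply: le_lt_trans mc; rewrite divr_ge0.
by rewrite divr_gt0 ?mulr_gt0 ?Gamma_gt0 ?powR_gt0 ?pi_gt0 ?subr_gt0.
Qed.

Let Cb0 : (0 <= Cb)%R.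
Proof. by rewrite exprn_ge0 // divr_ge0 // ltW // ?ctd_gt0 ?Gamma_gt0. Qed.

Lemma prod_betap (X : 'M[R]_(d.+1, d)) :
  (\prod_i betap_density b (row i X))%R%:E = Cb%:E * intRd (fun t => (mixE X t)%:E).
Proof.
rewrite /mixE.
under eq_intRd do rewrite -prod_EFin.
pose g (i : 'I_d.+1) (t : R) : \bar R :=
  ((0 < t)%R%:R * (t `^ (b - 1) * expR (- ((1 + enorm (row i X) ^+ 2) * t))))%R%:E.
rewrite (@intRd_prod R d.+1 g); last 2 first.
- by move=> i; rewrite /g; mfun.
- by move=> i t; rewrite lee_fin mulr_ge0 // mulr_ge0 ?powR_ge0 ?expR_ge0.
have gE i : \int[mu]_t g i t = ((1 + enorm (row i X) ^+ 2) `^ (- b) * Gamma b)%R%:E.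
  rewrite /g integral_gamma_scale //; first by rewrite mulrC.
  by rewrite ltr_pwDl // sqr_ge0.
rewrite (eq_bigr _ (fun i _ => gE i)) prod_EFin -EFinM; congr EFin.
rewrite /Cb -[X in (_ ^+ X)%R](card_ord d.+1) -prodr_const -big_split /=.
have Gn : (Gamma b != 0)%R by rewrite gt_eqF // Gamma_gt0.
apply: eq_bigr => i _; rewrite /betap_density; move: (ctd d b) => c.
rewrite -[c in LHS](divfK Gn) -[LHS]mulrA.
by rewrite [(Gamma b * _)%R]mulrC.
Qed.

(** [expected_angle] with the angle replaced by its Gaussian formula. The formula also makes sense
    at [k = d.+1], where the cone is the whole space; that case calibrates the constants. *)
Definition EK k : \bar R := intM (fun X : 'M[R]_(d.+1, d) =>
  ((pi `^ (d%:R / 2))^-1 * `|\det (edge_mx X)|)%R%:E *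
  intRd (fun l : 'rV[R]_d => ((face_cone k l)%:R * expR (- enorm (l *m edge_mx X) ^+ 2))%R%:E) *
  (\prod_i betap_density b (row i X))%R%:E).

Lemma expected_angle_EK k : (0 < k <= d)%N -> expected_angle d.+1 k b = EK k.
Proof.
move=> kd; rewrite /expected_angle /EK /intM /=; apply: eq_intRd => v.
by rewrite EFinM face_angleE.
Qed.

Definition JK k : \bar R := intRd (fun l : 'rV[R]_d => intRd (fun t : 'rV[R]_d.+1 =>
  ((face_cone k l)%:R * (\prod_i gamma_ker s0 (t ord0 i) *
    (Num.sqrt (\sum_i t ord0 i) * (1 + qform t l) `^ (- (d.+1%:R / 2)))))%R%:E)).

Lemma powR_prod (n : nat) (f : 'I_n -> R) p : (forall i, 0 <= f i)%R ->
  ((\prod_i f i) `^ p = \prod_i (f i `^ p))%R.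
Proof.
move=> f0; elim: (index_enum _) => [|i s IH]; first by rewrite !big_nil powR1.
by rewrite !big_cons powRM ?IH // prodr_ge0.
Qed.

Lemma gamma_ker_weight (t : 'rV[R]_d.+1) l :
  (\prod_i gamma_ker b (t ord0 i) *
    (Num.sqrt (\sum_i t ord0 i) * (Num.sqrt ((\prod_i t ord0 i) * (1 + qform t l)))^-1 ^+ d.+1) =
  \prod_i gamma_ker s0 (t ord0 i) *
    (Num.sqrt (\sum_i t ord0 i) * (1 + qform t l) `^ (- (d.+1%:R / 2))))%R.
Proof.
have [/forallP t0|] := boolP [forall i, (0 < t ord0 i)%R]; last first.
  rewrite negb_forall => /existsP[i ti].
  have z s : (\prod_i gamma_ker s (t ord0 i) = 0)%R.
    by rewrite (bigD1 i) //= /gamma_ker (negbTE ti) !mul0r.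
  by rewrite !z !mul0r.
have q0 : (0 <= qform t l)%R by apply: sumr_ge0 => i _; rewrite divr_ge0 ?sqr_ge0 // ltW.
have p0 : (0 < \prod_i t ord0 i)%R by exact: prodr_gt0.
have q1 : (0 < 1 + qform t l)%R by rewrite ltr_pwDl.
have sqrtX (x : R) : (0 < x)%R -> ((Num.sqrt x)^-1 ^+ d.+1 = x `^ (- (d.+1%:R / 2)))%R.
  move=> x0; rewrite -powR12_sqrt ?(ltW x0) // -powRN -powR_mulrn ?powR_ge0 // -powRrM.
  by congr powR; field.
rewrite sqrtX ?mulr_gt0 // powRM ?(ltW p0) ?(ltW q1) //.
rewrite [LHS]mulrCA [RHS]mulrCA; congr (_ * _)%R; rewrite mulrA; congr (_ * _)%R.
rewrite powR_prod; last by move=> i; exact: ltW.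
rewrite -big_split /=; apply: eq_bigr => i _; rewrite /gamma_ker t0 !mul1r mulrAC.
congr (_ * _)%R; rewrite -powRD; last by rewrite (gt_eqF (t0 i)) implybT.
by congr powR; rewrite /b /s0 -natr1; field.
Qed.

Let JKf k l (t : 'rV[R]_d.+1) : R :=
  ((face_cone k l)%:R * (\prod_i gamma_ker s0 (t ord0 i) *
    (Num.sqrt (\sum_i t ord0 i) * (1 + qform t l) `^ (- (d.+1%:R / 2)))))%R.

Let JK_ge0 k l t : 0 <= (JKf k l t)%:E.
Proof.
rewrite lee_fin !mulr_ge0 ?sqrtr_ge0 ?powR_ge0 // prodr_ge0 // => i _.
exact: gamma_ker_ge0.
Qed.

Lemma mfun_qform (e : measure_display) (T : measurableType e)
    (t : T -> 'rV[R]_d.+1) (l : T -> 'rV[R]_d) :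
  measurable_fun setT t -> measurable_fun setT l ->
  measurable_fun setT (fun p => qform (t p) (l p)).
Proof.
move=> mt ml; rewrite /qform; apply: mfun_bigsum => i; apply: mfun_mul; last by mfun.
apply: mfun_exp; apply: (@mfun_entry _ _ _ _ _ (fun p => hat (l p))).
by rewrite /hat; mfun.
Qed.

Let measurable_JK (e : measure_display) (T : measurableType e) k
    (t : T -> 'rV[R]_d.+1) (l : T -> 'rV[R]_d) :
  measurable_fun setT t -> measurable_fun setT l ->
  measurable_fun setT (fun p => (JKf k (l p) (t p))%:E).
Proof.
move=> mt ml; rewrite /JKf; apply: mfun_EFin; apply: mfun_mul.
  by apply: mfun_natbool; exact: (measurableT_comp (measurable_face_cone k)).
apply: mfun_mul.
  apply: (@mfun_bigprod _ _ _ _ _ _ (fun i p => gamma_ker s0 (t p ord0 i))) => i.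
  by apply: (measurableT_comp (measurable_gamma_ker s0)); mfun.
apply: mfun_mul; first by mfun.
by apply: mfun_powR; apply: mfun_add; [exact: measurable_cst|exact: mfun_qform].
Qed.

Let measurable_JK_inner k : measurable_fun setT (fun l : 'rV[R]_d =>
  intRd (fun t => (JKf k l t)%:E)).
Proof.
apply: (@measurable_intRd R d.+1 _ 'rV[R]_d (fun l t => (JKf k l t)%:E)) => //.
by apply: measurable_JK; mfun.
Qed.

Let F k (X : 'M[R]_(d.+1, d)) l (t : 'rV[R]_d.+1) : R :=
  ((face_cone k l)%:R * (\prod_i gamma_ker b (t ord0 i) * (`|\det (edge_mx X)| *
    expR (- (\sum_i t ord0 i * enorm (row i X) ^+ 2 + enorm (l *m edge_mx X) ^+ 2)))))%R.

Let F0 k X l t : 0 <= (F k X l t)%:E.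
Proof.
rewrite lee_fin mulr_ge0 // mulr_ge0 ?mulr_ge0 ?expR_ge0 // prodr_ge0 // => i _.
exact: gamma_ker_ge0.
Qed.

Let mF (e : measure_display) (T : measurableType e) k X l t :
  measurable_fun [set: T] X -> measurable_fun [set: T] l -> measurable_fun [set: T] t ->
  measurable_fun setT (fun p : T => (F k (X p) (l p) (t p))%:E).
Proof.
move=> mX ml mt; rewrite /F /edge_mx; apply: mfun_EFin; apply: mfun_mul.
  by apply: mfun_natbool; exact: (measurableT_comp (measurable_face_cone k)).
apply: mfun_mul; last by mfun.
apply: (@mfun_bigprod _ _ _ _ _ _ (fun i p => gamma_ker b (t p ord0 i))) => i.
by apply: (measurableT_comp (measurable_gamma_ker b)); mfun.
Qed.

(** For fixed [l] and [t] the integral over [X] is [gauss_det_integral]. The cone is a condition on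
    [l] alone, so the factor pulled out is the same for every [k]. *)
Lemma EK_JK : exists2 a : \bar R, 0 <= a & forall k, EK k = a * JK k.
Proof.
pose c : R := ((pi `^ (d%:R / 2))^-1 * Cb)%R.
have c0 : (0 <= c)%R by rewrite mulr_ge0 // invr_ge0 powR_ge0.
have G0 : 0 <= gauss_det_const R d.
  by apply: intM_ge0 => Z; rewrite lee_fin mulr_ge0 ?expR_ge0.
exists (c%:E * gauss_det_const R d); first by rewrite mule_ge0.
move=> k.
transitivity (intM (fun X => c%:E * intRd (fun l => intRd (fun t => (F k X l t)%:E)))).
  apply: eq_intM => X; rewrite prod_betap /c EFinM -!muleA.
  rewrite EFinM -muleA; congr (_ * _); rewrite [Cb%:E * _]muleC !muleA [_ * Cb%:E]muleC.
  congr (_ * _).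
  have mix0 t : 0 <= (mixE X t)%:E.
    rewrite lee_fin prodr_ge0 // => i _.
    by rewrite mulr_ge0 // mulr_ge0 ?powR_ge0 ?expR_ge0.
  have mmix : measurable_fun setT (fun t => (mixE X t)%:E) by rewrite /mixE; mfun.
  have mcone : measurable_fun setT (fun l : 'rV[R]_d =>
      ((face_cone k l)%:R * expR (- enorm (l *m edge_mx X) ^+ 2))%R%:E).
    apply: mfun_EFin; apply: mfun_mul; last by mfun.
    by apply: mfun_natbool; exact: measurable_face_cone.
  rewrite -[X in X * _]intRdZl //.
  rewrite muleC -intRdZl; last 3 first.
  - by apply: mfun_mule => //; exact: measurable_cst.
  - by move=> l; rewrite mule_ge0 // lee_fin mulr_ge0 ?expR_ge0.
  - exact: intRd_ge0.
  apply: eq_intRd => l; rewrite muleC -intRdZl //.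
  apply: eq_intRd => t; rewrite -!EFinM; congr EFin; rewrite /mixE /F.
  have -> : (\prod_i ((0 < t ord0 i)%R%:R * (t ord0 i `^ (b - 1) *
      expR (- ((1 + enorm (row i X) ^+ 2) * t ord0 i)))) =
      \prod_i gamma_ker b (t ord0 i) * expR (- \sum_i t ord0 i * enorm (row i X) ^+ 2))%R.
    rewrite -sumrN expR_sum -big_split /=; apply: eq_bigr => i _.
    rewrite /gamma_ker -!mulrA -expRD; congr (_ * (_ * expR _))%R.
    by ring.
  by rewrite opprD expRD; ring.
have mF1 : measurable_fun setT (fun p : 'M[R]_(d.+1, d) * 'rV[R]_d =>
    intRd (fun t => (F k p.1 p.2 t)%:E)).
  apply: (@measurable_intRd R d.+1 _ ('M[R]_(d.+1, d) * 'rV[R]_d)%type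
    (fun p t => (F k p.1 p.2 t)%:E)) => //.
  by apply: mF; mfun.
rewrite intMZl; last 3 first.
- by apply: (@measurable_intRd R d _ 'M[R]_(d.+1, d)
    (fun X l => intRd (fun t => (F k X l t)%:E))) => // X l; exact: intRd_ge0.
- by move=> X; apply: intRd_ge0 => l; exact: intRd_ge0.
- by rewrite lee_fin.
rewrite -muleA; congr (_ * _).
rewrite (intM_swap mF1); last by move=> X l; exact: intRd_ge0.
rewrite /JK -intRdZl //; last 2 first.
- exact: measurable_JK_inner.
- by move=> l; apply: intRd_ge0 => t; exact: JK_ge0.
apply: eq_intRd => l.
rewrite (intM_swap (f := fun X t => (F k X l t)%:E)) //; last by apply: mF; mfun.
rewrite -intRdZl //; last 2 first.
- by apply: measurable_JK; mfun.
- by move=> t; exact: JK_ge0.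
apply: eq_intRd => t.
rewrite -gamma_ker_weight mulrA EFinM.
have [/forallP t0|] := boolP [forall i, (0 < t ord0 i)%R]; last first.
  rewrite negb_forall => /existsP[i ti].
  have z : (\prod_i gamma_ker b (t ord0 i) = 0)%R.
    by rewrite (bigD1 i) //= /gamma_ker (negbTE ti) !mul0r.
  rewrite z mulr0 mul0e mule0 -[RHS](@intRd0 R (d.+1 * d)); apply: eq_intRd => v.
  by rewrite /F z mul0r mulr0.
rewrite muleCA -gauss_det_integral // -intMZl.
- by apply: eq_intM => X; rewrite /F -EFinM mulrA.
- by rewrite /edge_mx; mfun.
- by move=> X; rewrite lee_fin mulr_ge0 ?expR_ge0.
- rewrite lee_fin mulr_ge0 // prodr_ge0 // => i _; exact: gamma_ker_ge0.
Qed.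

End mixture.

(** * Degenerate simplices form a null set *)

Section singular_null.
Variable R : realType.
Local Notation mu := (@lebesgue_measure R).
Local Open Scope ereal_scope.

Lemma intRdD d (f g : 'rV[R]_d -> \bar R) :
  measurable_fun setT f -> measurable_fun setT g ->
  (forall x, 0 <= f x) -> (forall x, 0 <= g x) ->
  intRd (fun x => f x + g x) = intRd f + intRd g.
Proof.
elim: d f g => [|d IH] f g mf mg f0 g0 //=.
rewrite -ge0_integralD //.
- by apply: eq_integral => t _; rewrite IH //; exact: measurable_cons_slice1.
- by move=> t _; exact: intRd_ge0.
- exact: measurable_intRd_slice.
- by move=> t _; exact: intRd_ge0.
- exact: measurable_intRd_slice.
Qed.

Lemma finite_roots_null (p : {poly R}) (f : R -> \bar R) : p != 0%R ->
  measurable_fun setT f -> (forall s, 0 <= f s) -> (forall s, ~~ root p s -> f s = 0) ->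
  \int[mu]_s f s = 0.
Proof.
move=> p0 mf f0 fp.
pose N := [set` rootsR p].
have cN : countable N by exact/finite_set_countable/finite_seq.
have mN : measurable N by exact: countable_measurable.
rewrite (@ge0_negligible_integral _ _ _ mu setT N) //.
  rewrite integral0_eq // => s [_ /= sN]; apply: fp; apply/negP => ps; apply: sN.
  by have := roots_on_rootsR p0 s; rewrite in_itv /= ps => h; rewrite /N /= -h.
exact: countable_lebesgue_measure0.
Qed.

(** Translation invariance allows [Y] to be replaced by [Y + s], averaged over [s] with a weight of
    finite positive mass. For fixed [Y], [- s] must then be an eigenvalue of [Y], so only finitely
    many [s] contribute. *)
Lemma intM_singular n : intM (fun Y : 'M[R]_n => ((\det Y == 0)%R%:R : R)%:E) = 0.
Proof.
set N := intM _.
have N0 : 0 <= N by apply: intM_ge0 => Y; rewrite lee_fin.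
have G1 : (0 < Gamma 1 :> R)%R by exact: Gamma_gt0.
suff : (Gamma 1)%:E * N = 0.
  by move/eqP; rewrite mule_eq0 eqe gt_eqF //= => /eqP.
rewrite -integral_gamma_ker // -ge0_integralZr //; last 2 first.
- by apply: mfun_EFin; exact: measurable_gamma_ker.
- by move=> s _; rewrite lee_fin gamma_ker_ge0.
pose f (s : R) (Y : 'M[R]_n) : \bar R :=
  (gamma_ker 1 s * (\det (Y + s%:M) == 0)%R%:R)%R%:E.
have f0 s Y : 0 <= f s Y by rewrite lee_fin mulr_ge0 // gamma_ker_ge0.
have mf : measurable_fun setT (fun p : R * 'M[R]_n => f p.1 p.2).
  apply: mfun_EFin; apply: mfun_mul; last by mfun.
  by apply: (measurableT_comp (measurable_gamma_ker 1)); mfun.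
transitivity (\int[mu]_s intM (f s)).
  apply: eq_integral => s _; rewrite /f.
  under eq_intM do rewrite EFinM.
  rewrite (intMZl (k := (gamma_ker 1 s)%:E)); last 3 first.
  - by mfun.
  - by move=> Y; rewrite lee_fin.
  - by rewrite lee_fin gamma_ker_ge0.
  congr (_ * _); apply/esym.
  apply: (@intM_shift R n n s%:M (fun Y => ((\det Y == 0)%R%:R : R)%:E)); first by mfun.
  by move=> Y; rewrite lee_fin.
rewrite -(integral_intM mu (f := f)) // -[RHS](@intRd0 R (n * n)) /intM.
apply: eq_intRd => y; move: (vec_mx y) => {y}Y.
apply: (@finite_roots_null (char_poly (- Y)%R)).
- by apply: monic_neq0; exact: char_poly_monic.
- exact: (measurable_slice2 _ mf).
- by [].
move=> s; rewrite -eigenvalue_root_char => sY; rewrite /f.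
case: eqP => [/eqP/det0P[v v0 vY]|_]; last by rewrite mulr0.
case/eigenvalueP: sY; exists v => //.
by move/eqP: vY; rewrite mulmxDr mul_mx_scalar addr_eq0 mulmxN => /eqP ->; rewrite opprK.
Qed.

Lemma edge_col_mx d (r : 'rV[R]_d) (Y : 'M[R]_d) :
  (edge_mx (col_mx r Y : 'M[R]_(1 + d, d)) = Y + - (const_mx 1%R *m r))%R.
Proof.
apply/matrixP => i j; rewrite !mxE big_ord1 mxE mul1r.
case: splitP => k /=; first by case: k => -[].
move=> /eqP; rewrite /bump /= add1n eqSS => /eqP/val_inj <-.
by case: splitP => // k' _; rewrite ord1.
Qed.

Lemma intM_singular_edge d :
  intM (fun X : 'M[R]_(d.+1, d) => ((\det (edge_mx X) == 0)%R%:R : R)%:E) = 0.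
Proof.
rewrite intMS -[RHS](@intRd0 R d); apply: eq_intRd => r.
under eq_intM do rewrite edge_col_mx.
rewrite (@intM_shift R d d _ (fun Y : 'M[R]_d => ((\det Y == 0)%R%:R : R)%:E)).
- exact: intM_singular.
- by mfun.
- by move=> Y; rewrite lee_fin.
Qed.

Lemma intM_prod_rows m n (g : 'rV[R]_n -> \bar R) : measurable_fun setT g ->
  (forall r, 0 <= g r) -> intM (fun X : 'M[R]_(m, n) => \prod_i g (row i X)) = intRd g ^+ m.
Proof.
move=> mg g0; elim: m => [|m IH]; first by rewrite intM0 big_ord0.
rewrite intMS expeS.
transitivity (intRd (fun r => g r * intM (fun Y : 'M[R]_(m, n) => \prod_i g (row i Y)))).
  apply: eq_intRd => r; rewrite -intMZl //; last 2 first.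
  - by apply: mfun_bigprode => i; apply: (measurableT_comp mg); mfun.
  - by move=> Y; apply: prode_ge0.
  apply: eq_intM => Y; rewrite big_ord_recl; congr (_ * _).
    by congr g; apply/rowP => j; rewrite !mxE; case: splitP => // k _; rewrite ord1.
  apply: eq_bigr => i _; congr g; apply/rowP => j; rewrite !mxE.
  case: splitP => k /=; first by case: k => -[].
  by move=> /eqP; rewrite /bump /= add1n eqSS => /eqP/val_inj <-.
rewrite IH; under eq_intRd do rewrite muleC.
by rewrite intRdZl // 1?muleC // expe_ge0 // intRd_ge0.
Qed.

End singular_null.

(** * The case of the full cone *)

Section normalisation.
Variables (R : realType) (d : nat) (alpha : R).
Hypothesis alpha0 : 0 < alpha.
Local Notation mu := (@lebesgue_measure R).
Local Open Scope ereal_scope.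

Let b : R := ((alpha + d%:R) / 2)%R.
Let b0 : (0 < b)%R. Proof. by rewrite divr_gt0 // ltr_pwDl. Qed.
Let db : (d%:R / 2 < b)%R. Proof. by rewrite ltr_pM2r // ltrDr. Qed.

Lemma betap_density_ge0 (x : 'rV[R]_d) : (0 <= betap_density b x)%R.
Proof. by rewrite mulr_ge0 ?powR_ge0 // ltW // ctd_gt0. Qed.

Lemma betap_density_le (x : 'rV[R]_d) : (betap_density b x <= ctd d b)%R.
Proof.
rewrite /betap_density ler_piMr ?powR_ge0 //; first by rewrite ltW // ctd_gt0.
have e1 : (1 <= 1 + enorm x ^+ 2)%R by rewrite lerDl sqr_ge0.
by rewrite -[leRHS](powRr0 (1 + enorm x ^+ 2)%R) ler_powR // lerNl oppr0 ltW.
Qed.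

Lemma intRd_betap_density : intRd (fun x : 'rV[R]_d => (betap_density b x)%:E) = 1.
Proof.
rewrite /betap_density.
under eq_intRd do rewrite EFinM.
rewrite intRdZl.
- rewrite intRd_betap // -EFinM /ctd; congr EFin.
  have := Gamma_gt0 b0; have : (0 < Gamma (b - d%:R / 2))%R by rewrite Gamma_gt0 // subr_gt0.
  have : (0 < pi `^ (d%:R / 2) :> R)%R by rewrite powR_gt0 // pi_gt0.
  move: (pi `^ _)%R (Gamma (b - _)) (Gamma b) => x y z x0 y0 z0.
  by field; rewrite !gt_eqF.
- by mfun.
- by move=> x; rewrite lee_fin powR_ge0.
- by rewrite lee_fin ltW // ctd_gt0.
Qed.

Lemma face_cone_full (l : 'rV[R]_d) : face_cone d.+1 l.
Proof. by apply/face_coneP => i; rewrite ltnS leqNgt ltn_ord. Qed.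

(** For a nondegenerate simplex the Gaussian over the whole space has mass [pi^(d/2)], so the angle
    factor is 1 and the total mass of the product density is left. *)
Lemma EK_full : EK d alpha d.+1 = 1.
Proof.
pose p (X : 'M[R]_(d.+1, d)) : R := (\prod_i betap_density b (row i X))%R.
have p0 X : (0 <= p X)%R by apply: prodr_ge0 => i _; exact: betap_density_ge0.
have mp : measurable_fun setT p.
  by rewrite /p /betap_density; mfun.
have mdet : measurable_fun setT (fun X : 'M[R]_(d.+1, d) => (\det (edge_mx X) == 0)%R).
  by rewrite /edge_mx; mfun.
transitivity (intM (fun X => ((\det (edge_mx X) != 0)%R%:R * p X)%R%:E)).
  apply: eq_intM => X; rewrite [RHS]EFinM -/(p X); congr (_ * _).
  under eq_intRd do rewrite face_cone_full mul1r.
  have [->|D0] := eqVneq (\det (edge_mx X)) 0%R; first by rewrite normr0 mulr0 mul0e.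
  have uX : edge_mx X \in unitmx by rewrite unitmxE unitfE.
  rewrite EFinM -muleA (intRd_mulmx (f := fun x => (expR (- enorm x ^+ 2))%:E) uX).
  - have := @intRd_gauss R d 1%R ltr01; rewrite divr1.
    under eq_intRd do rewrite mul1r.
    move=> ->; rewrite -EFinM mulVf // gt_eqF // powR_gt0 // pi_gt0 //.
  - by mfun.
  - by move=> x; rewrite lee_fin expR_ge0.
(* The density is bounded, so the null set of singular edge matrices carries no mass. *)
have null : intM (fun X => ((\det (edge_mx X) == 0)%R%:R * p X)%R%:E) = 0.
  apply/eqP; rewrite eq_le; apply/andP; split; last first.
    by apply: intM_ge0 => X; rewrite lee_fin mulr_ge0.
  apply: (@le_trans _ _ (intM (fun X : 'M[R]_(d.+1, d) =>
      (ctd d b ^+ d.+1)%:E * ((\det (edge_mx X) == 0)%R%:R : R)%:E))).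
    apply: le_intM.
    - by mfun.
    - by mfun.
    - by move=> X; rewrite lee_fin mulr_ge0.
    - move=> X; rewrite -EFinM lee_fin mulrC ler_wpM2r //.
      rewrite /p -[X in (_ ^+ X)%R](card_ord d.+1) -prodr_const.
      by apply: ler_prod => i _; rewrite betap_density_ge0 betap_density_le.
  rewrite intMZl.
  - by rewrite intM_singular_edge mule0.
  - by mfun.
  - by move=> X; rewrite lee_fin.
  - by rewrite lee_fin exprn_ge0 // ltW // ctd_gt0.
have <- : intM (fun X => (p X)%:E) = 1.
  rewrite /p; under eq_intM do rewrite -prod_EFin.
  rewrite (@intM_prod_rows R d.+1 d (fun r => (betap_density b r)%:E)).
  - have e1 m : 1 ^+ m = 1 :> \bar R by elim: m => // m IH; rewrite expeS IH mule1.
    by rewrite intRd_betap_density e1.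
  - by rewrite /betap_density; mfun.
  - by move=> r; rewrite lee_fin betap_density_ge0.
rewrite -[LHS]adde0 -null /intM -intRdD.
- apply: eq_intRd => v; rewrite -EFinD -mulrDl; congr EFin.
  by case: (_ == _); rewrite /= ?addr0 ?add0r mul1r.
- by apply: (measurable_vec_mx (f := fun X => ((\det (edge_mx X) != 0)%R%:R * p X)%R%:E)); mfun.
- by apply: (measurable_vec_mx (f := fun X => ((\det (edge_mx X) == 0)%R%:R * p X)%R%:E)); mfun.
- by move=> v; rewrite lee_fin mulr_ge0.
- by move=> v; rewrite lee_fin mulr_ge0.
Qed.

End normalisation.

Ltac nneg := by move=> *; rewrite ?lee_fin ?mulr_ge0 ?invr_ge0 ?(ltW (Gamma_gt0 _))
  ?sqrtr_ge0 ?powR_ge0 ?expR_ge0 ?gamma_ker_ge0.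
Ltac side := first [exact: measurableT | by mfun | nneg].

(** * Removing the factors that do not split, by homogeneity *)

Section homogeneity.
Variables (R : realType) (d : nat) (alpha : R).
Local Notation mu := (@lebesgue_measure R).
Local Open Scope ereal_scope.
Implicit Types (t : 'rV[R]_d.+1) (l : 'rV[R]_d).

Let s0 : R := ((alpha - 1) / 2)%R.

Lemma qformZ (a : R) t l : (0 < a)%R -> qform (a *: t)%R l = qform t ((Num.sqrt a)^-1 *: l)%R.
Proof.
move=> a0; apply: eq_bigr => i _; rewrite [(a *: t)%R ord0 i]mxE.
have -> : (hat ((Num.sqrt a)^-1 *: l) ord0 i = (Num.sqrt a)^-1 * hat l ord0 i)%R.
  case: (unliftP ord0 i) => [j|] ->; first by rewrite !hatS mxE.
  by rewrite !hat0 mulrN mulr_sumr; congr (- _)%R; apply: eq_bigr => j _; rewrite mxE.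
by rewrite exprMn exprVn sqr_sqrtr ?(ltW a0) // invfM mulrCA mulrA.
Qed.

Lemma qform_scale (a : R) t l : qform (a *: t)%R l = (a^-1 * qform t l)%R.
Proof.
by rewrite /qform mulr_sumr; apply: eq_bigr => i _; rewrite [(a *: t)%R ord0 i]mxE invfM mulrCA.
Qed.

Definition cone_gauss_int k t : \bar R :=
  intRd (fun l => ((face_cone k l)%:R * expR (- qform t l))%R%:E).

Lemma measurable_cone_qform (e : measure_display) (T : measurableType e) k
    (t : T -> 'rV[R]_d.+1) (l : T -> 'rV[R]_d) :
  measurable_fun setT t -> measurable_fun setT l ->
  measurable_fun setT (fun p => ((face_cone k (l p))%:R * expR (- qform (t p) (l p)))%R%:E).
Proof.
move=> mt ml; apply: mfun_EFin; apply: mfun_mul.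
  by apply: mfun_natbool; exact: (measurableT_comp (measurable_face_cone k)).
by apply: mfun_expR; apply: mfun_opp; exact: mfun_qform.
Qed.

Lemma cone_gauss_int_ge0 k t : 0 <= cone_gauss_int k t.
Proof. by apply: intRd_ge0 => l; rewrite lee_fin mulr_ge0 ?expR_ge0. Qed.

Lemma measurable_cone_gauss_int k : measurable_fun setT (cone_gauss_int k).
Proof.
apply: (@measurable_intRd R d _ 'rV[R]_d.+1
  (fun t l => ((face_cone k l)%:R * expR (- qform t l))%R%:E)).
- by apply: measurable_cone_qform; mfun.
- by move=> t l; rewrite lee_fin mulr_ge0 ?expR_ge0.
Qed.

Lemma cone_gauss_intZ k (a : R) t : (0 < a)%R ->
  cone_gauss_int k (a *: t)%R = (a `^ (d%:R / 2))%:E * cone_gauss_int k t.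
Proof.
move=> a0; pose c := (Num.sqrt a)^-1%R.
have c0 : (0 < c)%R by rewrite invr_gt0 sqrtr_gt0.
have cn : (c != 0)%R by rewrite gt_eqF.
rewrite /cone_gauss_int.
rewrite -[intRd (fun l => ((face_cone k l)%:R * expR (- qform t l))%R%:E)](intRd_scale cn).
- rewrite muleA -EFinM gtr0_norm //.
  have -> : (a `^ (d%:R / 2) * c ^+ d = 1)%R.
    rewrite /c -powR12_sqrt ?(ltW a0) // -powRN -powR_mulrn ?powR_ge0 // -powRrM.
    rewrite -powRD; last by rewrite (gt_eqF a0) implybT.
    by rewrite (_ : _ + _ = 0)%R ?powRr0 //; field.
  rewrite mul1e; apply: eq_intRd => l.
  by rewrite face_coneZ // qformZ.
- by apply: measurable_cone_qform; mfun.
- by move=> l; rewrite lee_fin mulr_ge0 ?expR_ge0.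
Qed.

(** A Gamma mixture in [s] turns the power into [exp (- s * qform t l)], and [s] is absorbed by the
    dilation [t |-> s^-1 *: t], at the cost of [s^(- d / 2)]. The shape left over is
    [(d + 1) / 2 - d / 2], hence [Gamma 2^-1]. *)
Lemma cone_cauchy_int k t : (forall i, 0 < t ord0 i)%R ->
  intRd (fun l => ((face_cone k l)%:R * (1 + qform t l) `^ (- (d.+1%:R / 2)))%R%:E) =
  (Gamma 2^-1 / Gamma (d.+1%:R / 2))%R%:E * cone_gauss_int k t.
Proof.
move=> t0; pose n2 : R := (d.+1%:R / 2)%R.
have n20 : (0 < n2)%R by rewrite divr_gt0.
have q1 l : (0 < 1 + qform t l)%R.
  by rewrite ltr_pwDl // sumr_ge0 // => i _; rewrite divr_ge0 ?sqr_ge0 // ltW.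
pose f (s : R) l : R := ((face_cone k l)%:R *
  ((0 < s)%R%:R * (s `^ (n2 - 1) * expR (- ((1 + qform t l) * s)))))%R.
have f0 s l : 0 <= (f s l)%:E by rewrite lee_fin !mulr_ge0 ?powR_ge0 ?expR_ge0.
have mf : measurable_fun setT (fun p : R * 'rV[R]_d => (f p.1 p.2)%:E).
  rewrite /f; apply: mfun_EFin; apply: mfun_mul.
    by apply: mfun_natbool; apply: (measurableT_comp (measurable_face_cone k)); mfun.
  apply: mfun_mul; first by mfun.
  apply: mfun_mul; first by mfun.
  apply: mfun_expR; apply: mfun_opp; apply: mfun_mul; last by mfun.
  by apply: mfun_add; [exact: measurable_cst|apply: mfun_qform; mfun].
have mf2 : measurable_fun setT (fun l => \int[mu]_s (f s l)%:E).
  exact: (measurable_fun_fubini_tonelli_G (m1 := mu) (fun p : R * 'rV[R]_d => (f p.1 p.2)%:E)).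
transitivity (((Gamma n2)^-1)%:E * intRd (fun l => \int[mu]_s (f s l)%:E)).
  rewrite -intRdZl //.
  - apply: eq_intRd => l; rewrite EFinM -/n2 powR_gamma_mix // muleCA; congr (_ * _).
    rewrite -ge0_integralZl //.
    + by mfun.
    + by move=> s _; rewrite lee_fin !mulr_ge0 ?powR_ge0 ?expR_ge0.
  - by move=> l; apply: integral_ge0.
  - by rewrite lee_fin invr_ge0 ltW // Gamma_gt0.
rewrite mulrC EFinM -muleA; congr (_ * _).
rewrite (integral_intRd mu (f := fun s l => (f s l)%:E)) //.
rewrite -integral_gamma_ker // -ge0_integralZr //; last 3 first.
- by apply: mfun_EFin; exact: measurable_gamma_ker.
- by move=> s _; rewrite lee_fin gamma_ker_ge0.
- exact: cone_gauss_int_ge0.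
apply: eq_integral => s _; rewrite /f /gamma_ker.
case: ltP => sp; last first.
  rewrite mul0r mul0e -[RHS](@intRd0 R d); apply: eq_intRd => l.
  by rewrite mul0r mulr0.
transitivity ((s `^ (n2 - 1) * expR (- s))%R%:E * cone_gauss_int k (s^-1 *: t)%R).
  rewrite /cone_gauss_int -intRdZl.
  - apply: eq_intRd => l; rewrite -EFinM; congr EFin.
    by rewrite qform_scale invrK mulrDl !mul1r opprD expRD [(s * _)%R]mulrC; ring.
  - by apply: measurable_cone_qform; mfun.
  - by move=> l; rewrite lee_fin mulr_ge0 ?expR_ge0.
  - by rewrite lee_fin mulr_ge0 ?powR_ge0 ?expR_ge0.
rewrite cone_gauss_intZ ?invr_gt0 // muleA -EFinM; congr (_%:E * _).
rewrite mul1r mulrAC; congr (_ * _)%R.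
rewrite -[(s^-1)%R](powR_inv1 (ltW sp)) -powRrM -powRD; last by rewrite (gt_eqF sp) implybT.
by congr powR; rewrite /n2 -natr1; field.
Qed.

Let gprod t : R := (\prod_i gamma_ker s0 (t ord0 i))%R.

Let gprod_ge0 t : (0 <= gprod t)%R.
Proof. by apply: prodr_ge0 => i _; exact: gamma_ker_ge0. Qed.

Let mgprod (e : measure_display) (T : measurableType e) (t : T -> 'rV[R]_d.+1) :
  measurable_fun setT t -> measurable_fun setT (fun p => gprod (t p)).
Proof.
move=> mt; apply: (@mfun_bigprod _ _ _ _ _ _ (fun i p => gamma_ker s0 (t p ord0 i))) => i.
by apply: (measurableT_comp (measurable_gamma_ker s0)); mfun.
Qed.

Let gprod_eq0 t : ~~ [forall i, (0 < t ord0 i)%R] -> gprod t = 0%R.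
Proof.
rewrite negb_forall => /existsP[i ti].
by rewrite /gprod (bigD1 i) //= /gamma_ker (negbTE ti) !mul0r.
Qed.

(** Here the integrand is a product over the vertices: vertex [i] contributes
    [gamma_ker s0 (t_i) * exp (- h_i^2 / t_i)] and possibly a sign condition. *)
Definition LK k : \bar R := intRd (fun t =>
  (\prod_i gamma_ker s0 (t ord0 i))%R%:E * cone_gauss_int k t).

Let JK' k : \bar R := intRd (fun t =>
  (gprod t * Num.sqrt (\sum_i t ord0 i))%R%:E * cone_gauss_int k t).

Let JK'_ge0 k t : 0 <= (gprod t * Num.sqrt (\sum_i t ord0 i))%R%:E * cone_gauss_int k t.
Proof. by rewrite mule_ge0 ?cone_gauss_int_ge0 // lee_fin mulr_ge0 ?sqrtr_ge0. Qed.

Let mJK' k : measurable_fun setT (fun t =>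
  (gprod t * Num.sqrt (\sum_i t ord0 i))%R%:E * cone_gauss_int k t).
Proof.
apply: mfun_mule; last exact: measurable_cone_gauss_int.
by apply: mfun_EFin; apply: mfun_mul; [apply: mgprod|]; mfun.
Qed.

Let JK_JK' k : JK d alpha k = (Gamma 2^-1 / Gamma (d.+1%:R / 2))%R%:E * JK' k.
Proof.
have G0 : (0 <= Gamma 2^-1 / Gamma (d.+1%:R / 2) :> R)%R.
  by rewrite divr_ge0 // ltW // Gamma_gt0 // divr_gt0.
rewrite /JK.
have F0 l t : (0 <= (face_cone k l)%:R * (gprod t * (Num.sqrt (\sum_i t ord0 i) *
    (1 + qform t l) `^ (- (d.+1%:R / 2)))))%R.
  by rewrite !mulr_ge0 ?sqrtr_ge0 ?powR_ge0.
rewrite (intRd_swap (f := fun l t => ((face_cone k l)%:R * (gprod t *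
  (Num.sqrt (\sum_i t ord0 i) * (1 + qform t l) `^ (- (d.+1%:R / 2)))))%R%:E)); last 2 first.
- apply: mfun_EFin; apply: mfun_mul.
    by apply: mfun_natbool; apply: (measurableT_comp (measurable_face_cone k)); mfun.
  apply: mfun_mul; first by apply: mgprod; mfun.
  apply: mfun_mul; first by mfun.
  apply: mfun_powR; apply: mfun_add; first exact: measurable_cst.
  by apply: mfun_qform; mfun.
- by move=> l t; rewrite lee_fin.
rewrite /JK' -intRdZl //.
apply: eq_intRd => t.
have [/forallP t0|/gprod_eq0 z] := boolP [forall i, (0 < t ord0 i)%R]; last first.
  rewrite z mul0r mul0e mule0 -[RHS](@intRd0 R d); apply: eq_intRd => l.
  by rewrite mul0r mulr0.
rewrite muleCA -cone_cauchy_int // -intRdZl.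
- by apply: eq_intRd => l; rewrite -EFinM; congr EFin; ring.
- apply: mfun_EFin; apply: mfun_mul.
    by apply: mfun_natbool; exact: measurable_face_cone.
  apply: mfun_powR; apply: mfun_add; first exact: measurable_cst.
  by apply: mfun_qform; mfun.
- by move=> l; rewrite lee_fin mulr_ge0 ?powR_ge0.
- by rewrite lee_fin mulr_ge0 ?sqrtr_ge0.
Qed.

(** The inverted powers of [1 + u] are, in order, the costs of dilating [t] in the cone integral, in
    the Gamma kernels, in the square root and in Lebesgue measure. Together they make
    [(1 + u)^(- alpha (d + 1) / 2)], so the integral in [u] is finite exactly when
    [alpha (d + 1) > 1]. *)
Let ratio (u : R) : R := ((Gamma 2^-1)^-1 * ((0 < u)%R%:R * (u `^ (2^-1 - 1) *
  ((1 + u) `^ (d%:R / 2) * (((1 + u) `^ (s0 - 1)) ^+ d.+1 *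
   (Num.sqrt (1 + u) * (1 + u) ^+ d.+1)))^-1)))%R.

Let ratio_ge0 u : (0 <= ratio u)%R.
Proof.
rewrite mulr_ge0 ?invr_ge0 ?(ltW (Gamma_gt0 _)) //.
case: ltP => u0; last by rewrite mul0r.
by rewrite !mulr_ge0 ?powR_ge0 // invr_ge0 !mulr_ge0 ?powR_ge0 ?exprn_ge0 ?powR_ge0 ?sqrtr_ge0 ?addr_ge0 ?ltW.
Qed.

(** With [S = sum_i t_i], insert [1 = sqrt S / Gamma (1/2) * int u^(-1/2) exp (- S u) du]. The new
    exponential joins the [exp (- t_i)] of the Gamma kernels to give [exp (- (1 + u) S)], which the
    dilation of [t] by [1 + u] brings back to the kernel of [JK']. *)
Let LK_JK' k : LK k = (\int[mu]_u (ratio u)%:E) * JK' k.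
Proof.
have JK'0 : 0 <= JK' k by exact: intRd_ge0.
rewrite -ge0_integralZr //; last 2 first.
- by rewrite /ratio; mfun.
- by move=> u _; rewrite lee_fin.
pose f (u : R) t : \bar R := ((Gamma 2^-1)^-1 * (gprod t * (Num.sqrt (\sum_i t ord0 i) *
   ((0 < u)%R%:R * (u `^ (2^-1 - 1) * expR (- ((\sum_i t ord0 i) * u)))))))%R%:E *
   cone_gauss_int k t.
have f0 u t : 0 <= f u t.
  rewrite mule_ge0 ?cone_gauss_int_ge0 // lee_fin.
  by rewrite !mulr_ge0 ?invr_ge0 ?(ltW (Gamma_gt0 _)) ?sqrtr_ge0 ?powR_ge0 ?expR_ge0.
have mf : measurable_fun setT (fun p : R * 'rV[R]_d.+1 => f p.1 p.2).
  apply: mfun_mule; last by apply: (measurableT_comp (measurable_cone_gauss_int k)); mfun.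
  apply: mfun_EFin; apply: mfun_mul; first exact: measurable_cst.
  by apply: mfun_mul; [apply: mgprod|]; mfun.
transitivity (intRd (fun t => \int[mu]_u f u t)).
  apply: eq_intRd => t; rewrite /f -/(gprod t).
  have [/forallP t0|/gprod_eq0 z] := boolP [forall i, (0 < t ord0 i)%R]; last first.
    rewrite z mul0e integral0_eq // => u _; rewrite mul0r mulr0 mul0e //.
  have S0 : (0 < \sum_i t ord0 i)%R.
    by rewrite big_ord_recl ltr_pwDl // sumr_ge0 // => i _; exact: ltW.
  rewrite ge0_integralZr; [|side|side|side|exact: cone_gauss_int_ge0].
  congr (_ * _).
  under eq_integral do rewrite mulrCA EFinM.
  rewrite ge0_integralZl; [|side|side|side|exact: gprod_ge0].
  rewrite -[LHS]mule1; congr (_ * _).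
  under eq_integral do rewrite mulrCA EFinM.
  rewrite ge0_integralZl; [|side|side|side|side].
  under eq_integral do rewrite EFinM.
  rewrite ge0_integralZl; [|side|side|side|side].
  rewrite -powR_gamma_mix // -EFinM -powR12_sqrt ?(ltW S0) // -powRD; last first.
    by rewrite (gt_eqF S0) implybT.
  by rewrite subrr powRr0.
rewrite (integral_intRd mu (f := f)) //.
apply: eq_integral => u _.
case: (ltP 0%R u) => u0; last first.
  rewrite /ratio (le_gtF u0) mul0r mulr0 mul0e -[RHS](@intRd0 R d.+1); apply: eq_intRd => t.
  by rewrite /f (le_gtF u0) !(mul0r, mulr0) mul0e.
pose a : R := (1 + u)%R.
have a0 : (0 < a)%R by rewrite ltr_pwDl // ltW.
have E := intRd_scale (lt0r_neq0 a0) (mJK' k) (JK'_ge0 k).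
rewrite gtr0_norm // in E.
rewrite /JK' -E {E}.
rewrite muleA -EFinM -intRdZl; last 3 first.
- by apply: (measurableT_comp (mJK' k)); mfun.
- by move=> t; exact: JK'_ge0.
- by rewrite lee_fin; apply: mulr_ge0; [exact: ratio_ge0|exact/exprn_ge0/ltW].
apply: eq_intRd => t; rewrite /f cone_gauss_intZ // !muleA -!EFinM; congr (_%:E * _).
have -> : gprod (a *: t)%R = ((a `^ (s0 - 1)) ^+ d.+1 * (gprod t * expR (- ((\sum_i t ord0 i) * u))))%R.
  rewrite mulrA mulrAC mulr_suml -sumrN expR_sum /gprod -[X in (_ ^+ X)%R](card_ord d.+1).
  rewrite -prodr_const -!big_split /=; apply: eq_bigr => i _; rewrite mxE /gamma_ker.
  rewrite pmulr_rgt0 //; case: ltP => ti; last by rewrite !(mul0r, mulr0).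
  rewrite !mul1r powRM ?(ltW a0) ?(ltW ti) // /a mulrDl mul1r opprD expRD [(u * _)%R]mulrC.
  by ring.
have -> : (\sum_i (a *: t)%R ord0 i = a * \sum_i t ord0 i)%R.
  by rewrite mulr_sumr; apply: eq_bigr => i _; rewrite mxE.
rewrite sqrtrM ?(ltW a0) // /ratio u0 -/a !mul1r.
have : (0 < a ^+ d.+1)%R by rewrite exprn_gt0.
have : (0 < a `^ (d%:R / 2))%R by rewrite powR_gt0.
have : (0 < (a `^ (s0 - 1)) ^+ d.+1)%R by rewrite exprn_gt0 // powR_gt0.
have : (0 < Num.sqrt a)%R by rewrite sqrtr_gt0.
have : (0 < Gamma 2^-1 :> R)%R by exact: Gamma_gt0.
move: (a ^+ d.+1)%R (a `^ (d%:R / 2))%R ((a `^ (s0 - 1)) ^+ d.+1)%R (Num.sqrt a)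
  (Gamma 2^-1) (Num.sqrt (\sum_i t ord0 i)) (expR _) (gprod t) (u `^ _)%R.
by move=> x1 x2 x3 x4 x5 x6 x7 x8 x9 p1 p2 p3 p4 p5; field; rewrite !gt_eqF.
Qed.

Lemma LK_JK : exists2 c : \bar R, 0 <= c & forall k, LK k = c * JK d alpha k.
Proof.
have G0 : (0 < Gamma 2^-1 / Gamma (d.+1%:R / 2) :> R)%R.
  by rewrite divr_gt0 // Gamma_gt0 // divr_gt0.
pose c : R := (Gamma 2^-1 / Gamma (d.+1%:R / 2))%R.
exists ((\int[mu]_u (ratio u)%:E) * (c^-1)%:E).
  by rewrite mule_ge0 // ?lee_fin ?invr_ge0 ?(ltW G0) //; apply: integral_ge0 => u _; rewrite lee_fin.
move=> k; rewrite JK_JK' LK_JK' -!muleA; congr (_ * _).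
by rewrite muleA -EFinM mulVf ?mul1e // gt_eqF.
Qed.

End homogeneity.

(** * Comparison with the full cone *)

Section expectation_ratio.
Variables (R : realType) (d : nat) (alpha : R).
Hypothesis alpha0 : 0 < alpha.
Local Open Scope ereal_scope.

(** Stated as a product, since the factors [a] and [c] are only extended reals: [EK_full] reads
    [a * JK d alpha d.+1 = 1], which eliminates them without a division. *)
Lemma expected_angle_LK k : (0 < k <= d)%N ->
  expected_angle d.+1 k ((alpha + d%:R) / 2)%R * LK d alpha d.+1 = LK d alpha k.
Proof.
move=> kd; rewrite expected_angle_EK //.
have [a _ aE] := EK_JK d alpha0; have [c _ cE] := LK_JK d alpha.
have a1 : a * JK d alpha d.+1 = 1 by rewrite -aE EK_full.
by rewrite aE !cE [c * JK d alpha d.+1]muleC muleACA a1 mul1e muleC.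
Qed.

End expectation_ratio.

(** * Half-line cosine and sine integrals of a Gaussian *)

Section gaussian_trig.
Variable R : realType.
Local Notation mu := (@lebesgue_measure R).
Local Notation D0 := (`[0, +oo[%classic : set R).

(** The fundamental theorem on [[0, n]], followed by dominated convergence of the truncations of
    [f]. *)
Lemma integral_derive_itvy (F f : R -> R) : (forall y : R, is_derive y (1 : R) F (f y)) ->
  continuous f -> mu.-integrable D0 (EFin \o f) -> F n%:R @[n --> \oo] --> 0 ->
  (\int[mu]_(y in D0) (f y)%:E = (- F 0)%:E)%E.
Proof.
move=> dF cf intf F0.
have mf : measurable_fun setT f by exact: continuous_measurable_fun.
pose f_ (n : nat) (y : R) : \bar R := ((y <= n%:R)%R%:R * f y)%:E.
have h1 : (\int[mu]_(y in D0) f_ n y @[n --> \oo] --> \int[mu]_(y in D0) (f y)%:E)%E.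
  apply: (@dominated_cvg _ _ _ mu D0 _ f_ (EFin \o f) (abse \o (EFin \o f))).
  - exact: measurable_itv.
  - by move=> n; apply: measurable_funTS; rewrite /f_; mfun.
  - move=> y _; apply: cvg_near_cst.
    exists (Num.trunc y).+1 => // n /= yn; rewrite /f_.
    by rewrite (le_trans (ltW (truncnS_gt y))) ?mul1r // ler_nat.
  - by [].
  - exact: (integrable_abse intf).
  - move=> n y _; rewrite /f_ /= lee_fin normrM.
    by case: (y <= n%:R)%R; rewrite ?normr1 ?mul1r // normr0 mul0r.
have h2 : (\int[mu]_(y in D0) f_ n y @[n --> \oo] --> (- F 0)%:E)%E.
  have E n : (\int[mu]_(y in D0) f_ n y)%E = (F n%:R - F 0)%:E.
    transitivity (\int[mu]_(y in `[0%R, n%:R]) (f y)%:E)%E; last first.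
      by apply: integral_is_derive => // x _; exact: cf.
    rewrite !integral_itv_natbool; apply: eq_integral => y _; rewrite !in_itv /= andbT.
    by case: (0 <= y)%R; rewrite ?mul0r ?mul1r.
  under eq_fun do rewrite E.
  apply: cvg_EFin; first exact: nearW.
  by rewrite -[X in _ --> X]add0r; apply: cvgB => //; exact: cvg_cst.
exact: (cvg_unique _ h1 h2).
Qed.

Lemma integrable_gauss_bounded (g : R -> R) (C : R) : measurable_fun setT g ->
  (forall y, 0 <= y -> `|g y| <= C * expR (- (2^-1 * y ^+ 2))) ->
  mu.-integrable D0 (EFin \o g).
Proof.
move=> mg gC.
have ig : mu.-integrable D0 (fun y => (C * expR (- (2^-1 * y ^+ 2)))%:E).
  apply: (@integrableS _ _ _ mu setT) => //.
  apply/integrableP; split; first by mfun.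
  under eq_integral do rewrite abse_EFin normrM (ger0_norm (expR_ge0 _)) EFinM.
  rewrite ge0_integralZl; [|exact: measurableT|by mfun|by move=> y _; rewrite lee_fin|by []].
  by rewrite integral_gauss_scale // -EFinM ltry.
apply: (le_integrable _ _ _ ig) => //.
- by apply: measurable_funTS; exact: mfun_EFin.
- move=> y; rewrite /= in_itv /= andbT => y0.
  by rewrite lee_fin (le_trans (gC y y0)) // ler_norm.
Qed.

Let gle1 (y : R) : expR (- y ^+ 2) <= 1 * expR (- (2^-1 * y ^+ 2)).
Proof. by rewrite mul1r ler_expR lerN2 ler_piMl ?sqr_ge0 // invf_le1 ?ler1n. Qed.

Let yle1 (y : R) : 0 <= y -> y * expR (- y ^+ 2) <= 1 * expR (- (2^-1 * y ^+ 2)).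
Proof.
move=> y0; rewrite mul1r.
have -> : - y ^+ 2 = - (2^-1 * y ^+ 2) - 2^-1 * y ^+ 2 by field.
rewrite expRD mulrCA ler_piMr ?expR_ge0 // expRN ler_pdivrMr ?expR_gt0 // mul1r.
apply: le_trans (expR_ge1Dx _); rewrite -subr_ge0.
have -> : 1 + 2^-1 * y ^+ 2 - y = 2^-1 * (1 + (y - 1) ^+ 2) by field.
by rewrite mulr_ge0 // addr_ge0 // sqr_ge0.
Qed.

Definition gcos (a : R) : R := \int[mu]_(y in D0) (expR (- y ^+ 2) * cos (a * y)).
Definition gsin (a : R) : R := \int[mu]_(y in D0) (expR (- y ^+ 2) * sin (a * y)).
Let ycos (a : R) : R := \int[mu]_(y in D0) (y * expR (- y ^+ 2) * cos (a * y)).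
Let ysin (a : R) : R := \int[mu]_(y in D0) (y * expR (- y ^+ 2) * sin (a * y)).

Lemma norm_cos_le1 (x : R) : `|cos x| <= 1.
Proof. by rewrite ler_norml cos_geN1 cos_le1. Qed.

Lemma norm_sin_le1 (x : R) : `|sin x| <= 1.
Proof. by rewrite ler_norml sin_geN1 sin_le1. Qed.

Lemma integrable_gcos a : mu.-integrable D0 (EFin \o (fun y => expR (- y ^+ 2) * cos (a * y))).
Proof.
apply: (@integrable_gauss_bounded _ 1); first by mfun.
move=> y y0; rewrite normrM ger0_norm ?expR_ge0 //.
by apply: le_trans (gle1 y); rewrite ler_piMr ?expR_ge0 ?norm_cos_le1.
Qed.

Lemma integrable_gsin a : mu.-integrable D0 (EFin \o (fun y => expR (- y ^+ 2) * sin (a * y))).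
Proof.
apply: (@integrable_gauss_bounded _ 1); first by mfun.
move=> y y0; rewrite normrM ger0_norm ?expR_ge0 //.
by apply: le_trans (gle1 y); rewrite ler_piMr ?expR_ge0 ?norm_sin_le1.
Qed.

Let int_ycos a : mu.-integrable D0 (EFin \o (fun y => y * expR (- y ^+ 2) * cos (a * y))).
Proof.
apply: (@integrable_gauss_bounded _ 1); first by mfun.
move=> y y0; have ye : 0 <= y * expR (- y ^+ 2) by rewrite mulr_ge0 ?expR_ge0.
rewrite normrM ger0_norm //; apply: le_trans (yle1 y0).
by rewrite ler_piMr ?norm_cos_le1.
Qed.

Let int_ysin a : mu.-integrable D0 (EFin \o (fun y => y * expR (- y ^+ 2) * sin (a * y))).
Proof.
apply: (@integrable_gauss_bounded _ 1); first by mfun.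
move=> y y0; have ye : 0 <= y * expR (- y ^+ 2) by rewrite mulr_ge0 ?expR_ge0.
rewrite normrM ger0_norm //; apply: le_trans (yle1 y0).
by rewrite ler_piMr ?norm_sin_le1.
Qed.

Let is_derive_exp2 (y : R) : is_derive y 1 (fun y => expR (- y ^+ 2)) (- (2 * y * expR (- y ^+ 2))).
Proof.
have h1 : is_derive y 1 (fun y : R => - y ^+ 2) (- (2 * y)).
  apply: is_derive_eq.
  by rewrite /GRing.scale /= mulr1; ring.
apply: is_derive_eq (is_derive1_comp (f := expR) _ h1) _.
by rewrite mulrC mulNr.
Qed.

Let is_derive_cosl (a y : R) : is_derive y 1 (fun y => cos (a * y)) (- (a * sin (a * y))).
Proof.
have h : is_derive y 1 (fun y : R => a * y) a.
  by apply: (is_derive_eq (is_deriveZ a (is_derive_id y (1 : R)))); rewrite /GRing.scale /= mulr1.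
by apply: (is_derive_eq (is_derive1_comp (is_derive_cos (a * y)) h)); ring.
Qed.

Let is_derive_sinl (a y : R) : is_derive y 1 (fun y => sin (a * y)) (a * cos (a * y)).
Proof.
have h : is_derive y 1 (fun y : R => a * y) a.
  by apply: (is_derive_eq (is_deriveZ a (is_derive_id y (1 : R)))); rewrite /GRing.scale /= mulr1.
by apply: (is_derive_eq (is_derive1_comp (is_derive_sin (a * y)) h)); ring.
Qed.

Let cvg_gauss_nat : expR (- (n%:R : R) ^+ 2) @[n --> \oo] --> (0 : R).
Proof. exact: (cvg_comp _ _ (@cvgr_idn R) (@cvg_gauss_fun R)). Qed.

Let cvg_gauss_bounded (h : R -> R) : (forall y, `|h y| <= 1) ->
  expR (- (n%:R : R) ^+ 2) * h n%:R @[n --> \oo] --> (0 : R).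
Proof.
move=> h1; have g0 := cvg_gauss_nat.
have gN : - expR (- (n%:R : R) ^+ 2) @[n --> \oo] --> (0 : R).
  by rewrite -[X in _ --> X]oppr0; exact: cvgN.
apply: (squeeze_cvgr _ gN g0); apply: nearW => n /=.
by rewrite -ler_norml normrM ger0_norm ?expR_ge0 // ler_piMr ?expR_ge0.
Qed.

Let continuous_of_derive (f f' : R -> R) : (forall y : R, is_derive y (1 : R) f (f' y)) -> continuous f.
Proof. by move=> h y; apply/differentiable_continuous/derivable1_diffP; exact: ex_derive. Qed.

Lemma integrableZlE (k : R) (f : R -> R) : mu.-integrable D0 (EFin \o f) ->
  mu.-integrable D0 (EFin \o (fun y => k * f y)).
Proof. by move=> h; exact: (integrableZl _ k h). Qed.

(** Integration by parts: the derivative of [exp (- y^2) * cos (a y)] integrates to its boundary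
    value at 0. That value makes the equation for [gsin] inhomogeneous, whereas the one for [gcos]
    is homogeneous. *)
Let ycosE a : 2 * ycos a = 1 - a * gsin a.
Proof.
pose f y := (-2) * (y * expR (- y ^+ 2) * cos (a * y)) - a * (expR (- y ^+ 2) * sin (a * y)).
have i1 := integrableZlE (-2) (int_ycos a); have i2 := integrableZlE a (integrable_gsin a).
have dF (y : R) : is_derive y (1 : R) (fun y => expR (- y ^+ 2) * cos (a * y)) (f y).
  apply: (is_derive_eq (is_deriveM (is_derive_exp2 y) (is_derive_cosl a y))).
  by rewrite /GRing.scale /= /f; ring.
have cf : continuous f.
  move=> y; apply: cvgB.
  - apply: cvgM; first exact: cvg_cst.
    apply: cvgM; last exact: (continuous_of_derive (is_derive_cosl a)).
    by apply: cvgM; [exact: cvg_id|exact: (continuous_of_derive is_derive_exp2)].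
  - apply: cvgM; first exact: cvg_cst.
    by apply: cvgM; [exact: (continuous_of_derive is_derive_exp2)|
      exact: (continuous_of_derive (is_derive_sinl a))].
have intf : mu.-integrable D0 (EFin \o f) by exact: (integrableB _ i1 i2).
have := integral_derive_itvy dF cf intf (cvg_gauss_bounded (fun y => norm_cos_le1 (a * y))).
move=> /(congr1 fine) /=; rewrite mulr0 cos0 expr0n /= oppr0 expR0 mul1r.
rewrite -/(Rintegral mu D0 f) RintegralB // RintegralZl // ?RintegralZl //.
- rewrite -/(ycos a) -/(gsin a) => E; lra.
- exact: integrable_gsin.
Qed.

Let ysinE a : 2 * ysin a = a * gcos a.
Proof.
pose f y := (-2) * (y * expR (- y ^+ 2) * sin (a * y)) + a * (expR (- y ^+ 2) * cos (a * y)).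
have i1 := integrableZlE (-2) (int_ysin a); have i2 := integrableZlE a (integrable_gcos a).
have dF (y : R) : is_derive y (1 : R) (fun y => expR (- y ^+ 2) * sin (a * y)) (f y).
  apply: (is_derive_eq (is_deriveM (is_derive_exp2 y) (is_derive_sinl a y))).
  by rewrite /GRing.scale /= /f; ring.
have cf : continuous f.
  move=> y; apply: cvgD.
  - apply: cvgM; first exact: cvg_cst.
    apply: cvgM; last exact: (continuous_of_derive (is_derive_sinl a)).
    by apply: cvgM; [exact: cvg_id|exact: (continuous_of_derive is_derive_exp2)].
  - apply: cvgM; first exact: cvg_cst.
    by apply: cvgM; [exact: (continuous_of_derive is_derive_exp2)|
      exact: (continuous_of_derive (is_derive_cosl a))].
have intf : mu.-integrable D0 (EFin \o f) by exact: (integrableD _ i1 i2).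
have := integral_derive_itvy dF cf intf (cvg_gauss_bounded (fun y => norm_sin_le1 (a * y))).
move=> /(congr1 fine) /=; rewrite mulr0 sin0 mulr0 oppr0.
rewrite -/(Rintegral mu D0 f) RintegralD // RintegralZl // ?RintegralZl //.
- rewrite -/(ysin a) -/(gcos a) => E; lra.
- exact: integrable_gcos.
Qed.

Let int_G : mu.-integrable D0 (EFin \o (fun y : R => `|y| * expR (- y ^+ 2))).
Proof.
apply: (@integrable_gauss_bounded _ 1); first by mfun.
move=> y y0; rewrite normrM normr_id ger0_norm // ger0_norm ?expR_ge0 //.
exact: yle1.
Qed.

Let is_derive_gsin a : is_derive a (1 : R) gsin (ycos a).
Proof.
pose f (x y : R) : R := expR (- y ^+ 2) * sin (x * y).
have df (x y : R) : is_derive x (1 : R) (f^~ y) (y * expR (- y ^+ 2) * cos (x * y)).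
  have h : is_derive x (1 : R) (fun x => sin (x * y)) (y * cos (y * x)).
    have := is_derive_sinl y x; congr (is_derive _ _ _ _).
    by apply/funext => z; rewrite mulrC.
  apply: (is_derive_eq (is_deriveZ (expR (- y ^+ 2)) h)).
  by rewrite /GRing.scale /= [x * y]mulrC; ring.
have Ia : `](a - 1), (a + 1)[%classic a by rewrite /= in_itv /= ltrBlDr ltrDl ltr01.
have G0 (y : R) : 0 <= `|y| * expR (- y ^+ 2) by rewrite mulr_ge0 ?expR_ge0.
have d1 (x y : R) : partial1of2 f x y = y * expR (- y ^+ 2) * cos (x * y).
  by rewrite partial1of2E; have := df x y => ?; rewrite derive_val.
have Gub (x y : R) : `](a - 1), (a + 1)[%classic x -> D0 y ->
    `|partial1of2 f x y| <= `|y| * expR (- y ^+ 2).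
  move=> _ _; rewrite d1 !normrM (ger0_norm (expR_ge0 _)) ler_piMr ?norm_cos_le1 //.
have dr (x y : R) : `](a - 1), (a + 1)[%classic x -> D0 y -> derivable (f^~ y) x 1.
  by move=> _ _; have := df x y => ?; exact: ex_derive.
have mB : measurable D0 by exact: measurable_itv.
have iF (x : R) : `](a - 1), (a + 1)[%classic x -> mu.-integrable D0 (EFin \o f x).
  by move=> _; exact: integrable_gsin.
apply: DeriveDef.
  exact: (@derivable_under_integral R _ (measurableTypeR R) mu f D0 mB a _ _ Ia iF dr _ G0 int_G Gub).
rewrite -derive1E (@differentiation_under_integral R _ (measurableTypeR R) mu f D0 mB a _ _ Ia iF dr _ G0 int_G Gub).
by apply: eq_Rintegral => y _; rewrite d1.
Qed.

Let is_derive_gcos a : is_derive a (1 : R) gcos (- ysin a).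
Proof.
pose f (x y : R) : R := expR (- y ^+ 2) * cos (x * y).
have df (x y : R) : is_derive x (1 : R) (f^~ y) (- (y * expR (- y ^+ 2) * sin (x * y))).
  have h : is_derive x (1 : R) (fun x => cos (x * y)) (- (y * sin (y * x))).
    have := is_derive_cosl y x; congr (is_derive _ _ _ _).
    by apply/funext => z; rewrite mulrC.
  apply: (is_derive_eq (is_deriveZ (expR (- y ^+ 2)) h)).
  by rewrite /GRing.scale /= [x * y]mulrC; ring.
have Ia : `](a - 1), (a + 1)[%classic a by rewrite /= in_itv /= ltrBlDr ltrDl ltr01.
have G0 (y : R) : 0 <= `|y| * expR (- y ^+ 2) by rewrite mulr_ge0 ?expR_ge0.
have d1 (x y : R) : partial1of2 f x y = - (y * expR (- y ^+ 2) * sin (x * y)).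
  by rewrite partial1of2E; have := df x y => ?; rewrite derive_val.
have Gub (x y : R) : `](a - 1), (a + 1)[%classic x -> D0 y ->
    `|partial1of2 f x y| <= `|y| * expR (- y ^+ 2).
  move=> _ _; rewrite d1 normrN !normrM (ger0_norm (expR_ge0 _)) ler_piMr ?norm_sin_le1 //.
have dr (x y : R) : `](a - 1), (a + 1)[%classic x -> D0 y -> derivable (f^~ y) x 1.
  by move=> _ _; have := df x y => ?; exact: ex_derive.
have mB : measurable D0 by exact: measurable_itv.
have iF (x : R) : `](a - 1), (a + 1)[%classic x -> mu.-integrable D0 (EFin \o f x).
  by move=> _; exact: integrable_gcos.
apply: DeriveDef.
  exact: (@derivable_under_integral R _ (measurableTypeR R) mu f D0 mB a _ _ Ia iF dr _ G0 int_G Gub).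
rewrite -derive1E (@differentiation_under_integral R _ (measurableTypeR R) mu f D0 mB a _ _ Ia iF dr _ G0 int_G Gub).
transitivity (\int[mu]_(y in D0) ((-1) * (y * expR (- y ^+ 2) * sin (a * y)))).
  by apply: eq_Rintegral => y _; rewrite d1 mulN1r.
by rewrite RintegralZl ?mulN1r //; exact: int_ysin.
Qed.

Let is_derive_expq (c a : R) : is_derive a (1 : R) (fun a => expR (c * a ^+ 2)) (2 * c * a * expR (c * a ^+ 2)).
Proof.
have h1 : is_derive a 1 (fun a : R => c * a ^+ 2) (2 * c * a).
  apply: is_derive_eq.
  by rewrite /GRing.scale /=; ring.
by apply: is_derive_eq (is_derive1_comp (f := expR) _ h1) _; rewrite mulrC.
Qed.

(** Differentiating under the integral and [ysinE] give [gcos' = - a / 2 * gcos], so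
    [gcos a * exp (a^2 / 4)] is constant. *)
Lemma gcosE a : gcos a = Num.sqrt pi / 2 * expR (- (4^-1 * a ^+ 2)).
Proof.
have d (x : R) : is_derive x (1 : R) (fun x => gcos x * expR (4^-1 * x ^+ 2)) 0.
  apply: (is_derive_eq (is_deriveM (is_derive_gcos x) (is_derive_expq 4^-1 x))).
  rewrite /GRing.scale /=.
  have -> : ysin x = x * gcos x / 2 by rewrite -ysinE; field.
  by field.
have := is_derive_0_is_cst a 0 d.
rewrite expr0n /= mulr0 expR0 mulr1 => h.
rewrite expRN -[LHS](mulfK (lt0r_neq0 (expR_gt0 (4^-1 * a ^+ 2)))) h; congr (_ / _).
rewrite /gcos /Rintegral -[RHS]/(fine (Num.sqrt pi / 2)%:E) -integral0y_gauss.
by congr fine; apply: eq_integral => y _; rewrite mul0r cos0 mulr1.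
Qed.

(* Dawson's integral: both sides solve [2 f' = 1 - a f], [f 0 = 0]. *)
Lemma gsinE a :
  (\int[mu]_(u in `[0%R, 1%R]) (a / 2 * expR (- (4^-1 * a ^+ 2 * (1 - u ^+ 2))))%:E = (gsin a)%:E)%E.
Proof.
pose F u := gsin (a * u) * expR (4^-1 * a ^+ 2 * u ^+ 2) * expR (- (4^-1 * a ^+ 2)).
have dl (u : R) : is_derive u (1 : R) (fun u => a * u) a.
  by apply: (is_derive_eq (is_deriveZ a (is_derive_id u (1 : R)))); rewrite /GRing.scale /= mulr1.
have dF (u : R) : is_derive u (1 : R) F (a / 2 * expR (- (4^-1 * a ^+ 2 * (1 - u ^+ 2)))).
  have h1 : is_derive u (1 : R) (fun u => gsin (a * u)) (ycos (a * u) * a).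
    exact: (is_derive1_comp (is_derive_gsin (a * u)) (dl u)).
  have h2 := is_deriveM h1 (is_derive_expq (4^-1 * a ^+ 2) u).
  have h3 := is_deriveM h2 (is_derive_cst (expR (- (4^-1 * a ^+ 2))) u (1 : R)).
  apply: (is_derive_eq h3); rewrite /GRing.scale /=.
  have -> : ycos (a * u) = (1 - a * u * gsin (a * u)) / 2 by rewrite -ycosE; field.
  have -> : - (4^-1 * a ^+ 2 * (1 - u ^+ 2)) = - (4^-1 * a ^+ 2) + 4^-1 * a ^+ 2 * u ^+ 2 by ring.
  by rewrite expRD mulr0 add0r; field.
rewrite (@integral_is_derive _ _ F) //.
- have -> : F 0 = 0.
    rewrite /F mulr0 /gsin /Rintegral integral0_eq ?mul0r // => y _.
    by rewrite mul0r sin0 mulr0.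
  by rewrite /F expr1n !mulr1 -mulrA -expRD subrr expR0 mulr1 subr0.
- move=> u _; apply: cvgM; first exact: cvg_cst.
  apply: (continuous_of_derive (f := fun u => expR (- (4^-1 * a ^+ 2 * (1 - u ^+ 2))))
    (f' := fun u => 2 * (4^-1 * a ^+ 2) * u * expR (4^-1 * a ^+ 2 * u ^+ 2) * expR (- (4^-1 * a ^+ 2)))).
  move=> y; have h := is_deriveM (is_derive_expq (4^-1 * a ^+ 2) y) (is_derive_cst (expR (- (4^-1 * a ^+ 2))) y (1 : R)).
  have -> : (fun u => expR (- (4^-1 * a ^+ 2 * (1 - u ^+ 2)))) =
     ((fun a0 => expR (4^-1 * a ^+ 2 * a0 ^+ 2)) * cst (expR (- (4^-1 * a ^+ 2))))%R.
    by apply/funext => z /=; rewrite fctE /= -expRD; congr expR; ring.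
  by apply: (is_derive_eq h); rewrite /GRing.scale /= mulr0 add0r mulrC.
Qed.

End gaussian_trig.

(** * Scaling, parity and Fubini for real-valued integrals *)

Section real_integrals.
Variable R : realType.
Local Notation mu := (@lebesgue_measure R).
Implicit Types f g h : R -> R.

Lemma integrable_boundedM (C : R) h f : measurable_fun setT h -> (forall x, `|h x| <= C) ->
  mu.-integrable setT (EFin \o f) -> mu.-integrable setT (fun x => (h x * f x)%:E).
Proof.
move=> mh hC intf.
apply: (le_integrable _ _ _ (integrable_abse (integrableZl measurableT C intf))) => //.
- have mf : measurable_fun setT f by apply/measurable_EFinP; exact: (measurable_int _ intf).
  by apply/measurable_EFinP; mfun.
- move=> x _; rewrite /= lee_fin !normrM !normr_id.
  by rewrite ler_wpM2r // (le_trans (hC x)) // ler_norm.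
Qed.

Lemma measurable_of_integrable f : mu.-integrable setT (EFin \o f) -> measurable_fun setT f.
Proof. by move=> intf; apply/measurable_EFinP; exact: (measurable_int _ intf). Qed.

Lemma ge0_integral_scale (c : R) (f : R -> \bar R) : c != 0 -> measurable_fun setT f ->
  (forall x, (0 <= f x)%E) ->
  (\int[mu]_x f (c * x)%R = `|c|^-1%:E * \int[mu]_x f x)%E.
Proof.
move=> c0 mf f0; rewrite -(ge0_integral_affine 0 c0 mf f0) muleA -EFinM mulVf ?normr_eq0 // mul1e.
by apply: eq_integral => x _; rewrite addr0.
Qed.

Lemma integrable_scale (c : R) f : c != 0 -> mu.-integrable setT (EFin \o f) ->
  mu.-integrable setT (fun x => (f (c * x))%:E).
Proof.
move=> c0 intf; have mf := measurable_of_integrable intf.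
apply/integrableP; split.
  by apply/measurable_EFinP; apply: (measurableT_comp mf); mfun.
have -> : (\int[mu]_x `|(f (c * x))%:E| = `|c|^-1%:E * \int[mu]_x `|(f x)%:E|)%E.
  rewrite -(@ge0_integral_scale c (fun x => `|(f x)%:E|%E)) //.
  by apply: measurableT_comp => //; apply/measurable_EFinP.
case/integrableP: intf => _ h.
by rewrite lte_mul_pinfty // lee_fin invr_ge0.
Qed.

Lemma integral_scale (c : R) f : c != 0 -> mu.-integrable setT (EFin \o f) ->
  (\int[mu]_x (f (c * x))%:E = `|c|^-1%:E * \int[mu]_x (f x)%:E)%E.
Proof.
move=> c0 intf.
have mF : measurable_fun setT (EFin \o f) := measurable_int _ intf.
rewrite integralE [in RHS]integralE muleDr //; last first.
  apply: fin_num_adde_defl; rewrite fin_numN.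
  exact: (integrable_neg_fin_num measurableT intf).
congr (_ + _)%E.
- rewrite -(@ge0_integral_scale c (EFin \o f)^\+%E c0 (measurable_funepos mF) (funepos_ge0 _)).
  by apply: eq_integral => x _; rewrite !funeposE.
- rewrite muleN -(@ge0_integral_scale c (EFin \o f)^\-%E c0 (measurable_funeneg mF) (funeneg_ge0 _)).
  by congr (- _)%E; apply: eq_integral => x _; rewrite !funenegE.
Qed.

Lemma Rintegral_scale (c : R) f : c != 0 -> mu.-integrable setT (EFin \o f) ->
  \int[mu]_x f (c * x) = `|c|^-1 * \int[mu]_x f x.
Proof.
move=> c0 intf; rewrite /Rintegral integral_scale // fineM //.
exact: integrable_fin_num.
Qed.

Lemma Rintegral_odd f : measurable_fun setT f -> (forall x, f (- x) = - f x) ->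
  \int[mu]_x f x = 0.
Proof.
move=> mf fN; have mF : measurable_fun setT (EFin \o f) by exact/measurable_EFinP.
have E := ge0_integral_opp (measurable_funepos mF) (funepos_ge0 (EFin \o f)).
rewrite /Rintegral integralE -E (_ : (\int[mu]_x _ = \int[mu]_x ((EFin \o f)^\- x))%E).
  by case: (\int[mu]_x _)%E => [r| |] //=; rewrite subrr.
by apply: eq_integral => x _; rewrite funeposE funenegE /= fN EFinN.
Qed.

Lemma Rintegral_even f : mu.-integrable setT (EFin \o f) -> (forall x, f (- x) = f x) ->
  \int[mu]_x f x = 2 * \int[mu]_(x in `[0, +oo[) f x.
Proof.
(* [p] keeps the origin and [n] drops it, so that [p] and the reflection of [n] add up to [f] at
   every point. *)
move=> intf fN; pose p x : R := (0 <= x)%R%:R * f x; pose n x : R := (0 < x)%R%:R * f x.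
have ip : mu.-integrable setT (EFin \o p).
  apply: (@integrable_boundedM 1) intf; first by mfun.
  by move=> x; case: (0 <= x); rewrite ?normr1 ?normr0.
have i_n : mu.-integrable setT (EFin \o n).
  apply: (@integrable_boundedM 1) intf; first by mfun.
  by move=> x; case: (0 < x); rewrite ?normr1 ?normr0.
have N1 : (-1 : R) != 0 by rewrite oppr_eq0 oner_eq0.
have in' := integrable_scale N1 i_n.
have E1 : \int[mu]_x f x = \int[mu]_x p x + \int[mu]_x n (-1 * x).
  rewrite -RintegralD //; apply: eq_Rintegral => x _; rewrite /p /n mulN1r fN oppr_gt0 -mulrDl ltNge.
  by case: (0 <= x) => /=; rewrite ?addr0 ?add0r mul1r.
have E2 : \int[mu]_x n x = \int[mu]_x p x.
  rewrite /Rintegral; congr fine; apply: ae_eq_integral => //;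
    [exact: (measurable_int _ i_n)|exact: (measurable_int _ ip)|].
  exists [set 0]; split; [exact: measurable_set1|exact: lebesgue_measure_set1|].
  move=> x /= h; apply: contrapT => x0; apply: h => _; rewrite /n /p.
  by rewrite lt_neqAle; move/eqP: x0; rewrite eq_sym => ->.
have E3 : \int[mu]_(x in `[0, +oo[) f x = \int[mu]_x p x.
  by rewrite /Rintegral integral_itv_natbool; congr fine; apply: eq_integral => x _; rewrite in_itv /= andbT.
by rewrite E1 Rintegral_scale // E2 normrN1 invr1 mul1r E3 mulr_natl mulr2n.
Qed.

Let integrable_prod (f : R * R -> R) : measurable_fun setT f ->
  (\int[mu]_x \int[mu]_y `|f (x, y)|%:E < +oo)%E -> (mu \x mu)%E.-integrable setT (EFin \o f).
Proof. by move=> mf fy; apply/integrable12ltyP => //; exact/measurable_EFinP. Qed.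

Lemma integrable_Rintegral (f : R * R -> R) : measurable_fun setT f ->
  (\int[mu]_x \int[mu]_y `|f (x, y)|%:E < +oo)%E ->
  mu.-integrable setT (fun x => (\int[mu]_y f (x, y))%:E).
Proof.
move=> mf fy; have ig := integrable_fubini_F (integrable_prod mf fy).
have mg := measurable_int _ ig.
apply: (le_integrable _ _ _ ig) => //.
  exact/measurable_EFinP/(measurableT_comp (@fine_measurable R setT measurableT)).
move=> x _; rewrite /Rintegral /fubini_F.
by case: (\int[mu]_y _)%E => [r| |] /=; rewrite ?lexx ?normr0 ?leey.
Qed.

(** An inner [Rintegral] replaces an infinite value by 0; absolute integrability makes the inner
    integrals finite almost everywhere, so the outer ones are not affected. *)
Lemma Rintegral_fubini (f : R * R -> R) : measurable_fun setT f ->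
  (\int[mu]_x \int[mu]_y `|f (x, y)|%:E < +oo)%E ->
  \int[mu]_x \int[mu]_y f (x, y) = \int[mu]_y \int[mu]_x f (x, y).
Proof.
move=> mf fy.
have intf := integrable_prod mf fy.
have fineE (g : R -> \bar R) : mu.-integrable setT g ->
    (\int[mu]_x (fine (g x))%:E)%E = (\int[mu]_x g x)%E.
  move=> ig; have mg := measurable_int _ ig.
  apply: ae_eq_integral => //; first exact/measurable_EFinP/(measurableT_comp (@fine_measurable R setT measurableT)).
  have := integrable_ae measurableT ig.
  by apply: filterS => x h /= _; rewrite fineK // h.
rewrite /Rintegral; congr fine.
rewrite (fineE (fun x => \int[mu]_y (f (x, y))%:E)%E); last exact: (integrable_fubini_F intf).
rewrite (fineE (fun y => \int[mu]_x (f (x, y))%:E)%E); last first.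
  have ig : (mu \x mu)%E.-integrable setT (EFin \o (fun z => f (z.2, z.1))).
    apply/integrable12ltyP; last exact: ((integrable21ltyP mu mu (measurable_int _ intf)).1 intf).
    by apply/measurable_EFinP; apply: (measurableT_comp mf); exact: measurable_swap.
  exact: (integrable_fubini_F ig).
exact: (Fubini intf).
Qed.

Lemma Rintegral_halfline f : \int[mu]_(x in `[0, +oo[) f x = \int[mu]_x ((0 <= x)%R%:R * f x).
Proof.
rewrite /Rintegral integral_itv_natbool; congr fine; apply: eq_integral => x _.
by rewrite in_itv /= andbT.
Qed.

Lemma integrable_halfline f : measurable_fun setT f -> mu.-integrable `[0, +oo[%classic (EFin \o f) ->
  mu.-integrable setT (fun x => ((0 <= x)%R%:R * f x)%:E).
Proof.
move=> mf /integrableP[_ h]; apply/integrableP; split; first by apply/measurable_EFinP; mfun.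
rewrite [ltLHS](_ : _ = \int[mu]_(x in `[0%R, +oo[) `|f x|%:E)%E //.
rewrite integral_itv_natbool; apply: eq_integral => x _.
by rewrite /= in_itv /= andbT normrM; case: (0 <= x)%R; rewrite ?normr1 ?normr0.
Qed.

Lemma Rintegral_halfline_scale (c : R) f : 0 < c -> measurable_fun setT f ->
  mu.-integrable `[0, +oo[%classic (EFin \o f) ->
  \int[mu]_(x in `[0, +oo[) f (c * x) = c^-1 * \int[mu]_(x in `[0, +oo[) f x.
Proof.
move=> c0 mf intf; rewrite !Rintegral_halfline.
have := Rintegral_scale (lt0r_neq0 c0) (integrable_halfline mf intf).
rewrite gtr0_norm // => <-; apply: eq_Rintegral => x _.
by rewrite pmulr_rge0.
Qed.

End real_integrals.

(** * Fourier transforms of products against a Gaussian *)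

Section fourier.
Variable R : realType.
Local Notation mu := (@lebesgue_measure R).
Implicit Types (g : R -> R) (Z : R -> R[i]).

(** Inversion for the Gaussian, read off [gcosE] after a dilation. It writes the factor of vertex 0
    as a superposition of characters, which then split over the other coordinates. *)
Lemma gauss_fourier (tau s : R) : 0 < tau ->
  \int[mu]_v (Num.sqrt tau / (2 * Num.sqrt pi) * expR (- (tau / 4 * v ^+ 2)) * cos (v * s)) =
  expR (- (s ^+ 2 / tau)).
Proof.
move=> tau0; pose c := Num.sqrt tau / 2.
have st0 : 0 < Num.sqrt tau by rewrite sqrtr_gt0.
have c0 : 0 < c by rewrite divr_gt0.
have sp0 : 0 < Num.sqrt (pi : R) by rewrite sqrtr_gt0 pi_gt0.
have c2 : c ^+ 2 = tau / 4 by rewrite expr_div_n sqr_sqrtr ?(ltW tau0) // -natrX.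
pose f y := expR (- y ^+ 2) * cos (s / c * y).
have mf : measurable_fun setT f by rewrite /f; mfun.
have intf : mu.-integrable `[0, +oo[%classic (EFin \o f) by exact: integrable_gcos.
have fN y : f (- y) = f y by rewrite /f sqrrN mulrN cosN.
have intT : mu.-integrable setT (EFin \o f).
  have i1 := integrable_halfline mf intf.
  have N1 : (-1 : R) != 0 by rewrite oppr_eq0 oner_eq0.
  have i2 := integrable_scale N1 i1.
  apply: (le_integrable _ _ _ (integrableD measurableT (integrable_abse i1) (integrable_abse i2))) => //.
    exact/measurable_EFinP.
  move=> y _ /=; rewrite lee_fin !mulN1r fN oppr_ge0 !normrM.
  rewrite [X in _ <= X]ger0_norm ?addr_ge0 // ?mulr_ge0 // -mulrDl.
  rewrite ler_peMl ?mulr_ge0 //.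
  by case: (leP 0 y) => [h|h]; rewrite ?normr1 ?normr0 ?lerDl ?(ltW h) // normr1 add0r.
transitivity (\int[mu]_v (Num.sqrt tau / (2 * Num.sqrt pi) * f (c * v))).
  apply: eq_Rintegral => v _; rewrite -mulrA /f exprMn c2; congr (_ * (_ * cos _)).
  by field; rewrite gt_eqF.
rewrite RintegralZl //; last exact: (integrable_scale (lt0r_neq0 c0) intT).
rewrite (Rintegral_scale (lt0r_neq0 c0) intT) (Rintegral_even intT fN) -/(gcos (s / c)) gcosE.
rewrite (gtr0_norm c0) exprMn exprVn c2 mulrCA mulrA.
have -> : 4^-1 * (s ^+ 2 / (tau / 4)) = s ^+ 2 / tau by field; rewrite gt_eqF.
rewrite /c; move: (expR _) (Num.sqrt tau) st0 (Num.sqrt pi) sp0 => e a a0 b b0.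
by field; rewrite !gt_eqF.
Qed.

Lemma eq_integrableT (f h : R -> \bar R) : f =1 h -> mu.-integrable setT f -> mu.-integrable setT h.
Proof. by move=> /funext ->. Qed.

Definition fcos g (v : R) : R := \int[mu]_x (cos (v * x) * g x).
Definition fsin g (v : R) : R := \int[mu]_x (sin (v * x) * g x).
Definition fourierT g (v : R) : R[i] := Complex (fcos g v) (fsin g v).

Section one_function.
Variable g : R -> R.
Hypothesis g0 : forall x, 0 <= g x.
Hypothesis ig : mu.-integrable setT (EFin \o g).

Let mg : measurable_fun setT g := measurable_of_integrable ig.

Lemma integrable_fcos v : mu.-integrable setT (fun x => (cos (v * x) * g x)%:E).
Proof.
by apply: (@integrable_boundedM _ 1) => //; [mfun|move=> x; exact: norm_cos_le1].
Qed.

Lemma integrable_fsin v : mu.-integrable setT (fun x => (sin (v * x) * g x)%:E).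
Proof.
by apply: (@integrable_boundedM _ 1) => //; [mfun|move=> x; exact: norm_sin_le1].
Qed.

Let measurable_trig (h : R -> R) : measurable_fun setT h -> (forall x, `|h x| <= 1) ->
  measurable_fun setT (fun v : R => \int[mu]_x (h (v * x) * g x)).
Proof.
move=> mh h1.
have m1 : measurable_fun setT (fun z : R * R => h (z.1 * z.2)).
  by apply: (measurableT_comp mh); mfun.
have m2 : measurable_fun setT (fun z : R * R => g z.2) by apply: (measurableT_comp mg).
have mF : measurable_fun setT (fun v : R => \int[mu]_x ((1 + h (v * x)) * g x)%:E)%E.
  apply: (measurable_fun_fubini_tonelli_F (m2 := mu) (fun z : R * R => ((1 + h (z.1 * z.2)) * g z.2)%:E)).
    by apply/measurable_EFinP; mfun.
  move=> z; rewrite lee_fin mulr_ge0 // -lerBlDl sub0r.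
  by have := h1 (z.1 * z.2); rewrite ler_norml => /andP[].
rewrite (_ : (fun v : R => _) = (fun v : R => fine (\int[mu]_x ((1 + h (v * x)) * g x)%:E)%E - \int[mu]_x g x)).
  apply: measurable_funB => //.
  exact: (measurableT_comp (@fine_measurable R setT measurableT) mF).
apply/funext => v; rewrite -/(Rintegral mu setT (fun x => (1 + h (v * x)) * g x)).
have ih : mu.-integrable setT (EFin \o (fun x => h (v * x) * g x)).
  by apply: (@integrable_boundedM _ 1) => //; apply: (measurableT_comp mh); mfun.
rewrite (_ : \int[mu]_x ((1 + h (v * x)) * g x) = \int[mu]_x g x + \int[mu]_x (h (v * x) * g x)).
  by rewrite addrC addKr.
by rewrite -RintegralD //; apply: eq_Rintegral => x _; rewrite mulrDl mul1r.
Qed.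

Lemma measurable_fcos : measurable_fun setT (fcos g).
Proof. by apply: measurable_trig; [mfun|exact: norm_cos_le1]. Qed.

Lemma measurable_fsin : measurable_fun setT (fsin g).
Proof. by apply: measurable_trig; [mfun|exact: norm_sin_le1]. Qed.

Let norm_trig (h : R -> R) (v : R) : measurable_fun setT h -> (forall x, `|h x| <= 1) ->
  `|\int[mu]_x (h (v * x) * g x)| <= \int[mu]_x g x.
Proof.
move=> mh h1.
have ih : mu.-integrable setT (EFin \o (fun x => h (v * x) * g x)).
  by apply: (@integrable_boundedM _ 1) => //; apply: (measurableT_comp mh); mfun.
apply: (le_trans (le_normr_Rintegral measurableT ih)).
apply: le_Rintegral => //; first exact: (integrable_abse ih).
by move=> x _; rewrite normrM (ger0_norm (g0 x)) ler_piMl.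
Qed.

Lemma norm_fcos v : `|fcos g v| <= \int[mu]_x g x.
Proof. by apply: norm_trig; [mfun|exact: norm_cos_le1]. Qed.

Lemma norm_fsin v : `|fsin g v| <= \int[mu]_x g x.
Proof. by apply: norm_trig; [mfun|exact: norm_sin_le1]. Qed.

(* [crot s z v] is [Re (e^(ivs) z)]. *)
Definition crot (s : R) (z : R[i]) (v : R) : R := cos (v * s) * complex.Re z - sin (v * s) * complex.Im z.

Definition cintegrable Z := mu.-integrable setT (fun v => (complex.Re (Z v))%:E) /\
  mu.-integrable setT (fun v => (complex.Im (Z v))%:E).

Lemma cintegrable_fourierT Z : cintegrable Z -> cintegrable (fun v => Z v * fourierT g v).
Proof.
move=> [i1 i2].
have c1 := integrable_boundedM measurable_fcos norm_fcos i1.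
have c2 := integrable_boundedM measurable_fsin norm_fsin i2.
have c3 := integrable_boundedM measurable_fsin norm_fsin i1.
have c4 := integrable_boundedM measurable_fcos norm_fcos i2.
split.
- apply: (eq_integrableT _ (integrableB measurableT c1 c2)) => v.
  by case: (Z v) => a b; rewrite /= -EFinB [a * _]mulrC [b * _]mulrC.
- apply: (eq_integrableT _ (integrableD measurableT c3 c4)) => v.
  by case: (Z v) => a b; rewrite /= -EFinD [a * _]mulrC [b * _]mulrC.
Qed.

Lemma integrable_crot Z s : cintegrable Z -> mu.-integrable setT (fun v => (crot s (Z v) v)%:E).
Proof.
move=> [i1 i2].
have c1 : mu.-integrable setT (fun v => (cos (v * s) * complex.Re (Z v))%:E).
  by apply: (@integrable_boundedM _ 1) i1; [mfun|move=> v; exact: norm_cos_le1].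
have c2 : mu.-integrable setT (fun v => (sin (v * s) * complex.Im (Z v))%:E).
  by apply: (@integrable_boundedM _ 1) i2; [mfun|move=> v; exact: norm_sin_le1].
exact: (integrableB measurableT c1 c2).
Qed.

(** Since [e^(iv(s+x)) = e^(ivs) e^(ivx)], integrating a shift against [g] multiplies the spectral
    function by the transform of [g]. *)
Lemma fourier_step Z s : cintegrable Z ->
  (\int[mu]_x (g x * \int[mu]_v crot (s + x) (Z v) v)%:E = (\int[mu]_v crot s (Z v * fourierT g v) v)%:E)%E.
Proof.
move=> iZ; have [i1 i2] := iZ.
pose f (z : R * R) := g z.1 * crot (s + z.1) (Z z.2) z.2.
have m1 := measurable_of_integrable i1; have m2 := measurable_of_integrable i2.
have k1 : measurable_fun setT (fun z : R * R => complex.Re (Z z.2)).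
  by apply: (measurableT_comp m1).
have k2 : measurable_fun setT (fun z : R * R => complex.Im (Z z.2)).
  by apply: (measurableT_comp m2).
have k3 : measurable_fun setT (fun z : R * R => g z.1) by apply: (measurableT_comp mg).
have mf : measurable_fun setT f by rewrite /f /crot; mfun.
(* [N] bounds [crot] uniformly in the shift, so [g x * N v] dominates the integrand and Fubini
   applies. *)
pose N v := `|complex.Re (Z v)| + `|complex.Im (Z v)|.
have iN : mu.-integrable setT (EFin \o N).
  exact: (integrableD measurableT (integrable_abse i1) (integrable_abse i2)).
have mN : measurable_fun setT N := measurable_of_integrable iN.
have fy : (\int[mu]_x \int[mu]_y `|f (x, y)|%:E < +oo)%E.
  apply: (@le_lt_trans _ _ (\int[mu]_x ((g x)%:E * \int[mu]_v (N v)%:E))%E).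
    apply: ge0_le_integral => //.
    - by move=> x _; apply: integral_ge0 => v _; rewrite lee_fin.
    - apply: (measurable_fun_fubini_tonelli_F (m2 := mu) (fun z : R * R => `|f z|%:E)).
        by apply/measurable_EFinP; mfun.
      by move=> z; rewrite lee_fin.
    - have := measurable_int _ ig => mg'.
      by apply: emeasurable_funM => //; exact: measurable_cst.
    - move=> x _; rewrite -ge0_integralZl //.
      + apply: ge0_le_integral => //.
        * apply/measurable_EFinP.
          have a1 : measurable_fun setT (fun v : R => f (x, v)) by rewrite /f /crot /=; mfun.
          by mfun.
        * by apply: emeasurable_funM; [exact: measurable_cst|exact/measurable_EFinP].
        * move=> v _; rewrite lee_fin /f normrM (ger0_norm (g0 _)) ler_wpM2l //.
          rewrite /crot (le_trans (ler_normB _ _)) // lerD // normrM ler_piMl //.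
            exact: norm_cos_le1.
          exact: norm_sin_le1.
      + exact/measurable_EFinP.
      + by move=> v _; rewrite lee_fin addr_ge0.
      + by rewrite lee_fin.
  have /integrableP[_ ] := ig; under eq_integral do rewrite gee0_abs ?lee_fin //.
  move=> gy; have Nf := integrable_fin_num measurableT iN.
  rewrite -(fineK Nf) ge0_integralZr //.
  - rewrite muleC lte_mul_pinfty // lee_fin; apply: fine_ge0; apply: integral_ge0 => v _.
    by rewrite lee_fin addr_ge0.
  - exact/measurable_EFinP.
  - by move=> x _; rewrite lee_fin.
  - by rewrite lee_fin; apply: fine_ge0; apply: integral_ge0 => v _; rewrite lee_fin addr_ge0.
have E1 : (\int[mu]_x (g x * \int[mu]_v crot (s + x) (Z v) v)%:E = \int[mu]_x (\int[mu]_v f (x, v))%:E)%E.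
  apply: eq_integral => x _; congr EFin.
  by rewrite -RintegralZl //; exact: integrable_crot.
rewrite E1 -(fineK (integrable_fin_num measurableT (integrable_Rintegral mf fy))); congr EFin.
rewrite -/(Rintegral mu setT (fun x => \int[mu]_v f (x, v))) (Rintegral_fubini mf fy).
apply: eq_Rintegral => v _.
pose A := cos (v * s) * complex.Re (Z v) - sin (v * s) * complex.Im (Z v).
pose B := - (sin (v * s) * complex.Re (Z v) + cos (v * s) * complex.Im (Z v)).
transitivity (\int[mu]_x (A * (cos (v * x) * g x) + B * (sin (v * x) * g x))).
  apply: eq_Rintegral => x _; rewrite /f /crot /= [v * (s + x)]mulrDr cosD sinD /A /B; ring.
have jc := integrable_fcos v; have js := integrable_fsin v.
have jc' := integrableZl measurableT A jc; have js' := integrableZl measurableT B js.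
rewrite RintegralD // !RintegralZl // -/(fcos g v) -/(fsin g v) /A /B /crot.
case: (Z v) => a b /=; ring.
Qed.

End one_function.

(** Induction on [m], the shift [s] collecting the coordinates already fixed; the base case is
    [gauss_fourier]. The [g i] may take the value [+oo], as [qE] does, but only on a null set, which
    [fine] may change freely. *)
Lemma fourier_prod (m : nat) (tau s : R) (g : 'I_m -> R -> \bar R) : 0 < tau ->
  (forall i x, (0 <= g i x)%E) -> (forall i, mu.-integrable setT (g i)) ->
  let Z v := (Num.sqrt tau / (2 * Num.sqrt pi) * expR (- (tau / 4 * v ^+ 2)))%:C%C *
    \prod_i fourierT (fine \o g i) v in
  cintegrable Z /\
  intRd (fun x : 'rV[R]_m => (\prod_i g i (x ord0 i)) *
    (expR (- ((s + \sum_i x ord0 i) ^+ 2 / tau)))%:E)%E = (\int[mu]_v crot s (Z v) v)%:E.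
Proof.
move=> tau0; elim: m s g => [|m IH] s g g0 ig /=.
- have e0 (v : R) : \prod_(i < 0) fourierT (fine \o g i) v = 1 by rewrite big_ord0.
  pose c : R := Num.sqrt tau / (2 * Num.sqrt pi).
  have ic : mu.-integrable setT (fun v => (c * expR (- (tau / 4 * v ^+ 2)))%:E).
    have -> : (fun v => (c * expR (- (tau / 4 * v ^+ 2)))%:E) =
        (fun v : R => c%:E * (expR (- (tau / 4 * v ^+ 2)))%:E)%E by [].
    apply: integrableZl => //.
    apply/integrableP; split; first by mfun.
    under eq_integral do rewrite gee0_abs ?lee_fin ?expR_ge0 //.
    by rewrite integral_gauss_scale ?divr_gt0 // ltry.
  split.
    split; first by apply: (eq_integrableT _ ic) => v; rewrite e0 mulr1.
    apply: (eq_integrableT _ (integrable0 mu setT)) => v.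
    by rewrite e0 mulr1.
  rewrite big_ord0 big_ord0 mul1e addr0 -gauss_fourier //; congr EFin.
  by apply: eq_Rintegral => v _; rewrite /crot e0 mulr1 /= mulr0 subr0 mulrC.
- pose h i := g (lift ord0 i).
  have h0 i x : (0 <= h i x)%E by exact: g0.
  have ih i : mu.-integrable setT (h i) by exact: ig.
  have mh i : measurable_fun setT (h i) := measurable_int _ (ih i).
  have [iZ _] := IH s h h0 ih.
  have mg : measurable_fun setT (g ord0) := measurable_int _ (ig ord0).
  have fg0 x : 0 <= fine (g ord0 x) by exact: fine_ge0.
  have ifg : mu.-integrable setT (EFin \o (fine \o g ord0)).
    apply: (le_integrable _ _ _ (ig ord0)) => //.
      exact/measurable_EFinP/(measurableT_comp (@fine_measurable R setT measurableT)).
    by move=> x _ /=; case: (g ord0 x) => [r| |] /=; rewrite ?lexx ?normr0 ?leey.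
  split.
    have := cintegrable_fourierT fg0 ifg iZ; congr cintegrable.
    by apply/funext => v; rewrite big_ord_recl [RHS]mulrA [LHS]mulrAC.
  set W := (fun v => _) in iZ.
  transitivity (\int[mu]_x (fine (g ord0 x) * \int[mu]_v crot (s + x) (W v) v)%:E)%E; last first.
    rewrite (fourier_step fg0 ifg s iZ); congr EFin; apply: eq_Rintegral => v _; congr crot.
    by rewrite big_ord_recl [RHS]mulrA [LHS]mulrAC.
  transitivity (\int[mu]_x (g ord0 x * (\int[mu]_v crot (s + x) (W v) v)%:E))%E.
    apply: eq_integral => x _; have [_ <-] := IH (s + x) h h0 ih.
    rewrite -intRdZl //.
    + apply: eq_intRd => y; rewrite !big_ord_recl; have -> : row_mx x%:M y ord0 ord0 = x.
        by rewrite mxE; case: splitP => // j; rewrite !mxE !ord1 mulr1n.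
      have e i : row_mx x%:M y ord0 (lift ord0 i) = y ord0 i.
        transitivity (row_mx (x%:M : 'M[R]_1) y ord0 (rshift 1 i)); last by rewrite row_mxEr.
        by congr (row_mx _ _ _ _); exact/val_inj.
      rewrite addrA -muleA; congr (_ * (_ * _))%E.
        by apply: eq_bigr => i _; rewrite e.
      by under eq_bigr do rewrite e.
    + apply: emeasurable_funM; last by mfun.
      by apply: (@mfun_bigprode _ _ _ _ _ _ (fun i (y : 'rV[R]_m) => h i (y ord0 i))) => i;
        apply: (measurableT_comp (mh i)); mfun.
    + by move=> y; rewrite mule_ge0 ?lee_fin ?expR_ge0 // prode_ge0.
  have mr : measurable_fun setT (fun x => (\int[mu]_v crot (s + x) (W v) v)%:E).
    have -> : (fun x => (\int[mu]_v crot (s + x) (W v) v)%:E) =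
      (fun x => intRd (fun y : 'rV[R]_m => (\prod_i h i (y ord0 i)) *
        (expR (- ((s + x + \sum_i y ord0 i) ^+ 2 / tau)))%:E)%E).
      by apply/funext => x; have [_ ->] := IH (s + x) h h0 ih.
    apply: measurable_intRd.
      apply: emeasurable_funM; last by mfun.
      apply: (@mfun_bigprode _ _ _ _ _ _ (fun i (p : R * 'rV[R]_m) => h i (p.2 ord0 i))) => i.
      by apply: (measurableT_comp (mh i)); mfun.
    by move=> x y; rewrite mule_ge0 ?lee_fin ?expR_ge0 // prode_ge0.
  have /measurable_EFinP mr' := mr.
  have mfg := measurable_of_integrable ifg.
  apply: ae_eq_integral => //.
  + by apply: emeasurable_funM.
  + by apply/measurable_EFinP; apply: measurable_funM.
  + have := integrable_ae measurableT (ig ord0); apply: filterS => x hx _.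
    by have fx := hx Logic.I; rewrite /= EFinM (fineK fx).
Qed.

End fourier.

(** * The cone integral as a convolution *)

Section cone_fourier.
Variables (R : realType) (d : nat) (alpha : R).
Hypothesis alpha0 : 0 < alpha.
Local Notation mu := (@lebesgue_measure R).

Let s0 : R := (alpha - 1) / 2.

Definition qker (t x : R) : R := gamma_ker ((alpha - 1) / 2) t * expR (- (x ^+ 2 / t)).
(** The function [q] of the overview, kept extended because [q 0] is infinite when [alpha <= 1]. *)
Definition qE (x : R) : \bar R := (\int[mu]_t (qker t x)%:E)%E.
Definition gcone (k i : nat) (x : R) : \bar R := (((k <= i.+1)%N ==> (0 <= x)%R)%:R%:E * qE x)%E.

Lemma qker_ge0 t x : 0 <= qker t x.
Proof. by rewrite mulr_ge0 ?gamma_ker_ge0 ?expR_ge0. Qed.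

Lemma mfun_qker (e : measure_display) (T : measurableType e) (t x : T -> R) :
  measurable_fun setT t -> measurable_fun setT x -> measurable_fun setT (fun p => qker (t p) (x p)).
Proof.
move=> mt mx; apply: mfun_mul; last by mfun.
exact: (measurableT_comp (measurable_gamma_ker s0)).
Qed.

Lemma qE_ge0 x : (0 <= qE x)%E.
Proof. by apply: integral_ge0 => t _; rewrite lee_fin qker_ge0. Qed.

Lemma measurable_qE : measurable_fun setT qE.
Proof.
apply: (measurable_fun_fubini_tonelli_G (m1 := mu) (fun p : R * R => (qker p.1 p.2)%:E)).
  by apply/measurable_EFinP; apply: mfun_qker; mfun.
by move=> p; rewrite lee_fin qker_ge0.
Qed.

(** The Gaussian [exp (- x^2 / t)] has mass [sqrt (pi t)]; its root raises the shape from
    [(alpha - 1) / 2], possibly nonpositive, to the positive [alpha / 2]. *)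
Lemma gamma_ker_sqrt (t : R) : gamma_ker s0 t * Num.sqrt t = gamma_ker (alpha / 2) t.
Proof.
rewrite /gamma_ker; case: (ltP 0 t) => t0; last by rewrite !mul0r.
rewrite !mul1r mulrAC -powR12_sqrt ?(ltW t0) // -powRD; last by rewrite (gt_eqF t0) implybT.
by congr (_ `^ _ * _); rewrite /s0; field.
Qed.

Lemma integral_qE : (\int[mu]_x qE x = (Num.sqrt pi * Gamma (alpha / 2))%:E)%E.
Proof.
rewrite [LHS](fubini_tonelli (m1 := mu) (m2 := mu) (fun p : R * R => (qker p.2 p.1)%:E)); last 2 first.
- by apply/measurable_EFinP; apply: mfun_qker; mfun.
- by move=> p; rewrite lee_fin qker_ge0.
rewrite EFinM -integral_gamma_ker ?divr_gt0 //.
rewrite -ge0_integralZl //; last 2 first.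
- by apply: mfun_EFin; exact: measurable_gamma_ker.
- by move=> s _; rewrite lee_fin gamma_ker_ge0.
apply: eq_integral => t _ /=; rewrite -gamma_ker_sqrt.
have [t0|t0] := ltP 0 t; last first.
  rewrite /gamma_ker ltNge t0 /= !mul0r mule0; apply: integral0_eq => x _.
  by rewrite /qker /gamma_ker ltNge t0 /= !mul0r.
rewrite /qker -/s0; under eq_integral do rewrite EFinM.
rewrite ge0_integralZl; [|exact: measurableT|by mfun|by move=> *; rewrite lee_fin expR_ge0|by rewrite lee_fin gamma_ker_ge0].
under eq_integral do rewrite mulrC.
rewrite integral_gauss_scale ?invr_gt0 // invrK -!EFinM powR12_sqrt ?mulr_ge0 ?pi_ge0 ?(ltW t0) //.
by rewrite sqrtrM ?pi_ge0 //; congr EFin; ring.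
Qed.

Lemma gcone_ge0 k i x : (0 <= gcone k i x)%E.
Proof. by rewrite mule_ge0 ?lee_fin ?qE_ge0. Qed.

Lemma measurable_gcone k i : measurable_fun setT (gcone k i).
Proof.
have m := measurable_qE; apply: emeasurable_funM => //.
apply/measurable_EFinP; apply: mfun_natbool.
by case: (k <= i.+1)%N => /=; mfun.
Qed.

Lemma integrable_gcone k i : mu.-integrable setT (gcone k i).
Proof.
have m := measurable_gcone k i.
apply/integrableP; split => //; under eq_integral do rewrite gee0_abs ?gcone_ge0 //.
apply: (@le_lt_trans _ _ (\int[mu]_x qE x)%E); last by rewrite integral_qE ltry.
apply: ge0_le_integral => //.
- by move=> x _; exact: gcone_ge0.
- exact: measurable_qE.
- move=> x _; rewrite /gcone; case: (_ ==> _); rewrite ?mul1e ?mul0e //; exact: qE_ge0.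
Qed.

Lemma face_cone_prod k (l : 'rV[R]_d) :
  (face_cone k l)%:R = \prod_(i < d) ((k <= i.+1)%N ==> (0 <= l ord0 i))%:R :> R.
Proof.
have [/face_coneP h|/face_coneP h] := boolP (face_cone k l).
  by rewrite big1 // => i _; case: leqP => //= ki; rewrite h.
have [i hi] : exists i : 'I_d, ~~ ((k <= i.+1)%N ==> (0 <= l ord0 i)).
  apply/existsP; rewrite -negb_forall; apply/negP => /forallP h'; apply: h => i ki.
  by have := h' i; rewrite ki.
by rewrite (bigD1 i) //= (negbTE hi) mul0r.
Qed.

(** The mixing variable [t] of vertex 0 stays outside, where its factor is the Gaussian of
    [sum_i l_i]; the mixing variables of the other vertices are integrated out and produce [qE]. The
    [0 +] is the initial shift of [fourier_prod]. *)
Lemma LK_outer k : LK d alpha k = (\int[mu]_t ((gamma_ker s0 t)%:E *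
  intRd (fun l : 'rV[R]_d => (\prod_(i < d) gcone k i (l ord0 i)) *
    (expR (- ((0 + \sum_i l ord0 i) ^+ 2 / t)))%:E)))%E.
Proof.
rewrite /LK /=; apply: eq_integral => t _.
pose D (l : 'rV[R]_d) : R := \prod_(i < d) ((k <= i.+1)%N ==> (0 <= l ord0 i))%:R.
pose E (l : 'rV[R]_d) : R := expR (- ((0 + \sum_i l ord0 i) ^+ 2 / t)).
have D0 l : 0 <= D l by apply: prodr_ge0.
have mD (e : measure_display) (T : measurableType e) (l : T -> 'rV[R]_d) : measurable_fun setT l ->
    measurable_fun setT (fun p => D (l p)).
  move=> ml; rewrite /D.
  apply: (@mfun_bigprod _ _ _ _ _ _ (fun (i : 'I_d) p => ((k <= i.+1)%N ==> (0 <= l p ord0 i))%:R)) => i.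
  by apply: mfun_natbool; case: (k <= i.+1)%N => /=; mfun.
have mE (e : measure_display) (T : measurableType e) (l : T -> 'rV[R]_d) : measurable_fun setT l ->
    measurable_fun setT (fun p => E (l p)) by move=> ml; rewrite /E; mfun.
pose F (u l : 'rV[R]_d) : \bar R :=
  ((gamma_ker s0 t * (D l * E l)) * \prod_i qker (u ord0 i) (l ord0 i))%:E.
have F0 u l : (0 <= F u l)%E.
  rewrite lee_fin; apply: mulr_ge0; last by apply: prodr_ge0 => i _; exact: qker_ge0.
  by apply: mulr_ge0; [exact: gamma_ker_ge0|rewrite mulr_ge0 ?expR_ge0].
have mQ : measurable_fun setT (fun p : 'rV[R]_d * 'rV[R]_d => \prod_i qker (p.1 ord0 i) (p.2 ord0 i)).
  apply: (@mfun_bigprod _ _ _ _ _ _ (fun (i : 'I_d) (p : 'rV[R]_d * 'rV[R]_d) =>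
    qker (p.1 ord0 i) (p.2 ord0 i))) => i.
  by apply: mfun_qker; mfun.
have mF : measurable_fun setT (fun p : 'rV[R]_d * 'rV[R]_d => F p.1 p.2).
  apply/measurable_EFinP; apply: mfun_mul => //; apply: mfun_mul; first exact: measurable_cst.
  by apply: mfun_mul; [apply: mD|apply: mE]; exact: measurable_snd.
transitivity (intRd (fun u => intRd (F u))).
  apply: eq_intRd => u; rewrite /cone_gauss_int -intRdZl //.
  - apply: eq_intRd => l; rewrite -EFinM /F; congr EFin.
    have e0 : row_mx t%:M u ord0 ord0 = t.
      by rewrite mxE; case: splitP => // j; rewrite !mxE !ord1 mulr1n.
    have eS i : row_mx t%:M u ord0 (lift ord0 i) = u ord0 i.
      transitivity (row_mx (t%:M : 'M[R]_1) u ord0 (rshift 1 i)); last by rewrite row_mxEr.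
      by congr (row_mx _ _ _ _); exact/val_inj.
    have Q : qform (row_mx t%:M u : 'rV[R]_d.+1) l =
        (\sum_i l ord0 i) ^+ 2 / t + \sum_i l ord0 i ^+ 2 / u ord0 i.
      rewrite [LHS]big_ord_recl e0 hat0 sqrrN; congr (_ + _).
      by apply: eq_bigr => i _; rewrite eS hatS.
    have P : \prod_i gamma_ker s0 (row_mx t%:M u ord0 i) =
        gamma_ker s0 t * \prod_i gamma_ker s0 (u ord0 i).
      by rewrite big_ord_recl e0; congr (_ * _); apply: eq_bigr => i _; rewrite eS.
    rewrite P Q face_cone_prod -/(D l) [in RHS]big_split /=.
    rewrite opprD expRD /E add0r.
    rewrite -sumrN expR_sum.
    move: (\prod_(i < d) gamma_ker _ _) (\prod_(i < d) expR _) => a b.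
    rewrite -/s0; ring.
  - apply: measurable_cone_qform; mfun.
  - by rewrite lee_fin; apply: prodr_ge0 => i _; exact: gamma_ker_ge0.
rewrite intRd_swap // -intRdZl; last 3 first.
- apply: emeasurable_funM; last by apply/measurable_EFinP; apply: mE; mfun.
  apply: (@mfun_bigprode _ _ _ _ _ _ (fun (i : 'I_d) (l : 'rV[R]_d) => gcone k i (l ord0 i))) => i.
  by apply: (measurableT_comp (measurable_gcone k i)); mfun.
- by move=> l; rewrite mule_ge0 ?lee_fin ?expR_ge0 // prode_ge0 // => i _; exact: gcone_ge0.
- by rewrite lee_fin gamma_ker_ge0.
apply: eq_intRd => l.
rewrite /F; under eq_intRd do rewrite EFinM.
rewrite intRdZl; last 3 first.
- apply/measurable_EFinP.
  apply: (@mfun_bigprod _ _ _ _ _ _ (fun (i : 'I_d) (u : 'rV[R]_d) =>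
    qker (u ord0 i) (l ord0 i))) => i.
  by apply: mfun_qker; mfun.
- by move=> u; rewrite lee_fin; apply: prodr_ge0 => i _; exact: qker_ge0.
- by rewrite lee_fin; apply: mulr_ge0; [exact: gamma_ker_ge0|rewrite mulr_ge0 ?expR_ge0].
under eq_intRd do rewrite -prod_EFin.
rewrite (@intRd_prod _ _ (fun i u => (qker u (l ord0 i))%:E)).
- rewrite EFinM -muleA; congr (_ * _)%E; rewrite -/(E l) EFinM muleAC; congr (_ * _)%E.
  by rewrite /D -prod_EFin -big_split.
- by move=> i; apply/measurable_EFinP; apply: mfun_qker; mfun.
- by move=> i x; rewrite lee_fin qker_ge0.
Qed.

End cone_fourier.

(** * The cone integral as a Fourier integral *)

Section fourier_inversion.
Variables (R : realType) (d : nat) (alpha : R).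
Hypothesis alpha0 : 0 < alpha.
Local Notation mu := (@lebesgue_measure R).

Definition cone_fourierT (k : nat) (v : R) : R[i] :=
  \prod_(i < d) fourierT (fine \o gcone alpha k i) v.

Lemma integral_gamma_ker_expR (s a : R) : 0 < s -> 0 <= a ->
  (\int[mu]_t (gamma_ker s t * expR (- (t * a)))%:E = (Gamma s * (1 + a) `^ (- s))%:E)%E.
Proof.
move=> sp a0; rewrite -integral_gamma_scale ?ltr_pwDl //; apply: eq_integral => t _; congr EFin.
by rewrite /gamma_ker -!mulrA -expRD; congr (_ * (_ * expR _)); ring.
Qed.

Let fourier_gcone k (t s : R) (t0 : 0 < t) := @fourier_prod R d t s (fun i => gcone alpha k i) t0
  (fun i => @gcone_ge0 R alpha k i) (fun i => integrable_gcone alpha0 k i).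

Let ReZ (a : R) (z : R[i]) : complex.Re (a%:C%C * z) = a * complex.Re z.
Proof. by case: z => x y /=; rewrite mul0r subr0. Qed.

(** By [fourier_prod] at [tau = 1], the product with a positive Gaussian is integrable, hence
    measurable; the Gaussian is then divided out. *)
Lemma measurable_Re_cone_fourierT k : measurable_fun setT (fun v => complex.Re (cone_fourierT k v)).
Proof.
have [[h _] _] := fourier_gcone k 0 (@ltr01 R); have m := measurable_of_integrable h.
pose c (v : R) : R := Num.sqrt 1 / (2 * Num.sqrt pi) * expR (- (1 / 4 * v ^+ 2)).
have c0 v : 0 < c v by rewrite mulr_gt0 ?expR_gt0 // sqrtr1 mul1r invr_gt0 mulr_gt0 // sqrtr_gt0 pi_gt0.
have mc : measurable_fun setT c by rewrite /c; mfun.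
rewrite (_ : (fun v => _) = (fun v => (c v)^-1 * complex.Re ((c v)%:C%C * cone_fourierT k v))).
  by apply: mfun_mul => //; mfun.
by apply/funext => v; rewrite ReZ mulKf // gt_eqF.
Qed.

(** For fixed [t] the integrand is [fourier_prod] at shift 0. Integrating [t] first turns the
    Gaussian weight into [Gamma (alpha / 2) / (2 sqrt pi) * (1 + v^2 / 4)^(- alpha / 2)], which is
    [A v / (2 pi)]: the transform of vertex 0 with the inversion constant. The premise is what
    Fubini requires. *)
Lemma LK_fourier k :
  (\int[mu]_v ((1 + v ^+ 2 / 4) `^ (- (alpha / 2)) * `|complex.Re (cone_fourierT k v)|)%:E < +oo)%E ->
  LK d alpha k = (\int[mu]_v (Gamma (alpha / 2) / (2 * Num.sqrt pi) *
    ((1 + v ^+ 2 / 4) `^ (- (alpha / 2)) * complex.Re (cone_fourierT k v))))%:E.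
Proof.
move=> Wy; pose W v := complex.Re (cone_fourierT k v).
have mW : measurable_fun setT W := measurable_Re_cone_fourierT k.
pose K : R := (2 * Num.sqrt pi)^-1.
have K0 : 0 <= K by rewrite invr_ge0 mulr_ge0 ?sqrtr_ge0.
have a20 : 0 < alpha / 2 by rewrite divr_gt0.
pose f (z : R * R) := K * W z.2 * (gamma_ker (alpha / 2) z.1 * expR (- (z.1 * (z.2 ^+ 2 / 4)))).
have k1 : measurable_fun setT (fun z : R * R => W z.2) by apply: (measurableT_comp mW).
have k2 : measurable_fun setT (fun z : R * R => gamma_ker (alpha / 2) z.1).
  by apply: (measurableT_comp (measurable_gamma_ker _)).
have mf : measurable_fun setT f by rewrite /f; mfun.
have G1 v : (\int[mu]_t (gamma_ker (alpha / 2) t * expR (- (t * (v ^+ 2 / 4))))%:E =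
    (Gamma (alpha / 2) * (1 + v ^+ 2 / 4) `^ (- (alpha / 2)))%:E)%E.
  by rewrite integral_gamma_ker_expR // divr_ge0 ?sqr_ge0.
have gv0 (v t : R) : 0 <= gamma_ker (alpha / 2) t * expR (- (t * (v ^+ 2 / 4))).
  by rewrite mulr_ge0 ?gamma_ker_ge0 ?expR_ge0.
have mg (v : R) : measurable_fun setT (fun t : R => (gamma_ker (alpha / 2) t * expR (- (t * (v ^+ 2 / 4))))%:E).
  by apply/measurable_EFinP; apply: mfun_mul; [exact: measurable_gamma_ker|mfun].
have fy : (\int[mu]_t \int[mu]_v `|f (t, v)|%:E < +oo)%E.
  rewrite [ltLHS](fubini_tonelli (m1 := mu) (m2 := mu) (fun z => `|f z|%:E)); last 2 first.
  - by apply/measurable_EFinP; mfun.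
  - by move=> z; rewrite lee_fin.
  have -> : (\int[mu]_v \int[mu]_t `|f (t, v)|%:E = \int[mu]_v ((K * Gamma (alpha / 2))%:E *
      ((1 + v ^+ 2 / 4) `^ (- (alpha / 2)) * `|W v|)%:E))%E.
    apply: eq_integral => v _.
    under eq_integral do rewrite /f /= normrM (ger0_norm (gv0 _ _)) EFinM.
    rewrite ge0_integralZl; [|exact: measurableT|exact: mg|by move=> *; rewrite lee_fin|by rewrite lee_fin].
    by rewrite G1 -!EFinM normrM (ger0_norm K0); congr EFin; ring.
  rewrite ge0_integralZl.
  - by rewrite lte_mul_pinfty // lee_fin mulr_ge0 // ltW // Gamma_gt0.
  - exact: measurableT.
  - by apply/measurable_EFinP; mfun.
  - by move=> v _; rewrite lee_fin mulr_ge0 ?powR_ge0.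
  - by rewrite lee_fin mulr_ge0 // ltW // Gamma_gt0.
rewrite LK_outer.
have -> : (\int[mu]_t ((gamma_ker ((alpha - 1) / 2) t)%:E *
  intRd (fun l : 'rV[R]_d => (\prod_(i < d) gcone alpha k i (l ord0 i)) *
    (expR (- ((0 + \sum_i l ord0 i) ^+ 2 / t)))%:E)) = \int[mu]_t (\int[mu]_v f (t, v))%:E)%E.
  apply: eq_integral => t _; have [tp|t0] := ltP 0 t; last first.
    rewrite /gamma_ker ltNge t0 /= !mul0r mul0e; congr EFin.
    rewrite /Rintegral integral0_eq // => v _.
    by rewrite /f /gamma_ker /= ltNge t0 /= !mul0r mulr0.
  have [[iR iI] ->] := fourier_gcone k 0 tp.
  rewrite -EFinM; congr EFin; rewrite -RintegralZl //; last by apply: integrable_crot.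
  apply: eq_Rintegral => v _; rewrite /crot mulr0 cos0 sin0 mul0r subr0 mul1r ReZ -/(cone_fourierT k v).
  rewrite /f /= -/(W v) -(gamma_ker_sqrt alpha t) -/K.
  rewrite (_ : t / 4 * v ^+ 2 = t * (v ^+ 2 / 4)); last by ring.
  by rewrite /K; move: (gamma_ker _ _) (expR _) => a b; ring.
rewrite -(fineK (integrable_fin_num measurableT (integrable_Rintegral mf fy))); congr EFin.
rewrite -/(Rintegral mu setT (fun x => \int[mu]_v f (x, v))) (Rintegral_fubini mf fy).
apply: eq_Rintegral => v _; rewrite /f /= RintegralZl //.
- by rewrite /Rintegral G1 /= -/(W v) /K; ring.
- apply/integrableP; split; first exact: mg.
  by under eq_integral do rewrite gee0_abs ?lee_fin //; rewrite G1 ltry.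
Qed.

End fourier_inversion.

(** * The half-line transform of [q] *)

Section half_line_transform.
Variables (R : realType) (alpha : R).
Hypothesis alpha0 : 0 < alpha.
Local Notation mu := (@lebesgue_measure R).
Local Notation D0 := (`[0, +oo[%classic : set R).

Definition qr (x : R) : R := fine (qE alpha x).
Definition qh (x : R) : R := (0 <= x)%R%:R * qr x.

(** If the integral of [f] is infinite, [fine] makes both sides 0. *)
Lemma ge0_RintegralZl (c : R) (f : R -> R) : measurable_fun setT f -> (forall x, 0 <= f x) ->
  \int[mu]_x (c * f x) = c * \int[mu]_x f x.
Proof.
move=> mf f0.
have pos (a : R) : 0 <= a -> (\int[mu]_x (a * f x)%:E = a%:E * \int[mu]_x (f x)%:E)%E.
  move=> a0; under eq_integral do rewrite EFinM.
  rewrite ge0_integralZl //; first by apply/measurable_EFinP.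
  by move=> x _; rewrite lee_fin.
have fin (a : R) (y : \bar R) : (0 <= y)%E -> fine (a%:E * y)%E = a * fine y.
  case: y => [r| |] //= _; rewrite mulr0; have [->|a0] := eqVneq a 0; first by rewrite mul0e.
  by rewrite mulry; case: sgrP a0 => //= _ _; rewrite ?mul1e ?mulN1e.
have I0 : (0 <= \int[mu]_x (f x)%:E)%E by apply: integral_ge0 => x _; rewrite lee_fin.
rewrite /Rintegral; have [c0|c0] := leP 0 c; first by rewrite pos // fin.
have -> : (\int[mu]_x (c * f x)%:E = - \int[mu]_x (- c * f x)%:E)%E.
  rewrite -integral_ge0N; last by move=> x _; rewrite lee_fin mulr_ge0 // oppr_ge0 ltW.
  by apply: eq_integral => x _; rewrite -EFinN mulNr opprK.
by rewrite pos ?oppr_ge0 ?(ltW c0) // fineN fin // mulNr opprK.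
Qed.

Lemma measurable_qr : measurable_fun setT qr.
Proof. exact: (measurableT_comp (@fine_measurable R setT measurableT) (measurable_qE alpha)). Qed.

Lemma integrable_qr : mu.-integrable setT (EFin \o qr).
Proof.
have i : mu.-integrable setT (qE alpha).
  apply/integrableP; split; first exact: measurable_qE.
  by under eq_integral do rewrite gee0_abs ?qE_ge0 //; rewrite integral_qE ?ltry.
apply: (le_integrable _ _ _ i) => //; first by apply/measurable_EFinP; exact: measurable_qr.
by move=> x _; rewrite /= /qr; case: (qE _ _) => [r| |] //=; rewrite ?lexx ?normr0 ?leey.
Qed.

Lemma qrN x : qr (- x) = qr x.
Proof. by rewrite /qr /qE; under eq_integral do rewrite /qker sqrrN. Qed.

Let gh (h : R -> R) (a : R) : R := \int[mu]_(y in D0) (expR (- y ^+ 2) * h (a * y)).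

(** The mixture is moved outside and [x = sqrt t * y] substituted; the Jacobian [sqrt t] is absorbed
    by [gamma_ker_sqrt]. A general bounded [h] covers cosine and sine at once. *)
Lemma trig_qh (h : R -> R) (v : R) : measurable_fun setT h -> (forall x, `|h x| <= 1) ->
  \int[mu]_x (h (v * x) * qh x) = \int[mu]_t (gamma_ker (alpha / 2) t * gh h (v * Num.sqrt t)).
Proof.
move=> mh h1.
pose f (z : R * R) := h (v * z.1) * (0 <= z.1)%R%:R * qker alpha z.2 z.1.
have k1 : measurable_fun setT (fun z : R * R => h (v * z.1)).
  by apply: (measurableT_comp mh); mfun.
have k2 : measurable_fun setT (fun z : R * R => qker alpha z.2 z.1) by apply: mfun_qker; mfun.
have mf : measurable_fun setT f by rewrite /f; mfun.
have mq (x : R) : measurable_fun setT (fun t : R => qker alpha t x) by apply: mfun_qker; mfun.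
have fy : (\int[mu]_x \int[mu]_t `|f (x, t)|%:E < +oo)%E.
  apply: (@le_lt_trans _ _ (\int[mu]_x qE alpha x)%E); last by rewrite integral_qE ?ltry.
  apply: ge0_le_integral => //.
  - by move=> x _; apply: integral_ge0 => t _; rewrite lee_fin.
  - apply: (measurable_fun_fubini_tonelli_F (m2 := mu) (fun z : R * R => `|f z|%:E)).
      by apply/measurable_EFinP; mfun.
    by move=> z; rewrite lee_fin.
  - exact: measurable_qE.
  - move=> x _; apply: ge0_le_integral => //.
    + have a1 : measurable_fun setT (fun t : R => f (x, t)).
        by rewrite /f /=; apply: mfun_mul => //; exact: measurable_cst.
      by apply/measurable_EFinP; exact: mfun_norm.
    + by apply/measurable_EFinP; exact: mq.
    + move=> t _; rewrite lee_fin /f /= normrM (ger0_norm (qker_ge0 _ _ _)).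
      rewrite ler_piMl ?qker_ge0 // normrM mulr_ile1 //.
      by case: (0 <= x); rewrite ?normr1 ?normr0.
transitivity (\int[mu]_x \int[mu]_t f (x, t)).
  apply: eq_Rintegral => x _; rewrite /f /= ge0_RintegralZl //; first by rewrite mulrA.
  by move=> t; exact: qker_ge0.
rewrite Rintegral_fubini //; apply: eq_Rintegral => t _.
rewrite -gamma_ker_sqrt; have [tp|t0] := ltP 0 t; last first.
  rewrite /gamma_ker ltNge t0 /= !mul0r /Rintegral integral0_eq // => x _.
  by rewrite /f /qker /gamma_ker /= ltNge t0 /= !mul0r mulr0.
have st0 : 0 < Num.sqrt t by rewrite sqrtr_gt0.
pose F (y : R) := expR (- y ^+ 2) * h (v * Num.sqrt t * y).
have k3 : measurable_fun setT (fun y : R => h (v * Num.sqrt t * y)).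
  by apply: (measurableT_comp mh); mfun.
have mF : measurable_fun setT F by rewrite /F; mfun.
have iF : mu.-integrable D0 (EFin \o F).
  apply: (le_integrable _ _ _ (integrable_gcos 0)) => //.
    by apply/measurable_EFinP; exact: measurable_funTS.
  move=> y _; rewrite /= lee_fin mul0r cos0 mulr1 normrM ler_piMr //.
have c0 : 0 < (Num.sqrt t)^-1 by rewrite invr_gt0.
have := Rintegral_halfline_scale c0 mF iF; rewrite invrK => E.
rewrite -mulrA -/(gh h (v * Num.sqrt t)) -E Rintegral_halfline -RintegralZl //.
  apply: eq_Rintegral => x _; rewrite /f /qker /F /= exprMn exprVn sqr_sqrtr ?(ltW tp) //.
  have -> : v * Num.sqrt t * ((Num.sqrt t)^-1 * x) = v * x by field; rewrite gt_eqF.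
  rewrite [x ^+ 2 / t]mulrC; move: (h _) (expR _) (gamma_ker _ _) => a b c; ring.
have iT := integrable_scale (lt0r_neq0 c0) (integrable_halfline mF iF).
by apply: (eq_integrableT _ iT) => x; rewrite pmulr_rge0.
Qed.

Lemma fcos_qh v : fcos qh v = Num.sqrt pi / 2 * (Gamma (alpha / 2) * (1 + v ^+ 2 / 4) `^ (- (alpha / 2))).
Proof.
have a20 : 0 < alpha / 2 by rewrite divr_gt0.
rewrite /fcos trig_qh; [|by mfun|exact: norm_cos_le1].
transitivity (\int[mu]_t (Num.sqrt pi / 2 * (gamma_ker (alpha / 2) t * expR (- (t * (v ^+ 2 / 4)))))).
  apply: eq_Rintegral => t _; rewrite -[gh _ _]/(gcos (v * Num.sqrt t)) gcosE.
  have [tp|t0] := ltP 0 t; last by rewrite /gamma_ker ltNge t0 /= !mul0r mulr0.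
  rewrite exprMn sqr_sqrtr ?(ltW tp) // (_ : 4^-1 * (v ^+ 2 * t) = t * (v ^+ 2 / 4)); last by ring.
  by move: (expR _) (gamma_ker _ _) => a b; ring.
rewrite ge0_RintegralZl.
- by rewrite /Rintegral integral_gamma_ker_expR // divr_ge0 ?sqr_ge0.
- by apply: mfun_mul; [exact: measurable_gamma_ker|mfun].
- by move=> t; rewrite mulr_ge0 ?gamma_ker_ge0 ?expR_ge0.
Qed.

(** What a Gamma superposition of the Dawson integrals [gsin (v * sqrt t)] becomes once [t] is
    integrated out, up to the prefactor in [fsin_qh]. *)
Definition dawson (v : R) : R :=
  \int[mu]_(u in `[0, 1]) ((1 + v ^+ 2 / 4 * (1 - u ^+ 2)) `^ (- ((alpha + 1) / 2))).

Let mfun_in01 (e : measure_display) (T : measurableType e) (g : T -> R) : measurable_fun setT g ->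
  measurable_fun setT (fun x => (g x \in `[0, 1]%R)%:R : R).
Proof.
move=> mg; rewrite (_ : (fun x => _) = (fun x => ((0 <= g x) && (g x <= 1))%:R)); first by mfun.
by apply/funext => x; rewrite in_itv.
Qed.

Let gsinR (a : R) : gsin a = a / 2 *
  \int[mu]_u ((u \in `[0, 1]%R)%:R * expR (- (4^-1 * a ^+ 2 * (1 - u ^+ 2)))).
Proof.
rewrite -[LHS]/(fine (gsin a)%:E) -gsinE integral_itv_natbool -ge0_RintegralZl.
- by rewrite /Rintegral; congr fine; apply: eq_integral => u _; rewrite mulrCA.
- by apply: mfun_mul; [exact: mfun_in01|mfun].
- by move=> u; rewrite mulr_ge0 ?expR_ge0.
Qed.

(** By [gsinE], [gsin (v * sqrt t)] is [v / 2 * sqrt t] times an integral of exponentials over [u].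
    The root raises the shape to [(alpha + 1) / 2], and for fixed [u] the integral in [t] is a Gamma
    integral. *)
Lemma fsin_qh v : fsin qh v = v / 2 * Gamma ((alpha + 1) / 2) * dawson v.
Proof.
have a20 : 0 < (alpha + 1) / 2 by rewrite divr_gt0 // addr_gt0.
rewrite /fsin trig_qh; [|by mfun|exact: norm_sin_le1].
pose f (z : R * R) := v / 2 * ((z.2 \in `[0, 1]%R)%:R * (gamma_ker ((alpha + 1) / 2) z.1 *
  expR (- (z.1 * (v ^+ 2 / 4 * (1 - z.2 ^+ 2)))))).
have k1 : measurable_fun setT (fun z : R * R => gamma_ker ((alpha + 1) / 2) z.1).
  by apply: (measurableT_comp (measurable_gamma_ker _)).
have k2 : measurable_fun setT (fun z : R * R => ((z.2 \in `[0, 1]%R)%:R : R)).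
  by apply: mfun_in01; mfun.
have mf : measurable_fun setT f by rewrite /f; mfun.
have f0 (t u : R) : 0 <= (u \in `[0, 1]%R)%:R * (gamma_ker ((alpha + 1) / 2) t *
  expR (- (t * (v ^+ 2 / 4 * (1 - u ^+ 2))))).
  by apply: mulr_ge0 => //; rewrite mulr_ge0 ?gamma_ker_ge0 ?expR_ge0.
have v40 : 0 <= v ^+ 2 / 4 by rewrite divr_ge0 ?sqr_ge0.
have v4u (u : R) : u \in `[0, 1]%R -> 0 <= v ^+ 2 / 4 * (1 - u ^+ 2).
  by rewrite in_itv /= => /andP[u0 u1]; rewrite mulr_ge0 // subr_ge0 expr_le1.
transitivity (\int[mu]_t \int[mu]_u f (t, u)).
  apply: eq_Rintegral => t _.
  have [tp|t0] := ltP 0 t; last first.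
    rewrite /gamma_ker ltNge t0 /= !mul0r /Rintegral integral0_eq // => u _.
    by rewrite /f /gamma_ker /= ltNge t0 /= !mul0r !mulr0.
  rewrite -[gh _ _]/(gsin (v * Num.sqrt t)) gsinR exprMn sqr_sqrtr ?(ltW tp) //.
  have -> : 4^-1 * (v ^+ 2 * t) = t * (v ^+ 2 / 4) by ring.
  transitivity (\int[mu]_u (v / 2 * gamma_ker ((alpha + 1) / 2) t * ((u \in `[0, 1]%R)%:R *
      expR (- (t * (v ^+ 2 / 4 * (1 - u ^+ 2))))))).
    rewrite ge0_RintegralZl.
    - rewrite -(gamma_ker_sqrt (alpha + 1)) addrK.
      have -> : (fun u : R => (u \in `[0, 1]%R)%:R * expR (- (t * (v ^+ 2 / 4 * (1 - u ^+ 2))))) =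
         (fun u => (u \in `[0, 1]%R)%:R * expR (- (t * (v ^+ 2 / 4) * (1 - u ^+ 2)))).
        by apply/funext => u; rewrite mulrA.
      by move: (Rintegral _ _ _) (gamma_ker _ _) (Num.sqrt t) => a b c; ring.
    - by apply: mfun_mul; [exact: mfun_in01|mfun].
    - by move=> u; rewrite mulr_ge0 ?expR_ge0.
  apply: eq_Rintegral => u _; rewrite /f /=; move: (gamma_ker _ _) (expR _) => a b; ring.
rewrite Rintegral_fubini //; last first.
  (* For Fubini: the exponential is at most 1 on [[0, 1]], so the Gamma kernel dominates. *)
  have fE (t : R) : (\int[mu]_u `|f (t, u)|%:E <= (`|v / 2|%:E * (gamma_ker ((alpha + 1) / 2) t)%:E))%E.
    have [tp|t0] := ltP 0 t; last first.
      rewrite integral0_eq ?mule_ge0 ?lee_fin ?gamma_ker_ge0 // => u _.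
      by rewrite /f /gamma_ker /= ltNge t0 /= !mul0r !mulr0 normr0.
    apply: (@le_trans _ _ (\int[mu]_(u in `[0%R, 1%R]) (`|v / 2| * gamma_ker ((alpha + 1) / 2) t)%:E)%E).
      rewrite integral_itv_natbool; apply: ge0_le_integral => //.
      - apply/measurable_EFinP; apply: mfun_norm.
        have := @measurable_slice1 _ _ _ R R R (fun t u => f (t, u)) t; apply.
        by rewrite (_ : (fun p => _) = f) //; apply/funext => -[].
      - by apply/measurable_EFinP; apply: mfun_mul; [exact: mfun_in01|mfun].
      - move=> u _; rewrite lee_fin /f /= normrM (ger0_norm (f0 _ _)).
        case: (boolP (u \in `[0, 1]%R)) => u01; last by rewrite !mul0r mulr0.
        rewrite !mul1r ler_wpM2l // ler_piMr ?gamma_ker_ge0 //.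
        by rewrite -[leRHS]expR0 ler_expR oppr_le0 mulr_ge0 ?v4u // ltW.
    have m1 : (mu `[0%R, 1%R]%classic = 1)%E.
      by rewrite lebesgue_measure_itv /= lte_fin ltr01 -EFinB subr0.
    by rewrite integral_cst ?EFinM; [rewrite -[X in (_ * X)%E]/(mu `[0%R, 1%R]%classic) m1 mule1|].
  apply: (@le_lt_trans _ _ (\int[mu]_t (`|v / 2|%:E * (gamma_ker ((alpha + 1) / 2) t)%:E))%E).
    apply: ge0_le_integral => //.
    - by move=> t _; apply: integral_ge0 => u _; rewrite lee_fin.
    - apply: (measurable_fun_fubini_tonelli_F (m2 := mu) (fun z : R * R => `|f z|%:E)).
        by apply/measurable_EFinP; mfun.
      by move=> z; rewrite lee_fin.
    - by apply/measurable_EFinP; apply: mfun_mul; [mfun|exact: measurable_gamma_ker].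
  rewrite ge0_integralZl //.
  - by rewrite integral_gamma_ker // ltry.
  - by apply/measurable_EFinP; exact: measurable_gamma_ker.
  - by move=> t _; rewrite lee_fin gamma_ker_ge0.
have -> : dawson v = \int[mu]_u ((u \in `[0, 1]%R)%:R *
    (1 + v ^+ 2 / 4 * (1 - u ^+ 2)) `^ (- ((alpha + 1) / 2))).
  by rewrite /dawson /Rintegral integral_itv_natbool.
rewrite -ge0_RintegralZl.
- apply: eq_Rintegral => u _; rewrite /f /=.
  case: (boolP (u \in `[0, 1]%R)) => u01; last first.
    by rewrite !mul0r mulr0 /Rintegral integral0_eq // => t _; rewrite !mul0r mulr0.
  rewrite !mul1r ge0_RintegralZl.
  + under eq_Rintegral do rewrite mul1r.
    rewrite /Rintegral integral_gamma_ker_expR // ?v4u //= mulrA; ring.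
  + by apply: mfun_mul; [exact: measurable_cst|apply: mfun_mul; [exact: measurable_gamma_ker|mfun]].
  + by move=> t; apply: mulr_ge0 => //; rewrite mulr_ge0 ?gamma_ker_ge0 ?expR_ge0.
- by apply: mfun_mul; [exact: mfun_in01|mfun].
- by move=> u; rewrite mulr_ge0 ?powR_ge0.
Qed.

End half_line_transform.

(** * Derivative of the oriented integral *)

Section oriented_integral.
Variable R : realType.
Local Notation mu := (@lebesgue_measure R).

(** With a base point [p] to the left of both 0 and [x], the oriented integral is [P y - P 0] on
    either side of 0, so the one-sided fundamental theorem for [P] suffices. The segment [[p, u]]
    contains 0 and [x] and stays inside []a, b[]. *)
Lemma is_derive_oint (f : R -> R) (a b x : R) : a < 0 < b ->
  (forall y, a < y < b -> {for y, continuous f}) -> a < x < b ->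
  is_derive x (1 : R) (fun y => oint 0 y f) (f x).
Proof.
move=> /andP[a0 b0] cf /andP[ax xb].
pose p := (a + Num.min x 0) / 2; pose u := (b + Num.max x 0) / 2.
have am : a < Num.min x 0 by rewrite lt_min ax.
have bM : Num.max x 0 < b by rewrite gt_max xb.
have ap : a < p by rewrite /p midf_lt.
have ub : u < b by rewrite /u addrC midf_lt.
have pm : p < Num.min x 0 by rewrite /p midf_lt.
have Mu : Num.max x 0 < u by rewrite /u addrC midf_lt.
have /andP[px p0] : (p < x) && (p < 0) by rewrite -lt_min.
have /andP[xu u0] : (x < u) && (0 < u) by rewrite -gt_max.
have intf : mu.-integrable `[p, u] (EFin \o f).
  apply: continuous_compact_integrable; first exact: segment_compact.
  apply: continuous_in_subspaceT => y; rewrite inE /= in_itv /= => /andP[py yu].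
  by apply: cf; rewrite (lt_le_trans ap py) (le_lt_trans yu ub).
pose P y := \int[mu]_(t in `[p, y]) f t.
have sub y z : p <= y -> z <= u -> mu.-integrable `[y, z] (EFin \o f).
  move=> py zu; apply: integrableS intf; [exact: measurable_itv|exact: measurable_itv|].
  by apply: subset_itv; rewrite bnd_simp.
have PE y z : p <= y -> y <= z -> z <= u -> P z - P y = \int[mu]_(t in `[y, z]) f t.
  move=> py yz zu; rewrite /P Rintegral_itvB ?bnd_simp //; last exact: sub.
  rewrite Rintegral_itv_obnd_cbnd //; apply: integrableS (sub y z py zu);
    [exact: measurable_itv|exact: measurable_itv|].
  by apply: subset_itv; rewrite bnd_simp.
have [dP dPE] := continuous_FTC1_closed xu intf px (cf x ltac:(by rewrite ax xb)).
have iP : is_derive x (1 : R) P (f x) by apply: DeriveDef; [exact: dP|rewrite -derive1E; exact: dPE].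
have iS : is_derive x (1 : R) (fun y => P y - P 0) (f x).
  apply: (is_derive_eq (is_deriveB iP (is_derive_cst (P 0) x (1 : R)))).
  by rewrite subr0.
apply: (near_eq_is_derive (f := fun y => P y - P 0)) iS.
have : \forall y \near x, p < y < u by apply: near_in_itvoo; rewrite in_itv /= px.
apply: filterS => y /andP[py yu]; rewrite /oint.
case: leP => y0; first by rewrite PE // ltW.
by rewrite -PE ?opprB ?(ltW py) ?(ltW y0) ?(ltW u0).
Qed.

End oriented_integral.

(** * The half-line transform at [v = 2 tan x] *)

Section half_line_transform_tan.
Variables (R : realType) (alpha : R).
Hypothesis alpha0 : 0 < alpha.
Local Notation mu := (@lebesgue_measure R).

Definition secint (x : R) : R := oint 0 x (fun y => ct ((alpha + 1) / 2) * cos y `^ (- alpha)).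

Lemma continuous_cosX (p x : R) : - (pi / 2) < x < pi / 2 -> {for x, continuous (fun y : R => cos y `^ p)}.
Proof.
move=> xp; apply: (@continuous_comp _ _ _ (@cos R) (fun y : R => y `^ p)); first exact: continuous_cos.
by apply: continuous_powR_pos; exact: cos_gt0_pihalf.
Qed.

Lemma is_derive_secint x : - (pi / 2) < x < pi / 2 ->
  is_derive x (1 : R) secint (ct ((alpha + 1) / 2) * cos x `^ (- alpha)).
Proof.
move=> xp; apply: (@is_derive_oint R (fun y => ct ((alpha + 1) / 2) * cos y `^ (- alpha))
  (- (pi / 2)) (pi / 2)) => //.
  by rewrite oppr_lt0 divr_gt0 ?pi_gt0.
by move=> y yp; apply: cvgM; [exact: cvg_cst|exact: continuous_cosX].
Qed.

Let ge0_Rintegral01Zl (c : R) (f : R -> R) : measurable_fun setT f -> (forall u, 0 <= f u) ->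
  \int[mu]_(u in `[0, 1]) (c * f u) = c * \int[mu]_(u in `[0, 1]) f u.
Proof.
move=> mf f0; rewrite /Rintegral !integral_itv_natbool -!/(Rintegral mu setT _).
rewrite -ge0_RintegralZl.
- by apply: eq_Rintegral => u _; rewrite mulrCA.
- apply: mfun_mul => //.
  rewrite (_ : (fun x => _) = (fun x : R => ((0 <= x) && (x <= 1))%:R)); first by mfun.
  by apply/funext => u; rewrite in_itv.
- by move=> u; rewrite mulr_ge0.
Qed.

Let sin_sqr_lt1 (x : R) : - (pi / 2) < x < pi / 2 -> sin x ^+ 2 < 1.
Proof.
move=> /cos_gt0_pihalf c0; rewrite -[ltRHS](cos2Dsin2 x) ltrDr.
by rewrite exprn_gt0.
Qed.

(* The primitive [u |-> secint (asin (u sin x))] encodes the substitution [sin y = u sin x]. *)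
Lemma secint_integral x : - (pi / 2) < x < pi / 2 ->
  (\int[mu]_(u in `[0%R, 1%R]) (ct ((alpha + 1) / 2) * sin x *
    (1 - (u * sin x) ^+ 2) `^ (- ((alpha + 1) / 2)))%:E = (secint x)%:E)%E.
Proof.
move=> xp; have s1 := sin_sqr_lt1 xp.
have w1 u : 0 <= u <= 1 -> (u * sin x) ^+ 2 < 1.
  move=> /andP[u0 u1]; rewrite exprMn; apply: le_lt_trans s1.
  by rewrite ler_piMl ?sqr_ge0 // exprn_ile1.
have w2 u : 0 <= u <= 1 -> -1 < u * sin x < 1.
  by move=> /w1; move: (u * sin x) => a a1; apply/andP; split; nra.
have dl (u : R) : is_derive u (1 : R) (fun u => u * sin x) (sin x).
  have := is_deriveZ (sin x) (is_derive_id u (1 : R)).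
  rewrite /GRing.scale /= mulr1; congr (is_derive _ _ _ _).
  by apply/funext => z /=; rewrite mulrC.
transitivity ((secint (asin (1 * sin x)) - secint (asin (0 * sin x)))%:E); last first.
  rewrite mul1r sinK; last by rewrite in_itv /=; case/andP: xp => h1 h2; rewrite !ltW.
  rewrite mul0r -(@sin0 R) sinK; last by rewrite in_itv /= oppr_le0 divr_ge0 ?pi_ge0.
  by rewrite {2}/secint /oint lexx set_itv1 Rintegral_set1 subr0.
apply: (@integral_is_derive _ _ (fun u => secint (asin (u * sin x)))) => //.
- move=> u u01; have w := w2 u u01; have wl := w1 u u01.
  have w' : -1 <= u * sin x <= 1 by case/andP: w => a b; rewrite !ltW.
  have p0 : 0 < 1 - (u * sin x) ^+ 2 by rewrite subr_gt0.
  have as1 : - (pi / 2) < asin (u * sin x) < pi / 2.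
    by case/andP: w => a b; rewrite asin_gtNpi2 ?a ?(ltW b) // asin_ltpi2 // b (ltW a).
  have d1 := is_derive1_comp (g := fun u : R => u * sin x) (is_derive1_asin w) (dl u).
  have d2 := is_derive1_comp (g := fun u : R => asin (u * sin x)) (is_derive_secint as1) d1.
  apply: (is_derive_eq d2); rewrite cos_asin // -mulrA [RHS]mulrAC -mulrA; congr (_ * _).
  rewrite mulrA; congr (_ * _).
  rewrite -powR12_sqrt ?(ltW p0) // -powRN -powRrM -powRD; last by rewrite (gt_eqF p0) implybT.
  by congr (_ `^ _); field.
- move=> u u01; apply: cvgM; first exact: cvg_cst.
  apply: (@continuous_comp _ _ _ (fun u : R => 1 - (u * sin x) ^+ 2) (fun y : R => y `^ _)).
    apply: cvgB; first exact: cvg_cst.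
    by apply: cvgM; (apply: cvgM; [exact: cvg_id|exact: cvg_cst]).
  by apply: continuous_powR_pos; rewrite subr_gt0 w1.
Qed.

(** The identity [1 + tan^2 x * (1 - u^2) = (1 - u^2 sin^2 x) / cos^2 x] brings the integrand of
    [dawson] to that of [secint_integral]. *)
Lemma tan_dawson x : - (pi / 2) < x < pi / 2 ->
  ct ((alpha + 1) / 2) * (tan x * dawson alpha (2 * tan x)) = cos x `^ alpha * secint x.
Proof.
move=> xp; have c0 := cos_gt0_pihalf xp; have s1 := sin_sqr_lt1 xp.
have -> : secint x = ct ((alpha + 1) / 2) * sin x *
    \int[mu]_(u in `[0, 1]) ((1 - (u * sin x) ^+ 2) `^ (- ((alpha + 1) / 2))).
  rewrite -ge0_Rintegral01Zl; [|by mfun|by move=> u; exact: powR_ge0].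
  by rewrite -[LHS]/(fine (secint x)%:E) -secint_integral.
have -> : dawson alpha (2 * tan x) = cos x `^ (alpha + 1) *
    \int[mu]_(u in `[0, 1]) ((1 - (u * sin x) ^+ 2) `^ (- ((alpha + 1) / 2))).
  rewrite -ge0_Rintegral01Zl; [|by mfun|by move=> u; exact: powR_ge0].
  apply: eq_Rintegral => u; rewrite inE /= in_itv /= => /andP[u0 u1].
  have p0 : 0 < 1 - (u * sin x) ^+ 2.
    rewrite subr_gt0 exprMn; apply: le_lt_trans s1.
    by rewrite ler_piMl ?sqr_ge0 // exprn_ile1.
  have -> : 1 + (2 * tan x) ^+ 2 / 4 * (1 - u ^+ 2) = cos x `^ (-2) * (1 - (u * sin x) ^+ 2).
    have := cos2Dsin2 x => /(canRL (addKr _)) s2.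
    rewrite powRN powR_mulrn ?(ltW c0) // /tan !exprMn s2; field.
    by rewrite gt_eqF.
  rewrite powRM ?powR_ge0 ?(ltW p0) // -powRrM; congr (_ `^ _ * _); first by field.
rewrite powRD; last by rewrite (gt_eqF c0) implybT.
rewrite powRr1 ?(ltW c0) // /tan; move: (Rintegral _ _ _) (ct _) (cos x `^ alpha) => a b c.
by field; rewrite gt_eqF.
Qed.

Lemma ctE : Num.sqrt pi * Gamma (alpha / 2) * ct ((alpha + 1) / 2) = Gamma ((alpha + 1) / 2).
Proof.
have g0 : 0 < Gamma (alpha / 2) by rewrite Gamma_gt0 // divr_gt0.
have sp0 : 0 < Num.sqrt (pi : R) by rewrite sqrtr_gt0 pi_gt0.
rewrite /ct /ctd (_ : (alpha + 1) / 2 - 1%:R / 2 = alpha / 2); last by field.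
rewrite mul1r powR12_sqrt ?pi_ge0 //.
by move: (Gamma _) (Gamma (alpha / 2)) g0 (Num.sqrt pi) sp0 => a b b0 c c0; field; rewrite !gt_eqF.
Qed.

Lemma fourierT_qh_tan x : - (pi / 2) < x < pi / 2 ->
  fourierT (qh alpha) (2 * tan x) = (Num.sqrt pi * Gamma (alpha / 2) * cos x `^ alpha)%:C%C *
    Complex 2^-1 (secint x).
Proof.
move=> xp; have c0 := cos_gt0_pihalf xp.
rewrite /fourierT fcos_qh // fsin_qh // -ctE.
have -> : (1 + (2 * tan x) ^+ 2 / 4) `^ (- (alpha / 2)) = cos x `^ alpha.
  have -> : 1 + (2 * tan x) ^+ 2 / 4 = cos x `^ (-2).
    have := cos2Dsin2 x => /(canRL (addKr _)) s2.
    rewrite powRN powR_mulrn ?(ltW c0) // /tan !exprMn s2; field.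
    by rewrite gt_eqF.
  by rewrite -powRrM; congr (_ `^ _); field.
have := tan_dawson xp; move: (dawson _ _) (ct _) (secint x) (cos x `^ alpha) (Gamma _) => a b c e g h.
apply/eqP; rewrite eq_complex /=; apply/andP; split; apply/eqP; first by rewrite mul0r subr0; field.
rewrite mul0r addr0; transitivity (Num.sqrt pi * g * (b * (tan x * a))); first by field.
by rewrite h; ring.
Qed.

End half_line_transform_tan.

(** * Decay of the transforms and absolute convergence *)

Section transform_bounds.
Variables (R : realType) (d : nat) (alpha : R).
Hypothesis alpha0 : 0 < alpha.
Local Notation mu := (@lebesgue_measure R).

Lemma fine_gcone k i : fine \o gcone alpha k i = if (k <= i.+1)%N then qh alpha else qr alpha.
Proof.
apply/funext => x; rewrite /= /gcone /qh /qr; case: (k <= i.+1)%N => /=; last by rewrite mul1e.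
by case: (0 <= x); rewrite ?mul1e ?mul0e ?mul1r ?mul0r.
Qed.

Lemma fourierT_qr v : fourierT (qr alpha) v = (2 * fcos (qh alpha) v)%:C%C.
Proof.
have iq := integrable_qr alpha0.
rewrite /fourierT /real_complex_def; congr Complex.
- rewrite /fcos Rintegral_even; [|exact: integrable_fcos|by move=> x; rewrite mulrN cosN qrN].
  rewrite Rintegral_halfline; congr (_ * _); apply: eq_Rintegral => x _.
  by rewrite /qh mulrCA.
- rewrite /fsin Rintegral_odd //; first by apply: mfun_mul; [mfun|exact: measurable_qr].
  by move=> x; rewrite mulrN sinN qrN mulNr.
Qed.

Lemma prod_threshold (S : comPzRingType) (a b : S) k : (0 < k)%N ->
  \prod_(i < d) (if (k <= i.+1)%N then b else a) = a ^+ minn k.-1 d * b ^+ (d - k.-1).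
Proof.
move=> k0; elim: d => [|m IH]; first by rewrite big_ord0 minn0 sub0n !expr0 mulr1.
rewrite big_ord_recr /= IH; case: k k0 {IH} => // k _ /=; rewrite ltnS.
case: leqP => km.
- by rewrite (minn_idPl (leqW km)) subSn // exprSr mulrA.
- rewrite (minn_idPr km) mulrAC -exprSr.
  by move: (ltnW km) (km); rewrite -!subn_eq0 => /eqP -> /eqP ->.
Qed.

(** The exponent is [k.-1] because vertex 0, also in the face, is already accounted for by the
    Gaussian factor. *)
Lemma cone_fourierTE k v : (0 < k <= d.+1)%N -> cone_fourierT d alpha k v =
  (2 * fcos (qh alpha) v)%:C%C ^+ k.-1 * fourierT (qh alpha) v ^+ (d.+1 - k).
Proof.
move=> /andP[k0 kd]; rewrite /cone_fourierT.
transitivity (\prod_(i < d) (if (k <= i.+1)%N then fourierT (qh alpha) v else (2 * fcos (qh alpha) v)%:C%C)).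
  by apply: eq_bigr => i _; rewrite fine_gcone -fourierT_qr; case: ifP.
rewrite prod_threshold //; case: k k0 kd => // k _ kd /=.
by rewrite subSS (minn_idPl _).
Qed.

(** The l1 norm: submultiplicative and real-valued, whereas the modulus in [R[i]] is itself a
    complex number. *)
Let N1 (z : R[i]) : R := `|complex.Re z| + `|complex.Im z|.

Let N1_ge0 z : 0 <= N1 z. Proof. by rewrite addr_ge0. Qed.

Let N1M z w : N1 (z * w) <= N1 z * N1 w.
Proof.
case: z w => [a b] [c e]; rewrite /N1 /= mulrDl !mulrDr -!normrM.
apply: (@le_trans _ _ ((`|a * c| + `|b * e|) + (`|a * e| + `|b * c|))).
  by rewrite lerD ?ler_normB ?ler_normD.
by rewrite le_eqVlt; apply/orP; left; apply/eqP; ring.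
Qed.

Let N1X z n : N1 (z ^+ n) <= N1 z ^+ n.
Proof.
elim: n => [|n IH]; first by rewrite !expr0 /N1 /= normr1 normr0 addr0.
by rewrite !exprS; apply: le_trans (N1M _ _) _; rewrite ler_wpM2l.
Qed.

Let w (v : R) : R := 1 + v ^+ 2 / 4.

Let w_ge1 v : 1 <= w v. Proof. by rewrite lerDl divr_ge0 ?sqr_ge0. Qed.
Let w_gt0 v : 0 < w v. Proof. exact: lt_le_trans ltr01 (w_ge1 v). Qed.

(** The base of the power is at least 1, which permits lowering the exponent to [(1 + theta) / 2],
    and at least [w v * (1 - u)], the difference being [u + v^2 / 4 * u (1 - u)]. For [theta < 1]
    the remaining [(1 - u)^(- (1 + theta) / 2)] is integrable up to [u = 1], with integral
    [2 / (1 - theta)]. *)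
Lemma dawson_le (theta v : R) : 0 < theta -> theta <= alpha -> theta < 1 ->
  dawson alpha v <= w v `^ (- ((1 + theta) / 2)) * ((1 - theta) / 2)^-1.
Proof.
move=> t0 ta t1; pose s := (1 - theta) / 2; pose p := - ((1 + theta) / 2).
have s0 : 0 < s by rewrite divr_gt0 // subr_gt0.
have sp : s - 1 = p by rewrite /s /p; field.
pose g (t : R) : \bar R := ((t \in `]0, 1]%R)%:R * (t `^ (s - 1)))%:E.
have g0 t : (0 <= g t)%E by rewrite lee_fin mulr_ge0 ?powR_ge0.
have mg : measurable_fun setT g.
  apply/measurable_EFinP; apply: mfun_mul; last by mfun.
  rewrite (_ : (fun x => _) = (fun x : R => ((0 < x) && (x <= 1))%:R)); first by mfun.
  by apply/funext => u; rewrite in_itv.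
have gI : (\int[mu]_t g t <= (s^-1)%:E)%E by have := integral_powR01 s0; rewrite integral_itv_natbool.
have gI' : (\int[mu]_u g (-1 * u + 1)%R <= (s^-1)%:E)%E.
  have N1' : (-1 : R) != 0 by rewrite oppr_eq0 oner_eq0.
  by have := ge0_integral_affine 1 N1' mg g0; rewrite normrN1 mul1e => ->.
pose f (u : R) := (1 + v ^+ 2 / 4 * (1 - u ^+ 2)) `^ (- ((alpha + 1) / 2)).
have mf : measurable_fun setT f by rewrite /f; mfun.
have key : (\int[mu]_(u in `[0%R, 1%R]) (f u)%:E <= (w v `^ p * s^-1)%:E)%E.
  rewrite -integral_itv_bndo_bndc; last by apply/measurable_funTS/measurable_EFinP.
  rewrite integral_itv_natbool.
  apply: (@le_trans _ _ (\int[mu]_u ((w v `^ p)%:E * g (-1 * u + 1)%R))%E).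
    apply: ge0_le_integral => //.
    - by move=> u _; rewrite lee_fin mulr_ge0 ?powR_ge0.
    - apply/measurable_EFinP; apply: mfun_mul => //.
      rewrite (_ : (fun x => _) = (fun x : R => ((0 <= x) && (x < 1))%:R)); first by mfun.
      by apply/funext => u; rewrite in_itv.
    - apply: emeasurable_funM; first exact: measurable_cst.
      by apply: (measurableT_comp mg); mfun.
    - move=> u _; rewrite /g -EFinM lee_fin in_itv /= in_itv /= mulN1r addrC subr_gt0 lerBlDr lerDl [(u < 1) && _]andbC.
      case: andP => [[u0 u1]|_]; last by rewrite !mul0r mulr0.
      have u1' : 0 < 1 - u by rewrite subr_gt0.
      have b1 : 1 <= 1 + v ^+ 2 / 4 * (1 - u ^+ 2).
        by rewrite lerDl mulr_ge0 ?divr_ge0 ?sqr_ge0 // subr_ge0 expr_le1 // ltW.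
      have b2 : w v * (1 - u) <= 1 + v ^+ 2 / 4 * (1 - u ^+ 2).
        rewrite -subr_ge0 /w (_ : _ - _ = u + v ^+ 2 / 4 * (u * (1 - u))); last by ring.
        by rewrite addr_ge0 // mulr_ge0 ?divr_ge0 ?sqr_ge0 // mulr_ge0 // ltW.
      rewrite !mul1r sp -powRM ?(ltW (w_gt0 v)) ?(ltW u1') //.
      apply: (@le_trans _ _ ((1 + v ^+ 2 / 4 * (1 - u ^+ 2)) `^ p)).
        by rewrite ler_powR // /p lerN2 ler_pM2r ?invr_gt0 // addrC lerD2r.
      rewrite /p !powRN lef_pV2 ?posrE ?powR_gt0 ?mulr_gt0 //; last exact: lt_le_trans b1.
      rewrite ge0_ler_powR ?nnegrE //.
      + by rewrite divr_ge0 // addr_ge0 // ltW.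
      + by rewrite mulr_ge0 // ltW.
      + by rewrite (le_trans _ b1).
  rewrite ge0_integralZl //.
  - by rewrite EFinM lee_wpmul2l // lee_fin powR_ge0.
  - by apply: (measurableT_comp mg); mfun.
  - by rewrite lee_fin powR_ge0.
rewrite /dawson /Rintegral -lee_fin fineK //.
rewrite ge0_fin_numE; first exact: le_lt_trans key (ltry _).
by apply: integral_ge0 => u _; rewrite lee_fin powR_ge0.
Qed.

Lemma integral_cauchy (b : R) : 1 / 2 < b ->
  (\int[mu]_y ((1 + y ^+ 2) `^ (- b))%:E = ((ct b)^-1)%:E)%E.
Proof.
move=> b2; have h : (1%:R : R) / 2 < b by [].
have := intRd_betap h; rewrite /= => E.
rewrite /ct /ctd invf_div -E; apply: eq_integral => y _.
by rewrite enorm_sqr big_ord1 mxE; case: splitP => // j _; rewrite mxE !ord1 mulr1n.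
Qed.

Lemma integral_w (p : R) : 1 < p -> (\int[mu]_v (w v `^ (- (p / 2)))%:E < +oo)%E.
Proof.
move=> p1; have p2 : 1 / 2 < p / 2 by rewrite ltr_pM2r ?invr_gt0.
have e v : (w v `^ (- (p / 2)))%:E = ((1 + (2^-1 * v) ^+ 2) `^ (- (p / 2)))%:E.
  by rewrite /w; congr (_ `^ _)%:E; field.
under eq_integral do rewrite e.
rewrite (@ge0_integral_scale R 2^-1 (fun y => ((1 + y ^+ 2) `^ (- (p / 2)))%:E)).
- by rewrite integral_cauchy // -EFinM ltry.
- by rewrite invr_eq0 pnatr_eq0.
- by mfun.
- by move=> y; rewrite lee_fin powR_ge0.
Qed.

Let C1 : R := Num.sqrt pi / 2 * Gamma (alpha / 2).

Let C1_ge0 : 0 <= C1.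
Proof. by rewrite mulr_ge0 ?divr_ge0 ?sqrtr_ge0 // ltW // Gamma_gt0 // divr_gt0. Qed.

Let fcosE v : fcos (qh alpha) v = C1 * w v `^ (- (alpha / 2)).
Proof. by rewrite fcos_qh // mulrA. Qed.

(** The real part decays like [w^(- alpha / 2)]. The imaginary part multiplies [dawson] by
    [|v| / 2 <= sqrt w], which leaves [w^(- theta / 2)]. The cut of [qh] at 0 prevents a decay
    faster than [1 / |v|], whence [theta < 1]. *)
Let fourierT_le (theta v : R) : 0 < theta -> theta <= alpha -> theta < 1 ->
  N1 (fourierT (qh alpha) v) <=
  (C1 + Gamma ((alpha + 1) / 2) * ((1 - theta) / 2)^-1) * w v `^ (- (theta / 2)).
Proof.
move=> t0 ta t1; rewrite /N1 /= mulrDl; apply: lerD.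
  rewrite fcosE ger0_norm; last by rewrite mulr_ge0 ?powR_ge0.
  apply: ler_wpM2l => //; rewrite ler_powR ?w_ge1 //.
  by rewrite lerN2 ler_pM2r ?invr_gt0.
have G0 : 0 <= Gamma ((alpha + 1) / 2) by rewrite ltW // Gamma_gt0 // divr_gt0 // addr_gt0.
have d0 : 0 <= dawson alpha v by apply: Rintegral_ge0 => u _; exact: powR_ge0.
rewrite fsin_qh // !normrM (ger0_norm G0) (ger0_norm d0).
have vw : `|v| * `|2^-1| <= w v `^ (2^-1).
  rewrite -normrM powR12_sqrt ?(ltW (w_gt0 v)) // -sqrtr_sqr ler_wsqrtr // /w.
  by rewrite exprMn (_ : _ ^+ 2 / 4 = v ^+ 2 * 2^-1 ^+ 2) ?lerDr //; field.
apply: (@le_trans _ _ (w v `^ 2^-1 * Gamma ((alpha + 1) / 2) *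
    (w v `^ (- ((1 + theta) / 2)) * ((1 - theta) / 2)^-1))).
  apply: ler_pM; rewrite ?mulr_ge0 //; last exact: dawson_le.
  by rewrite ler_wpM2r.
have -> : w v `^ (- (theta / 2)) = w v `^ 2^-1 * w v `^ (- ((1 + theta) / 2)).
  rewrite -powRD; last by rewrite (gt_eqF (w_gt0 v)) implybT.
  by congr (_ `^ _); field.
move: (w v `^ 2^-1) (w v `^ _) (Gamma _) (((1 - theta) / 2)^-1) => a b c e.
by rewrite le_eqVlt; apply/orP; left; apply/eqP; ring.
Qed.

(** With [n = d + 1], vertex 0 and the [k - 1] other face vertices each give [w^(- alpha / 2)], the
    [n - k] remaining ones [w^(- theta / 2)]. As [w] grows like [v^2], the integral converges once
    [alpha k + theta (n - k) > 1]. *)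
Lemma cone_fourierT_lty k : (0 < k <= d.+1)%N -> 1 < alpha * d.+1%:R ->
  (\int[mu]_v (w v `^ (- (alpha / 2)) * `|complex.Re (cone_fourierT d alpha k v)|)%:E < +oo)%E.
Proof.
move=> /andP[k0 kd] an1.
(* For [alpha < 1] take [theta = alpha], which gives [alpha n]. For [alpha >= 1] take [1/2]: already
   [alpha k >= 1], and the second term is positive unless [k = n], where [alpha n > 1] applies
   directly. *)
have [theta [t0 ta t1 p1]] : exists theta : R, [/\ 0 < theta, theta <= alpha, theta < 1 &
    1 < alpha * k%:R + theta * (d.+1 - k)%:R].
  have [a1|a1] := ltP alpha 1.
    by exists alpha; split => //; rewrite -mulrDr -natrD subnKC.
  exists 2^-1; split => //; first by rewrite (le_trans _ a1) // invf_le1 ?ler1n.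
    by rewrite invf_lt1 ?ltr1n.
  have k1 : 1 <= k%:R :> R by rewrite ler1n.
  have [kd'|kd'] := ltnP k d.+1.
    have : 0 < 2^-1 * (d.+1 - k)%:R :> R by rewrite mulr_gt0 // ltr0n subn_gt0.
    have : 1 <= alpha * k%:R by rewrite mulr_ege1.
    lra.
  by move: an1; rewrite (_ : d.+1 = k) ?subnn ?mulr0 ?addr0 //; apply/eqP; rewrite eqn_leq kd kd'.
pose K := C1 + Gamma ((alpha + 1) / 2) * ((1 - theta) / 2)^-1.
have K0 : 0 <= K.
  rewrite addr_ge0 // mulr_ge0 //; first by rewrite ltW // Gamma_gt0 // divr_gt0 // addr_gt0.
  by rewrite invr_ge0 divr_ge0 // subr_ge0 ltW.
pose p := alpha * k%:R + theta * (d.+1 - k)%:R.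
pose M := (2 * C1) ^+ k.-1 * K ^+ (d.+1 - k).
have M0 : 0 <= M by apply: mulr_ge0; apply: exprn_ge0 => //; apply: mulr_ge0.
apply: (@le_lt_trans _ _ (\int[mu]_v (M%:E * (w v `^ (- (p / 2)))%:E))%E); last first.
  rewrite ge0_integralZl //.
  - by rewrite lte_mul_pinfty // integral_w.
  - by rewrite /w; mfun.
  - by move=> v _; rewrite lee_fin powR_ge0.
have mW := measurable_Re_cone_fourierT d alpha0 k.
apply: ge0_le_integral => //.
- by move=> v _; rewrite lee_fin mulr_ge0 ?powR_ge0.
- by apply/measurable_EFinP; apply: mfun_mul; [rewrite /w; mfun|apply: mfun_norm].
- by rewrite /w; mfun.
move=> v _; rewrite -EFinM lee_fin cone_fourierTE ?k0 // fcosE.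
have wp := w_gt0 v.
set A := ((2 * _)%:C)%C; set B := fourierT _ _.
have NA : N1 A = 2 * C1 * w v `^ (- (alpha / 2)).
  have h : 0 <= 2 * (C1 * w v `^ (- (alpha / 2))).
    by apply: mulr_ge0 => //; apply: mulr_ge0 => //; exact: powR_ge0.
  by rewrite /N1 /= normr0 addr0 (ger0_norm h) mulrA.
have NB := fourierT_le v t0 ta t1; rewrite -/B -/K in NB.
have Re_le z : `|complex.Re z| <= N1 z by rewrite lerDl.
apply: (@le_trans _ _ (w v `^ (- (alpha / 2)) * ((2 * C1 * w v `^ (- (alpha / 2))) ^+ k.-1 *
    (K * w v `^ (- (theta / 2))) ^+ (d.+1 - k)))).
  rewrite ler_wpM2l ?powR_ge0 //; apply: (le_trans (Re_le _)); apply: (le_trans (N1M _ _)).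
  apply: ler_pM => //; apply: (le_trans (N1X _ _)); first by rewrite NA.
  by rewrite lerXn2r ?nnegrE // mulr_ge0 ?powR_ge0.
have eX (x : R) m : (w v `^ x) ^+ m = w v `^ (x * m%:R).
  by rewrite -powR_mulrn ?powR_ge0 // -powRrM.
rewrite [(2 * C1 * _) ^+ _]exprMn [(K * _) ^+ _]exprMn !eX /M.
have -> : w v `^ (- (p / 2)) = w v `^ (- (alpha / 2)) * w v `^ (- (alpha / 2) * k.-1%:R) *
    w v `^ (- (theta / 2) * (d.+1 - k)%:R).
  rewrite -!powRD ?(gt_eqF wp) ?implybT //; congr (_ `^ _); rewrite /p.
  rewrite -{1}(prednK k0) -natr1; by move: (k.-1%:R) ((d.+1 - k)%:R) => x y; field.
by rewrite le_eqVlt; apply/orP; left; apply/eqP; ring.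
Qed.

End transform_bounds.

(** * The substitution [y = tan x] *)

Section tangent_substitution.
Variable R : realType.
Local Notation mu := (@lebesgue_measure R).
Local Notation I := (`](- (pi / 2)), (pi / 2)[%classic : set R).

Let continuous_atan' : continuous (derive1 (@atan R)).
Proof.
have -> : (derive1 (@atan R)) = (fun x => (1 + x ^+ 2)^-1) by apply/funext => x; exact: derive1_atan.
move=> x; apply: cvgV; first by rewrite gt_eqF // ltr_pwDl // sqr_ge0.
by apply: cvgD; [exact: cvg_cst|apply: cvgM; exact: cvg_id].
Qed.

(** [H] may be unbounded at the endpoints, as [cos^(alpha n - 2)] is for [alpha n < 2]. The
    substitution is therefore made on [[atan (-n), atan n]], followed by monotone convergence on
    both sides. *)
Lemma ge0_integral_tan (H : R -> R) : (forall x, 0 <= H x) ->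
  (forall x, - (pi / 2) < x < pi / 2 -> {for x, continuous H}) ->
  (\int[mu]_(x in I) (H x)%:E = \int[mu]_y (H (atan y) / (1 + y ^+ 2))%:E)%E.
Proof.
move=> H0 cH.
have at1 (y : R) : - (pi / 2) < atan y < pi / 2 by rewrite atan_gtNpi2 atan_ltpi2.
pose F (n : nat) : set R := `[atan (- n%:R), atan n%:R]%classic.
pose G (n : nat) : set R := `[- n%:R, n%:R]%classic.
have IF : I = \bigcup_n F n.
  apply/seteqP; split => x /=.
    rewrite in_itv /= => xp; exists (Num.trunc `|tan x|).+1 => //; rewrite /F /= in_itv /=.
    have xT : atan (tan x) = x by rewrite tanK // in_itv.
    have := ltW (truncnS_gt `|tan x|); rewrite ler_norml => /andP[h1 h2].
    by apply/andP; split; [rewrite -[leRHS]xT|rewrite -[leLHS]xT]; exact: le_atan.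
  move=> [n _]; rewrite /F /= !in_itv /= => /andP[h1 h2].
  by rewrite (lt_le_trans (atan_gtNpi2 _) h1) (le_lt_trans h2 (atan_ltpi2 _)).
have TG : setT = \bigcup_n G n.
  apply/seteqP; split => x //= _; exists (Num.trunc `|x|).+1 => //; rewrite /G /= in_itv /=.
  by rewrite -ler_norml ltW // truncnS_gt.
have mH : measurable_fun I H.
  apply: open_continuous_measurable_fun; first exact: interval_open.
  by move=> x; rewrite inE /= in_itv /= => xp; exact: cH.
have cHa : continuous (fun y : R => H (atan y)).
  move=> y; apply: (@continuous_comp _ _ _ (@atan R) H); first exact: continuous_atan.
  exact: cH.
have mHa : measurable_fun setT (fun y : R => H (atan y)) by exact: continuous_measurable_fun.
have mG : measurable_fun setT (fun y : R => (H (atan y) / (1 + y ^+ 2))%:E) by mfun.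
have h1 : (\int[mu]_(x in F i) (H x)%:E @[i --> \oo] --> \int[mu]_(x in I) (H x)%:E)%E.
  rewrite IF; apply: (@ge0_nondecreasing_set_cvg_integral _ (measurableTypeR R) R F (fun x => (H x)%:E) mu).
  - apply/nondecreasing_seqP => n; apply/subsetPset => x; rewrite /F /= !in_itv /= => /andP[a b].
    by rewrite (le_trans _ a) ?(le_trans b) // le_atan // ?lerN2 ler_nat.
  - by move=> n; exact: measurable_itv.
  - move=> n; apply/measurable_EFinP; apply: measurable_funS mH; first exact: measurable_itv.
    by rewrite IF; exact: bigcup_sup.
  - by move=> n x _; rewrite lee_fin.
have h2 : (\int[mu]_(x in G i) (H (atan x) / (1 + x ^+ 2))%:E @[i --> \oo] -->
    \int[mu]_x (H (atan x) / (1 + x ^+ 2))%:E)%E.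
  rewrite TG; apply: (@ge0_nondecreasing_set_cvg_integral _ (measurableTypeR R) R G
    (fun x => (H (atan x) / (1 + x ^+ 2))%:E) mu).
  - apply/nondecreasing_seqP => n; apply/subsetPset => x; rewrite /G /= !in_itv /= => /andP[a b].
    by rewrite (le_trans _ a) ?(le_trans b) // ?lerN2 ler_nat.
  - by move=> n; exact: measurable_itv.
  - by move=> n; exact: measurable_funTS.
  - by move=> n x _; rewrite lee_fin divr_ge0 // addr_ge0 // sqr_ge0.
have E n : (\int[mu]_(x in F n) (H x)%:E = \int[mu]_(x in G n) (H (atan x) / (1 + x ^+ 2))%:E)%E.
  rewrite /F (@integration_by_substitution_increasing R atan H (- n%:R) n%:R).
  - by apply: eq_integral => x _; rewrite /= fctE derive1_atan.
  - by rewrite -subr_ge0 opprK addr_ge0.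
  - by move=> x y _ _; exact: lt_atan.
  - by move=> x _; exact: continuous_atan'.
  - apply/cvg_ex; eexists; apply: cvg_at_right_filter; exact: continuous_atan'.
  - apply/cvg_ex; eexists; apply: cvg_at_left_filter; exact: continuous_atan'.
  - split.
    + by move=> x _; exact: derivable_atan.
    + by apply: cvg_at_right_filter; exact: continuous_atan.
    + by apply: cvg_at_left_filter; exact: continuous_atan.
  - apply: continuous_in_subspaceT => x; rewrite inE /= in_itv /= => /andP[a b].
    by apply: cH; rewrite (lt_le_trans (atan_gtNpi2 _) a) (le_lt_trans b (atan_ltpi2 _)).
move: h1; under eq_fun do rewrite E; move=> h1.
exact: (cvg_unique _ h1 h2).
Qed.

(** The positive and negative parts, written [(|r| + r) / 2] and [(|r| - r) / 2], remain continuous,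
    so the nonnegative case applies to each. *)
Lemma integral_tan (H : R -> R) :
  (forall x, - (pi / 2) < x < pi / 2 -> {for x, continuous H}) ->
  (\int[mu]_(x in I) (H x)%:E = \int[mu]_y (H (atan y) / (1 + y ^+ 2))%:E)%E.
Proof.
move=> cH.
have posE (r : R) : Order.max r%:E 0%E = ((`|r| + r) / 2)%:E.
  rewrite -EFin_max; congr EFin; case: (leP 0 r) => r0.
    by rewrite ger0_norm //; field.
  by rewrite ltr0_norm // addNr mul0r.
have negE (r : R) : Order.max (- r%:E)%E 0%E = ((`|r| - r) / 2)%:E.
  by rewrite -EFinN posE normrN.
have ge0p (r : R) : 0 <= (`|r| + r) / 2.
  by rewrite divr_ge0 // -lerBlDr sub0r -normrN ler_norm.
have ge0n (r : R) : 0 <= (`|r| - r) / 2 by rewrite -[r in `|r|]opprK normrN ge0p.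
rewrite integralE [RHS]integralE; congr (_ - _)%E.
- under eq_integral do rewrite funeposE posE.
  rewrite (@ge0_integral_tan (fun x => (`|H x| + H x) / 2)) //.
    apply: eq_integral => y _; rewrite funeposE posE; congr EFin.
    have p0 : 0 < 1 + y ^+ 2 by rewrite ltr_pwDl // sqr_ge0.
    rewrite normrM (gtr0_norm (x := (1 + y ^+ 2)^-1)) ?invr_gt0 //.
    by field; rewrite gt_eqF.
  move=> x xp; apply: cvgM; last exact: cvg_cst.
  by apply: cvgD; [apply: cvg_norm|]; exact: cH.
- under eq_integral do rewrite funenegE negE.
  rewrite (@ge0_integral_tan (fun x => (`|H x| - H x) / 2)) //.
    apply: eq_integral => y _; rewrite funenegE negE; congr EFin.
    have p0 : 0 < 1 + y ^+ 2 by rewrite ltr_pwDl // sqr_ge0.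
    rewrite normrM (gtr0_norm (x := (1 + y ^+ 2)^-1)) ?invr_gt0 //.
    by field; rewrite gt_eqF.
  move=> x xp; apply: cvgM; last exact: cvg_cst.
  by apply: cvgB; [apply: cvg_norm|]; exact: cH.
Qed.

End tangent_substitution.

(** * Identification of the expected angle *)

Section assembly.
Variables (R : realType) (d : nat) (alpha : R).
Hypothesis alpha0 : 0 < alpha.
Hypothesis an1 : 1 < alpha * d.+1%:R.
Local Notation mu := (@lebesgue_measure R).
Local Notation I := (`](- (pi / 2)), (pi / 2)[%classic : set R).
Local Notation an := (alpha * d.+1%:R).

Let cn : R := ct (an / 2).

Let an2 : 1 / 2 < an / 2. Proof. by rewrite ltr_pM2r ?invr_gt0. Qed.

Let cn_gt0 : 0 < cn.
Proof. by apply: ctd_gt0. Qed.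

Let Z (x : R) : R[i] := Complex 2^-1 (secint alpha x).

Definition angle_integrand (k : nat) (x : R) : R[i] :=
  (cn * cos x `^ (an - 2))%:C%C * Z x ^+ (d.+1 - k).

Let continuous_complexX (f g : R -> R) (x : R) m : {for x, continuous f} -> {for x, continuous g} ->
  {for x, continuous (fun y => complex.Re (Complex (f y) (g y) ^+ m))} /\
  {for x, continuous (fun y => complex.Im (Complex (f y) (g y) ^+ m))}.
Proof.
move=> cf cg; elim: m => [|m [IHr IHi]].
  by split; exact: cvg_cst.
have eR : (fun y => complex.Re (Complex (f y) (g y) ^+ m.+1)) = (fun y =>
    f y * complex.Re (Complex (f y) (g y) ^+ m) - g y * complex.Im (Complex (f y) (g y) ^+ m)).
  by apply/funext => y; rewrite exprS; case: (_ ^+ m).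
have eI : (fun y => complex.Im (Complex (f y) (g y) ^+ m.+1)) = (fun y =>
    f y * complex.Im (Complex (f y) (g y) ^+ m) + g y * complex.Re (Complex (f y) (g y) ^+ m)).
  by apply/funext => y; rewrite exprS; case: (_ ^+ m).
rewrite eR eI; split.
- by apply: cvgB; apply: cvgM.
- by apply: cvgD; apply: cvgM.
Qed.

Let continuous_secint x : - (pi / 2) < x < pi / 2 -> {for x, continuous (secint alpha)}.
Proof.
move=> xp; have := is_derive_secint alpha xp => h.
by apply/differentiable_continuous/derivable1_diffP; exact: ex_derive.
Qed.

Let ReZ (a : R) (z : R[i]) : complex.Re (a%:C%C * z) = a * complex.Re z.
Proof. by case: z => x y /=; rewrite mul0r subr0. Qed.

Let ImZ (a : R) (z : R[i]) : complex.Im (a%:C%C * z) = a * complex.Im z.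
Proof. by case: z => x y /=; rewrite mul0r addr0. Qed.

Let continuous_angle_integrand k x : - (pi / 2) < x < pi / 2 ->
  {for x, continuous (fun y => complex.Re (angle_integrand k y))} /\
  {for x, continuous (fun y => complex.Im (angle_integrand k y))}.
Proof.
move=> xp; have c2 : {for x, continuous (fun=> 2^-1 : R)} by exact: cvg_cst.
have [cr ci] := continuous_complexX (d.+1 - k) c2 (continuous_secint xp).
have cc : {for x, continuous (fun y : R => cn * cos y `^ (an - 2))}.
  by apply: cvgM; [exact: cvg_cst|exact: continuous_cosX].
have -> : (fun y => complex.Re (angle_integrand k y)) =
    (fun y => cn * cos y `^ (an - 2) * complex.Re (Z y ^+ (d.+1 - k))).
  by apply/funext => y; rewrite ReZ.
have -> : (fun y => complex.Im (angle_integrand k y)) =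
    (fun y => cn * cos y `^ (an - 2) * complex.Im (Z y ^+ (d.+1 - k))).
  by apply/funext => y; rewrite ImZ.
by split; apply: cvgM.
Qed.

(** Continuity may fail at the endpoints, where [cos] vanishes; they are a null set and are dropped
    before substituting. *)
Let RintegralI (f : R -> R) : (forall x, - (pi / 2) < x < pi / 2 -> {for x, continuous f}) ->
  \int[mu]_(x in `[(- (pi / 2)), (pi / 2)]) f x = \int[mu]_y (f (atan y) / (1 + y ^+ 2)).
Proof.
move=> cf.
have mf : measurable_fun I (EFin \o f).
  apply/measurable_EFinP; apply: open_continuous_measurable_fun; first exact: interval_open.
  by move=> x; rewrite inE /= in_itv /= => xp; exact: cf.
rewrite /Rintegral -(integral_tan cf) -integral_itv_bndo_bndc.
  by rewrite -integral_itv_obnd_cbnd.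
exact/emeasurable_fun_itv_obnd_cbndP.
Qed.

(** Oddness is read off [tan_dawson]: [dawson] is even and [tan] odd, so the oriented integral
    itself need not be reflected. *)
Lemma secintN x : - (pi / 2) < x < pi / 2 -> secint alpha (- x) = - secint alpha x.
Proof.
move=> xp; have xp' : - (pi / 2) < - x < pi / 2 by case/andP: xp => a b; rewrite ltrN2 b ltrNl a.
have c0 := cos_gt0_pihalf xp; have p0 : 0 < cos x `^ alpha by rewrite powR_gt0.
apply: (mulfI (lt0r_neq0 p0)); rewrite mulrN -tan_dawson // -(cosN x) -tan_dawson //.
have -> : dawson alpha (2 * tan (- x)) = dawson alpha (2 * tan x).
  by rewrite /dawson tanN mulrN sqrrN.
by rewrite tanN mulNr mulrN.
Qed.

Lemma Im_angle_integrand k :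
  \int[mu]_(x in `[(- (pi / 2)), (pi / 2)]) complex.Im (angle_integrand k x) = 0.
Proof.
have ch := fun x xp => (@continuous_angle_integrand k x xp).2.
rewrite RintegralI //.
(* By oddness of [secint], [Z (- x)] is the conjugate of [Z x]; powers commute with conjugation, so
   the imaginary part of the integrand is odd. *)
have conjX (a b : R) m : complex.Im (Complex a (- b) ^+ m) = - complex.Im (Complex a b ^+ m) /\
    complex.Re (Complex a (- b) ^+ m) = complex.Re (Complex a b ^+ m).
  elim: m => [|m [i r]]; first by rewrite !expr0 /= oppr0.
  move: i r; rewrite !exprS; case: (Complex a (- b) ^+ m) => e f; case: (Complex a b ^+ m) => e' f' /= -> ->.
  by split; ring.
apply: Rintegral_odd.
- apply: continuous_measurable_fun => y; apply: cvgM.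
    apply: (@continuous_comp _ _ _ (@atan R) (fun x => complex.Im (angle_integrand k x))).
      exact: continuous_atan.
    by apply: ch; rewrite atan_gtNpi2 atan_ltpi2.
  apply: cvgV; first by rewrite gt_eqF // ltr_pwDl // sqr_ge0.
  by apply: cvgD; [exact: cvg_cst|apply: cvgM; exact: cvg_id].
- move=> y; rewrite sqrrN atanN !ImZ /Z secintN ?atan_gtNpi2 ?atan_ltpi2 // cosN.
  by rewrite (conjX _ _ _).1 mulrN mulNr.
Qed.

Let pow_cos_atan (y p : R) : cos (atan y) `^ p = (1 + y ^+ 2) `^ (- (p / 2)).
Proof.
have p0 : 0 < 1 + y ^+ 2 by rewrite ltr_pwDl // sqr_ge0.
rewrite cos_atan -powR12_sqrt ?(ltW p0) // -powRN -powRrM; congr (_ `^ _); by field.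
Qed.

Lemma Re_angle_integrand_full :
  \int[mu]_(x in `[(- (pi / 2)), (pi / 2)]) complex.Re (angle_integrand d.+1 x) = 1.
Proof.
have ch := fun x xp => (@continuous_angle_integrand d.+1 x xp).1.
rewrite RintegralI //.
transitivity (\int[mu]_y (cn * (1 + y ^+ 2) `^ (- (an / 2)))).
  apply: eq_Rintegral => y _; rewrite /angle_integrand subnn expr0 mulr1 /= pow_cos_atan -mulrA.
  have p0 : 0 < 1 + y ^+ 2 by rewrite ltr_pwDl // sqr_ge0.
  congr (_ * _); rewrite -[(1 + y ^+ 2)^-1]powR_inv1 ?(ltW p0) // -powRD; last by rewrite (gt_eqF p0) implybT.
  by congr (_ `^ _); field.
rewrite ge0_RintegralZl; [|by mfun|by move=> y; exact: powR_ge0].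
by rewrite /Rintegral integral_cauchy //= -/cn divff // gt_eqF.
Qed.

(** At [v = 2 tan x] every transform is [G0 * cos x ^ alpha], times [Z x] when the vertex is outside
    the face; for face vertices the factor is [2 * Re (Z x) = 1]. Thus [k] enters only through
    [Z^(n - k)], and [C] is common to all [k]. *)
Lemma LK_angle_integrand : exists2 C : R, 0 < C & forall k, (0 < k <= d.+1)%N ->
  LK d alpha k = (C * \int[mu]_(x in `[(- (pi / 2)), (pi / 2)]) complex.Re (angle_integrand k x))%:E.
Proof.
(* [G / (2 sqrt pi)] is the prefactor of [LK_fourier], [G0 ^+ d] comes from the [d] vertices other
   than vertex 0, and [cn] compensates the normalisation built into [angle_integrand]. *)
pose G := Gamma (alpha / 2); pose G0 := Num.sqrt pi * G; pose C := G / (2 * Num.sqrt pi) * G0 ^+ d / cn.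
have a20 : 0 < alpha / 2 by rewrite divr_gt0.
have Gp : 0 < G by rewrite Gamma_gt0.
have sp : 0 < Num.sqrt (pi : R) by rewrite sqrtr_gt0 pi_gt0.
have C0 : 0 < C by rewrite divr_gt0 // mulr_gt0 ?divr_gt0 ?mulr_gt0 // exprn_gt0 // mulr_gt0.
(* The factor 2 is the Jacobian of [v = 2 y]. *)
exists (2 * C); first by rewrite mulr_gt0.
move=> k kd; have ch := fun x xp => (@continuous_angle_integrand k x xp).1.
rewrite RintegralI // (LK_fourier alpha0 (cone_fourierT_lty alpha0 kd an1)); congr EFin.
pose Q (v : R) : R := G / (2 * Num.sqrt pi) *
  ((1 + v ^+ 2 / 4) `^ (- (alpha / 2)) * complex.Re (cone_fourierT d alpha k v)).
have mW := measurable_Re_cone_fourierT d alpha0 k.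
have iQ : mu.-integrable setT (EFin \o Q).
  have -> : EFin \o Q = (fun v => (G / (2 * Num.sqrt pi))%:E *
    ((1 + v ^+ 2 / 4) `^ (- (alpha / 2)) * complex.Re (cone_fourierT d alpha k v))%:E)%E by [].
  apply: integrableZl => //; apply/integrableP; split; first by apply/measurable_EFinP; mfun.
  under eq_integral do rewrite abse_EFin normrM (ger0_norm (powR_ge0 _ _)).
  exact: cone_fourierT_lty.
have two0 : (2 : R) != 0 by rewrite pnatr_eq0.
have E y : complex.Re (angle_integrand k (atan y)) / (1 + y ^+ 2) = C^-1 * Q (2 * y).
  have xp : - (pi / 2) < atan y < pi / 2 by rewrite atan_gtNpi2 atan_ltpi2.
  have p0 : 0 < 1 + y ^+ 2 by rewrite ltr_pwDl // sqr_ge0.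
  have fT := fourierT_qh_tan alpha0 xp; rewrite atanK in fT.
  have fc : 2 * fcos (qh alpha) (2 * y) = G0 * cos (atan y) `^ alpha.
    by have := congr1 (@complex.Re R) fT; rewrite ReZ /= => ->; rewrite -/G0; field.
  have kE : (k.-1 + (d.+1 - k) = d)%N by case: (k) kd => //= k' kd'; rewrite subSS subnKC.
  have cE : cone_fourierT d alpha k (2 * y) =
      ((G0 * cos (atan y) `^ alpha) ^+ d)%:C%C * Z (atan y) ^+ (d.+1 - k).
    by rewrite cone_fourierTE // fc fT -/G0 [(_ * Complex _ _) ^+ _]exprMn [LHS]mulrA -exprD kE rmorphXn.
  have -> : Q (2 * y) = G / (2 * Num.sqrt pi) * (cos (atan y) `^ alpha *
      ((G0 * cos (atan y) `^ alpha) ^+ d * complex.Re (Z (atan y) ^+ (d.+1 - k)))).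
    have -> : Q (2 * y) = G / (2 * Num.sqrt pi) * (cos (atan y) `^ alpha *
        complex.Re (cone_fourierT d alpha k (2 * y))).
      by rewrite /Q pow_cos_atan; congr (_ * (_ `^ _ * _)); field.
    by rewrite cE ReZ.
  rewrite ReZ exprMn pow_cos_atan pow_cos_atan.
  set u := 1 + y ^+ 2; set z := complex.Re _.
  (* As [u = cos^(-2)] at [atan y], the [- 2] in the exponent yields one more factor [u], which the
     Jacobian [1 / u] cancels. *)
  have -> : u `^ (- ((an - 2) / 2)) = u * (u `^ (- (alpha / 2)) * u `^ (- (alpha / 2)) ^+ d).
    rewrite -exprS -powR_mulrn ?powR_ge0 // -powRrM -[X in _ = X * _](powRr1 (ltW (p0 : 0 < u))) -powRD.
      by congr (_ `^ _); rewrite -/u; field.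
    by rewrite (gt_eqF p0) implybT.
  have G00 : 0 < G0 ^+ d by rewrite exprn_gt0 // mulr_gt0.
  have field_id (a b g q h c : R) : 0 < g -> 0 < q -> 0 < h -> 0 < c -> 0 < u ->
      c * (u * (a * b)) * z / u = (h / (2 * q) * g / c)^-1 * (h / (2 * q) * (a * (g * b * z))).
    by move=> *; field; rewrite !gt_eqF.
  exact: field_id.
have iS := integrable_scale two0 iQ.
under [in RHS]eq_Rintegral do rewrite E.
rewrite -[LHS]/(\int[mu]_x Q x) (RintegralZl C^-1 measurableT iS) (Rintegral_scale two0 iQ) normr_nat.
by move: (\int[mu]_x Q x) => J; field; rewrite gt_eqF.
Qed.

Lemma expected_angle_integrand k : (0 < k <= d)%N ->
  fine (expected_angle d.+1 k ((alpha + d%:R) / 2)) =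
  \int[mu]_(x in `[(- (pi / 2)), (pi / 2)]) complex.Re (angle_integrand k x).
Proof.
move=> kd; have [C C0 LKE] := LK_angle_integrand.
have := expected_angle_LK alpha0 kd.
rewrite !LKE ?Re_angle_integrand_full ?mulr1; last 2 first.
- by case/andP: kd => -> /leqW.
- by rewrite /= leqnn.
(* The expectation is so far only an extended real; an infinite value times [C > 0] could not equal
   the finite right-hand side. *)
move: (Rintegral _ _ _) (expected_angle _ _ _) => J [e| |] /=.
- by rewrite -EFinM => -[]; rewrite mulrC => /(mulfI (lt0r_neq0 C0)).
- by rewrite gt0_mulye.
- by rewrite gt0_mulNye.
Qed.

End assembly.

Local Open Scope complex_scope.

Theorem theorem1p6 (R : realType) (alpha : R) (n k : nat) :
  0 < alpha -> (1 <= k <= n)%N -> 1 < alpha * n%:R ->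
  (Jt n k ((alpha + n%:R - 1) / 2))%:C =
  ('C(n, k)%:R)%:C *
  cintegral (- (pi / 2)) (pi / 2)
    (fun x : R =>
       (ct (alpha * n%:R / 2) * cos x `^ (alpha * n%:R - 2))%:C *
       (((1 / 2 : R))%:C
        + (@Complex R 0 1) * (oint 0 x (fun y => ct ((alpha + 1) / 2) * cos y `^ (- alpha)))%:C)
       ^+ (n - k)).
Proof.
move=> alpha0; case: n => [|d] /andP[k0 kn] an1; first by move: kn; rewrite leqNgt k0.
have -> : (fun x : R => (ct (alpha * d.+1%:R / 2) * cos x `^ (alpha * d.+1%:R - 2))%:C *
       (((1 / 2 : R))%:C
        + (@Complex R 0 1) * (oint 0 x (fun y => ct ((alpha + 1) / 2) * cos y `^ (- alpha)))%:C)
       ^+ (d.+1 - k)) = angle_integrand d alpha k.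
  apply/funext => x; rewrite /angle_integrand; congr (_ * _ ^+ _).
  by apply/eqP; rewrite eq_complex /= /secint; apply/andP; split; apply/eqP; ring.
rewrite /cintegral Im_angle_integrand // mulr0 addr0 -rmorphM /=; congr (_ %:C).
(* For [k = n] the left side is 1 by convention, and the right side is the normalised integral of
   [cos^(alpha n - 2)]. *)
rewrite /Jt; have [->|kd] := eqVneq k d.+1.
  by rewrite binn mul1r Re_angle_integrand_full.
rewrite -expected_angle_integrand ?k0 //; last by rewrite -ltnS ltn_neqAle kd kn.
by rewrite -natr1 addrA addrK.
Qed.
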